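(* Let $n\ge 2$ and let $M=\{F=0\}$ be a germ at $0\in\mathbb{C}^n$ of an irreducible singular real-analytic Levi-flat hypersurface such that $F(z)=\mathrm{Re}(z_1\cdots z_n)+H(z,\bar z)$, where $H$ is a germ of a real-valued real-analytic function with $H(z,\bar z)=O(|z|^{n+1})$. Let $M_{\mathbb{C}}$ be the complexification of $M$ and $\mathcal{L}_{\mathbb{C}}$ the complexification of its Levi foliation. Suppose that $$\mathrm{Sing}(M_{\mathbb{C}})=\bigcup_{\substack{1\le i<j\le n\\ 1\le k<\ell\le n}}V_{ijk\ell},\qquad V_{ijk\ell}=\{(z,w)\in\mathbb{C}^n\times\mathbb{C}^n: z_i=z_j=w_k=w_\ell=0\},$$ and that $\mathrm{Sing}(M_{\mathbb{C}})\subset\mathrm{Sing}(\mathcal{L}_{\mathbb{C}})$. Let $f(z)=z_1\cdots z_n+O(|z|^{n+1})$ be a germ of holomorphic function at $0\in\mathbb{C}^n$ that is a first integral of a germ of codimension-one holomorphic foliation $\mathcal{F}_M$ tangent to $M$ and satisfies $M=\{\mathrm{Re}(f)=0\}$. If $f$ is right equivalent to the product $z_1\cdots z_n$ of all coordinates, then there exist a germ of a volume-preserving biholomorphism $\Phi:(\mathbb{C}^n,0)\to(\mathbb{C}^n,0)$ and a germ of an automorphism (biholomorphism) $\Psi:(\mathbb{C},0)\to(\mathbb{C},0)$ such that $$\Phi(M)=\{\mathrm{Re}(\Psi(z_1\cdots z_n))=0\},$$ where $\Psi$, arising from the relation $f\circ\Phi^{-1}(z)=\Psi(z_1\cdots z_n)$,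 is uniquely determined by $f$ up to a sign (that is, up to replacing $\Psi(t)$ by $\Psi(-t)$).
   Context: Levi-flat hypersurfaces: let $F$ be a germ at $0\in\mathbb{C}^n$ of a real-valued real-analytic function and $M=\{F=0\}$ a germ of real codimension-one real-analytic subvariety. Put $\mathrm{Sing}(M)=\{F=0\}\cap\{dF=0\}$ and $M^*=M\setminus\mathrm{Sing}(M)$. The Levi distribution on $M^*$ is $L_p=\ker(\partial F(p))\subset T_pM^*=\ker(dF(p))$. $M$ is Levi-flat if this distribution is integrable in the sense of Frobenius; equivalently $\partial F\wedge\bar\partial F\wedge\partial\bar\partial F=0$ at all points of $M^*$. The resulting foliation $\mathcal{L}$ of $M^*$ by immersed complex hypersurfaces is the Levi foliation. $M$ is singular if $0\in\mathrm{Sing}(M)$. Writing $M=\{F=0\}$ irreducible means that $F$ is irreducible in the ring of germs at $0$ of real-valued real-analytic functions. Complexification: if $F(z)=\sum F_{\mu\nu}z^\mu\bar z^\nu$, then $F_{\mathbb{C}}(z,w)=\sum F_{\mu\nu}z^\mu w^\nu$, a germ of holomorphic function at $0\in\mathbb{C}^{2n}$; $M_{\mathbb{C}}=\{F_{\mathbb{C}}=0\}$, $\mathrm{Sing}(M_{\mathbb{C}})=M_{\mathbb{C}}\cap\{dF_{\mathbb{C}}=0\}$, $M_{\mathbb{C}}^*=M_{\mathbb{C}}\setminus\mathrm{Sing}(M_{\mathbb{C}})$. Let $\eta_{\mathbb{C}}=i\sum_{j=1}^n\big(\frac{\partial F_{\mathbb{C}}}{\partial z_j}dz_j-\frac{\partial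 F_{\mathbb{C}}}{\partial w_j}dw_j\big)$. The restriction $\eta_{\mathbb{C}}|_{M_{\mathbb{C}}^*}$ is integrable and defines the codimension-one holomorphic foliation $\mathcal{L}_{\mathbb{C}}$ on $M_{\mathbb{C}}^*$, with singular set the zero set of the 1-form $\eta_{\mathbb{C}}|_{M_{\mathbb{C}}^*}$. In the inclusion $\mathrm{Sing}(M_{\mathbb{C}})\subset\mathrm{Sing}(\mathcal{L}_{\mathbb{C}})$, $\mathrm{Sing}(\mathcal{L}_{\mathbb{C}})$ is understood as the closure of this zero set in $M_{\mathbb{C}}$. Foliations: a germ at $0\in\mathbb{C}^n$ of codimension-one holomorphic foliation $\mathcal{F}$ is given by a germ of holomorphic 1-form $\omega$ with $\omega\wedge d\omega=0$ whose zero set $\mathrm{Sing}(\mathcal{F})$ has codimension at least two. $\mathcal{F}$ is tangent to $M$ if the leaves of the Levi foliation $\mathcal{L}$ are (contained in) leaves of $\mathcal{F}$. A germ of non-constant holomorphic function $f$ is a first integral of $\mathcal{F}$ if its level hypersurfaces contain the leaves of $\mathcal{F}$, i.e. $\omega\wedge df=0$. Right equivalence: germs of holomorphic functions $f,g$ at $0\in\mathbb{C}^n$ are right equivalent, $f\sim_R g$, if there is a germ of biholomorphism $\phi:(\mathbb{C}^n,0)\to(\mathbb{C}^n,0)$ with $f\circ\phi^{-1}=g$. Volume-preserving: fix a holomorphic volume form $\Omega=a(z)\,dz_1\wedge\dots\wedge dz_n$, $a(0)\neq0$, near $0\in\mathbb{C}^n$. A coordinate system $(x_1,\dots,x_n)$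 is isochore (volume-preserving) if $\Omega=dx_1\wedge\dots\wedge dx_n$ in these coordinates. A germ of biholomorphism $\Phi:(\mathbb{C}^n,0)\to(\mathbb{C}^n,0)$ is volume-preserving if the coordinate system $x=\Phi(z)$ it induces is isochore (for $\Omega=dz_1\wedge\dots\wedge dz_n$: the Jacobian determinant of $\Phi$ is identically $1$). *)

(* Defs.v *)
From HB Require Import structures.
From mathcomp Require Import all_boot all_order all_algebra all_fingroup.
From mathcomp Require Import complex.
From mathcomp Require Import all_classical all_reals all_analysis.

Set Implicit Arguments.
Unset Strict Implicit.
Unset Printing Implicit Defensive.
Set Warnings "-redundant-canonical-projection".

Import Order.TTheory GRing.Theory Num.Theory.
Import numFieldNormedType.Exports.
Local Open Scope classical_set_scope.
Local Open Scope ring_scope.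
Local Open Scope complex_scope.

(** C^n is ['rV[R[i]]_n] for an arbitrary [R : realType]; a point (z, w) of
    C^n x C^n is [row_mx z w].  A germ at a point is represented by a total
    function (or set), and everything asserted of a germ is asserted on some
    neighbourhood of that point, through [\near]; values far from the base
    point are irrelevant.                                                     *)

(* same construction as the library's instance for an abstract numFieldType *)
HB.instance Definition _ (R : realType) := NormedModule.copy R[i] (R[i])^o.

Section PowerSeries.
Context (R : realType).
Local Notation C := R[i].

Definition mpow m (z : 'rV[C]_m) (mu : {ffun 'I_m -> nat}) : C :=
  \prod_(i < m) z 0 i ^+ mu i.

(* partial sum over the multi-indices with all entries < N *)
Definition box_sum m (a : {ffun 'I_m -> nat} -> C) (N : nat) : C :=
  \sum_(mu : {ffun 'I_m -> 'I_N}) a [ffun i => nat_of_ord (mu i)].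

(* absolute (hence order-independent) summability, with sum l *)
Definition sums_to m (a : {ffun 'I_m -> nat} -> C) (l : C) : Prop :=
  (exists B : R, forall N, box_sum (fun mu => `|a mu|) N <= B%:C) /\
  (box_sum a N @[N --> \oo] --> l).

Definition pseries_to m (c : {ffun 'I_m -> nat} -> C) (z : 'rV[C]_m) (l : C) :=
  sums_to (fun mu => c mu * mpow z mu) l.

(* the ring O_{n,p} of holomorphic germs as C{z_1 - p_1, ..., z_n - p_n} *)
Definition holo_at n (p : 'rV[C]_n) (f : 'rV[C]_n -> C) : Prop :=
  exists c, \forall z \near (0 : 'rV[C]_n), pseries_to c z (f (p + z)).

Definition holo_map_at n m (p : 'rV[C]_n) (f : 'rV[C]_n -> 'rV[C]_m) : Prop :=
  forall j, holo_at p (fun z => f z 0 j).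

Definition conj_rv n (z : 'rV[C]_n) : 'rV[C]_n := map_mx (@conjc R) z.

(* c_(mu,nu) is the coefficient of z^mu * conj(z)^nu *)
Definition real_expansion n (p : 'rV[C]_n) (c : {ffun 'I_(n + n) -> nat} -> C)
    (F : 'rV[C]_n -> R) : Prop :=
  \forall z \near (0 : 'rV[C]_n),
    pseries_to c (row_mx z (conj_rv z)) (F (p + z))%:C.

Definition ra_at n (p : 'rV[C]_n) (F : 'rV[C]_n -> R) : Prop :=
  exists c, real_expansion p c F.

(* F_C(z, w) = sum F_(mu,nu) z^mu w^nu *)
Definition complexification n (F : 'rV[C]_n -> R) (FC : 'rV[C]_(n + n) -> C) :=
  exists c, real_expansion 0 c F /\
    \forall x \near (0 : 'rV[C]_(n + n)), pseries_to c x (FC x).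

End PowerSeries.

Section RealHypersurfaces.
Context (R : realType) (n : nat).
Local Notation C := R[i].
Local Notation V := 'rV[C]_n.
Implicit Types (F G : V -> R) (g : V -> C) (p u v : V).

Definition ra_unit F : Prop :=
  exists G, ra_at 0 G /\ \forall z \near (0 : V), F z * G z = 1.

Definition ra_irreducible F : Prop :=
  [/\ ra_at 0 F, ~ (\forall z \near (0 : V), F z = 0), ~ ra_unit F &
      forall G K, ra_at 0 G -> ra_at 0 K ->
        (\forall z \near (0 : V), F z = G z * K z) -> ra_unit G \/ ra_unit K].

(* dF(p)(v), for the real differential on C^n = R^2n *)
Definition rdiff F p v : R := derive1 (fun t : R => F (p + t%:C *: v)) 0.

Definition rdiffC g p v : C :=
  rdiff (fun z => complex.Re (g z)) p v +i* rdiff (fun z => complex.Im (g z)) p v.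

(* Wirtinger derivatives d/dz_j = (d/dx_j - i d/dy_j)/2 and its conjugate *)
Definition dz (j : 'I_n) g p : C :=
  (rdiffC g p (delta_mx 0 j) - 'i * rdiffC g p ('i *: delta_mx 0 j)) / 2.
Definition dzb (j : 'I_n) g p : C :=
  (rdiffC g p (delta_mx 0 j) + 'i * rdiffC g p ('i *: delta_mx 0 j)) / 2.

(* deldelb is sum_(j,k) (d^2 g / dz_j dzbar_k) dz_j /\ dzbar_k at (u, v) *)
Definition del g p v : C := \sum_j dz j g p * v 0 j.
Definition delb g p v : C := \sum_j dzb j g p * (v 0 j)^*.
Definition deldelb g p u v : C :=
  \sum_j \sum_k dz j (dzb k g) p * (u 0 j * (v 0 k)^* - v 0 j * (u 0 k)^*).

Definition real_zero F : set V := [set p | F p = 0].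
Definition real_sing F : set V :=
  [set p | F p = 0 /\ forall v, rdiff F p v = 0].
Definition real_reg F : set V := real_zero F `\` real_sing F.

Definition real_smooth_hypersurface_at (A : set V) p : Prop :=
  exists G, [/\ ra_at p G, G p = 0, exists v, rdiff G p v <> 0 &
                \forall z \near p, A z <-> G z = 0].

(* dimension 2n-1 at 0: A has no interior near 0, but its smooth hypersurface
   points accumulate at 0 *)
Definition real_codim1 (A : set V) : Prop :=
  (\forall p \near (0 : V), ~ A° p) /\
  (forall U, nbhs (0 : V) U -> exists p : V, U p /\ real_smooth_hypersurface_at A p).

(* L_p = ker (del F(p)) *)
Definition levi_distribution F p : set V :=
  [set v | del (fun z => (F z)%:C) p v = 0].

(* del F /\ delbar F /\ del delbar F = 0 on M^*: the alternating sum is twice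
   the value of this 4-form at v *)
Definition levi_flat F : Prop :=
  let FF z := (F z)%:C in
  \forall p \near (0 : V), real_reg F p -> forall v : 'I_4 -> V,
    \sum_(s : 'S_4) (-1) ^+ s * (del FF p (v (s 0)) * delb FF p (v (s 1))
                                 * deldelb FF p (v (s 2)) (v (s 3))) = 0.

(** Leaves of a distribution D on a set S: the points joined to p inside S by
    a path whose velocity lies in D *)

Definition path_velocity (gam : R -> V) (t : R) : V :=
  \row_j (derive1 (fun s => complex.Re (gam s 0 j)) t +i*
          derive1 (fun s => complex.Im (gam s 0 j)) t).

Definition path_derivable (gam : R -> V) (t : R) : Prop :=
  forall j, derivable (fun s => complex.Re (gam s 0 j)) t 1 /\
            derivable (fun s => complex.Im (gam s 0 j)) t 1.

Definition leaf (S : set V) (D : V -> set V) p : set V :=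
  [set q | exists gam : R -> V, [/\ gam 0 = p, gam 1 = q &
     forall t, 0 <= t <= 1 ->
       [/\ S (gam t), path_derivable gam t & D (gam t) (path_velocity gam t)]]].

End RealHypersurfaces.

Section Complexified.
Context (R : realType) (n : nat).
Local Notation C := R[i].
Local Notation V2 := 'rV[C]_(n + n).
Implicit Types (FC : V2 -> C) (x v : V2).

Definition cplx_zero FC : set V2 := [set x | FC x = 0].
Definition cplx_sing FC : set V2 := [set x | FC x = 0 /\ forall v, 'D_v FC x = 0].
Definition cplx_reg FC : set V2 := cplx_zero FC `\` cplx_sing FC.

Definition eta_cplx FC x v : C :=
  'i * \sum_(j < n) ('D_(row_mx (delta_mx 0 j) 0) FC x * lsubmx v 0 j
                     - 'D_(row_mx 0 (delta_mx 0 j)) FC x * rsubmx v 0 j).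

(* closure in M_C of the zero set of eta_C restricted to M_C^* *)
Definition cplx_levi_sing FC : set V2 :=
  cplx_zero FC `&`
  closure [set x | cplx_reg FC x /\
                   forall v, 'D_v FC x = 0 -> eta_cplx FC x v = 0].

Definition V_ijkl (i j k l : 'I_n) : set V2 :=
  [set x | [/\ lsubmx x 0 i = 0, lsubmx x 0 j = 0,
               rsubmx x 0 k = 0 & rsubmx x 0 l = 0]].

Definition V_union : set V2 :=
  [set x | exists i j k l : 'I_n, [/\ (i < j)%N, (k < l)%N & V_ijkl i j k l x]].

End Complexified.

Section Foliations.
Context (R : realType) (n : nat).
Local Notation C := R[i].
Local Notation V := 'rV[C]_n.
Implicit Types (om : V -> V) (f : V -> C) (z u v : V).

(** The 1-form sum_j om_j dz_j is represented by the row [om] of its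
    coefficients. *)

Definition form_eval om z v : C := \sum_j om z 0 j * v 0 j.

(* d om (u, v), by Cartan's formula for constant vector fields u, v *)
Definition form_d om z u v : C :=
  'D_u (fun y => form_eval om y v) z - 'D_v (fun y => form_eval om y u) z.

(* om /\ d om = 0 near 0, as an alternating sum (twice the value of the form) *)
Definition form_integrable om : Prop :=
  \forall z \near (0 : V), forall v : 'I_3 -> V,
    \sum_(s : 'S_3) (-1) ^+ s * (form_eval om z (v (s 0))
                                 * form_d om z (v (s 1)) (v (s 2))) = 0.

Definition form_sing om : set V := [set z | om z = 0].

(* the germ at 0 of an analytic set A has dimension <= n-2: near 0 it contains
   no piece of a smooth complex hypersurface *)
Definition codim_ge2 (A : set V) : Prop :=
  \forall p \near (0 : V),
    ~ exists g, [/\ holo_at p g, g p = 0, exists v, 'D_v g p <> 0 &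
                    \forall z \near p, g z = 0 -> A z].

Definition foliation om : Prop :=
  [/\ holo_map_at 0 om, form_integrable om & codim_ge2 (form_sing om)].

(* the leaves of the Levi foliation of M^* are contained in leaves of om *)
Definition tangent_to om (F : V -> R) : Prop :=
  exists U, nbhs (0 : V) U /\ forall p, U p -> real_reg F p ->
    leaf (U `&` real_reg F) (levi_distribution F) p `<=`
    leaf (U `\` form_sing om) (fun z => [set v | form_eval om z v = 0]) p.

(* the last clause is om /\ df = 0 *)
Definition first_integral f om : Prop :=
  [/\ holo_at 0 f, ~ (exists c, \forall z \near (0 : V), f z = c) &
      \forall z \near (0 : V), forall u v,
        form_eval om z u * 'D_v f z - form_eval om z v * 'D_u f z = 0].

End Foliations.

Section Biholomorphisms.
Context (R : realType).
Local Notation C := R[i].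

(* Phii represents the inverse germ of Phi *)
Definition biholo n (Phi Phii : 'rV[C]_n -> 'rV[C]_n) : Prop :=
  [/\ holo_map_at 0 Phi, holo_map_at 0 Phii, Phi 0 = 0 /\ Phii 0 = 0,
      \forall z \near (0 : 'rV[C]_n), Phii (Phi z) = z &
      \forall z \near (0 : 'rV[C]_n), Phi (Phii z) = z].

(* C as C^1, so that biholo also covers automorphisms of (C, 0) *)
Definition rV1_map (psi : C -> C) : 'rV[C]_1 -> 'rV[C]_1 :=
  fun t => const_mx (psi (t 0 0)).

Definition automorphism1 (Psi : C -> C) : Prop :=
  exists Psii : C -> C, biholo (rV1_map Psi) (rV1_map Psii).

Definition right_equivalent n (f g : 'rV[C]_n -> C) : Prop :=
  exists Phi Phii, biholo Phi Phii /\
    \forall z \near (0 : 'rV[C]_n), f (Phii z) = g z.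

(* Omega = a dz_1 /\ ... /\ dz_n equals dx_1 /\ ... /\ dx_n for x = Phi(z) *)
Definition volume_preserving n (a : 'rV[C]_n -> C) (Phi : 'rV[C]_n -> 'rV[C]_n) :=
  \forall z \near (0 : 'rV[C]_n), \det (jacobian Phi z) = a z.

(* the germ at 0 of Phi(M /\ U) is that of X, for all small neighbourhoods U
   of 0; taking M whole would let far-away points of M interfere *)
Definition germ_image n (Phi : 'rV[C]_n -> 'rV[C]_n) (M X : set 'rV[C]_n) : Prop :=
  exists U0, nbhs (0 : 'rV[C]_n) U0 /\ forall U, nbhs (0 : 'rV[C]_n) U ->
    U `<=` U0 -> \forall z \near (0 : 'rV[C]_n), (Phi @` (M `&` U)) z <-> X z.

Definition coord_prod n (z : 'rV[C]_n) : C := \prod_(i < n) z 0 i.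

End Biholomorphisms.

(* Main.v *)
(** Write P for z_1 ... z_n. Through the right equivalence one may assume f = P, the
    volume form becoming b dz. The vector field E_k = z_k d/dz_k - z_o d/dz_o acts
    diagonally on monomials, so b = b_1 + E_k h with E_k b_1 = 0. A substitution
    (z_o, z_k) -> (z_o / u, u z_k) preserves P, and a suitable u turns b into b_1.
    Doing this for every k <> o leaves a density that is a function of P only, which
    is absorbed by z_o -> z_o mu(P). This map sends P to P mu(P) = Psi^-1(P).

    For the uniqueness, let X preserve the volume dz and satisfy P o X = L(P). Then X
    permutes the coordinate hyperplanes, X_s(j) = z_j u_j, so that, up to the
    permutation s, it is a composition of substitutions as above with
    z_o -> z_o mu(P), where L(t) = t mu(t). The substitutions do not change the
    coefficients of the powers of P in a density, so that L' = +-1. *)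
Require Import Defs.
From HB Require Import structures.
From mathcomp Require Import all_boot all_order all_algebra all_fingroup.
From mathcomp Require Import complex ring zify.
From mathcomp Require Import all_classical all_reals all_analysis.

Set Implicit Arguments.
Unset Strict Implicit.
Unset Printing Implicit Defensive.

Import Order.TTheory GRing.Theory Num.Theory.
Import numFieldNormedType.Exports.
Local Open Scope classical_set_scope.
Local Open Scope ring_scope.
Local Open Scope complex_scope.

(** * Unordered summation *)

Section Summation.
Context (R : realType).
Local Notation C := R[i].

(** All functions are handled through the coefficients of absolutely summable power series, so that
    a period over a torus becomes a diagonal coefficient. Two identities carry the proof. For the
    substitution T with multiplier u, the Jacobian is J = 1 + E_k(log u), and E_k(h o T) = J . (E_k
    h) o T. For existence, T must satisfy J . (b_1 o T) = b_1 + E_k h; as b_1 o T = b_1 and E_k b_1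
    = 0, this reads E_k(log u) = E_k(h / b_1), whence u = exp(h / b_1). For uniqueness, the same
    identities give J . (b o T) - b = E_k(b_1 log u + h o T - h) for every density b, and E_k kills
    diagonal monomials. Two solutions (Phi, Psi) and (Phi', Psi') are compared through X = Phi' o
    Phi^-1, for which L = Psi'^-1 o Psi. The substitutions contained in X have total Jacobian eps /
    L'(P), where eps is the sign of the permutation s. This is a function of P with the diagonal
    coefficients of 1, hence it is 1. An odd s accounts for Psi(-t). *)

Lemma ge0_ReE (x : C) : 0 <= x -> x = (complex.Re x)%:C.
Proof. by case: x => a b; rewrite lecE /= => /andP[/eqP -> _]. Qed.

Lemma le_eps_eq0 (x : C) : (forall e : C, 0 < e -> `|x| <= e) -> x = 0.
Proof.
move=> h; apply/eqP/negPn/negP => x0.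
have x0' : 0 < `|x| by rewrite normr_gt0.
have := h (`|x| / 2) (divr_gt0 x0' (ltr0Sn _ 1)).
by rewrite ler_pdivlMr// ger_pMr// (ler_nat _ 2 1).
Qed.

(* Norms on [R[i]] take their values in [R[i]], so all bounds and radii below are
   elements of [R[i]], necessarily real and nonnegative. *)
Definition abound (I : eqType) (a : I -> C) (B : C) :=
  forall s : seq I, uniq s -> \sum_(i <- s) `|a i| <= B.

(** Convergence along the net of finite subsets of [I], given as duplicate-free lists. No
    enumeration of the multi-indices has to be chosen, and sums can be reindexed and exchanged
    freely. *)
Definition summ (I : eqType) (a : I -> C) (l : C) :=
  forall e : C, 0 < e -> exists2 s0 : seq I, uniq s0 &
    forall s, uniq s -> {subset s0 <= s} -> `|\sum_(i <- s) a i - l| <= e.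

Lemma sum_subset (I : eqType) (a : I -> C) (s0 s : seq I) :
  uniq s0 -> uniq s -> {subset s0 <= s} ->
  \sum_(i <- s) a i = \sum_(i <- s0) a i + \sum_(i <- s | i \notin s0) a i.
Proof.
move=> u0 u h; rewrite (bigID (mem s0))/=; congr (_ + _).
rewrite -big_filter; apply: perm_big; apply: uniq_perm => //.
  exact: filter_uniq.
move=> i; rewrite mem_filter /=; apply/andP/idP => [[]//|h0].
by split=> //; exact: h.
Qed.

Lemma abound_ge0 (I : eqType) (a : I -> C) B : abound a B -> 0 <= B.
Proof. by move=> /(_ [::] isT); rewrite big_nil. Qed.

Lemma abound_at (I : eqType) (a : I -> C) B i : abound a B -> `|a i| <= B.
Proof. by move=> /(_ [:: i] isT); rewrite big_seq1. Qed.

Lemma abound_le (I : eqType) (a b : I -> C) B B' :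
  (forall i, `|a i| <= `|b i|) -> B <= B' -> abound b B -> abound a B'.
Proof.
move=> h BB hb s us; apply: (le_trans _ BB).
by apply: le_trans (hb s us); apply: ler_sum => i _.
Qed.

Lemma abound_add (I : eqType) (a b : I -> C) A B :
  abound a A -> abound b B -> abound (fun i => a i + b i) (A + B).
Proof.
move=> ha hb s us; apply: (le_trans (y := \sum_(i <- s) (`|a i| + `|b i|))).
  by apply: ler_sum => i _; exact: ler_normD.
by rewrite big_split/= lerD// ?ha ?hb.
Qed.

Lemma abound_scale (I : eqType) (a : I -> C) A k :
  abound a A -> abound (fun i => k * a i) (`|k| * A).
Proof.
move=> ha s us; under eq_bigr do rewrite normrM.
by rewrite -mulr_sumr ler_wpM2l ?ha.
Qed.

Lemma summ_ext (I : eqType) (a b : I -> C) l : a =1 b -> summ a l -> summ b l.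
Proof. by move=> /funext ->. Qed.

Lemma summ_uniq (I : eqType) (a : I -> C) l l' : summ a l -> summ a l' -> l = l'.
Proof.
move=> h h'; apply/eqP; rewrite -subr_eq0; apply/eqP/le_eps_eq0 => e e0.
have e2 : 0 < e / 2 by rewrite divr_gt0.
have [s u hs] := h _ e2; have [s' u' hs'] := h' _ e2.
pose t := undup (s ++ s').
have ut : uniq t by exact: undup_uniq.
have h1 := hs t ut; have h2 := hs' t ut.
have -> : l - l' = (\sum_(i <- t) a i - l') - (\sum_(i <- t) a i - l) by ring.
rewrite (splitr e); apply: le_trans (ler_normB _ _) _; apply: lerD.
  by apply: h2 => i hi; rewrite mem_undup mem_cat hi orbT.
by apply: h1 => i hi; rewrite mem_undup mem_cat hi.
Qed.

Lemma summ_add (I : eqType) (a b : I -> C) l m :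
  summ a l -> summ b m -> summ (fun i => a i + b i) (l + m).
Proof.
move=> h h' e e0.
have e2 : 0 < e / 2 by rewrite divr_gt0.
have [s u hs] := h _ e2; have [s' u' hs'] := h' _ e2.
exists (undup (s ++ s')); first exact: undup_uniq.
move=> t ut ht; rewrite big_split/=.
have -> : \sum_(i <- t) a i + \sum_(i <- t) b i - (l + m) =
  (\sum_(i <- t) a i - l) + (\sum_(i <- t) b i - m) by ring.
rewrite (splitr e); apply: le_trans (ler_normD _ _) _; apply: lerD.
  by apply: hs => // i hi; apply: ht; rewrite mem_undup mem_cat hi.
by apply: hs' => // i hi; apply: ht; rewrite mem_undup mem_cat hi orbT.
Qed.

Lemma summ0 (I : eqType) : summ (fun _ : I => 0) 0.
Proof. by move=> e e0; exists [::] => // s _ _; rewrite big1// subrr normr0 ltW. Qed.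

Lemma summ_scale (I : eqType) (a : I -> C) l k :
  summ a l -> summ (fun i => k * a i) (k * l).
Proof.
have [-> _|k0 h e e0] := eqVneq k 0.
  by rewrite mul0r; apply: summ_ext (@summ0 I) => i; rewrite mul0r.
have k0' : 0 < `|k| by rewrite normr_gt0.
have [s u hs] := h (e / `|k|) (divr_gt0 e0 k0').
exists s => // t ut ht.
rewrite -mulr_sumr -mulrBr normrM mulrC -ler_pdivlMr ?normr_gt0//.
exact: hs.
Qed.

Lemma summ_big (I : eqType) (J : Type) (s : seq J) (a : J -> I -> C) l :
  (forall j, summ (a j) (l j)) ->
  summ (fun i => \sum_(j <- s) a j i) (\sum_(j <- s) l j).
Proof.
move=> h; elim: s => [|j s ih].
  by rewrite big_nil; apply: summ_ext (@summ0 I) => i; rewrite big_nil.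
rewrite big_cons; apply: summ_ext (summ_add (h j) ih) => i.
by rewrite big_cons.
Qed.

Lemma summ_single (I : eqType) (i0 : I) (x : C) :
  summ (fun i => if i == i0 then x else 0) x.
Proof.
move=> e e0; exists [:: i0] => // s us /(_ i0 (mem_head _ _)) h.
rewrite (bigD1_seq i0)//= eqxx big1 ?addr0 ?subrr ?normr0 ?ltW//.
by move=> i /negPf ->.
Qed.

Lemma abound_single (I : eqType) (i0 : I) (x : C) :
  abound (fun i => if i == i0 then x else 0) `|x|.
Proof.
move=> s us; have [i0s|i0s] := boolP (i0 \in s).
  rewrite (bigD1_seq i0)//= eqxx big1 ?addr0//.
  by move=> i /negPf ->; rewrite normr0.
rewrite big_seq big1// => i si; case: eqP => [ii|_]; last by rewrite normr0.
by rewrite -ii si in i0s.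
Qed.

Lemma summ_bound (I : eqType) (a : I -> C) l B : abound a B -> summ a l -> `|l| <= B.
Proof.
move=> ha hl; rewrite -subr_ge0.
have hB e : 0 < e -> `|l| <= B + e.
  move=> e0; have [s us hs] := hl e e0.
  have -> : l = \sum_(i <- s) a i - (\sum_(i <- s) a i - l) by ring.
  apply: le_trans (ler_normB _ _) _; apply: lerD; last exact: hs.
  by apply: le_trans (ler_norm_sum _ _ _) _; exact: ha.
have B0 := abound_ge0 ha.
rewrite (ge0_ReE B0) (ge0_ReE (normr_ge0 l)) -raddfB/= lecR subr_ge0.
apply/ler_addgt0Pr => e e0; have := hB e%:C; rewrite ltcR => /(_ e0).
by rewrite (ge0_ReE B0) (ge0_ReE (normr_ge0 l)) -raddfD/= lecR.
Qed.

(** The order of [R[i]] is partial, so the supremum of the finite sums of norms is formed in [R],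
    through real parts. *)
Lemma abound_sup (I : eqType) (a : I -> C) B : abound a B ->
  exists2 S : R, abound a S%:C & forall e : C, 0 < e -> exists2 s0, uniq s0 &
    S%:C - e <= \sum_(i <- s0) `|a i|.
Proof.
move=> ha.
pose E := [set x : R | exists2 s, uniq s & x%:C = \sum_(i <- s) `|a i|].
have sumE s : (complex.Re (\sum_(i <- s) `|a i|))%:C = \sum_(i <- s) `|a i|.
  by rewrite -ge0_ReE// sumr_ge0.
have hE : has_sup E.
  split; first by exists 0; exists [::]; rewrite ?big_nil.
  exists (complex.Re B) => x [s us xE].
  by have := ha s us; rewrite -xE (ge0_ReE (abound_ge0 ha)) lecR.
exists (sup E) => [s us|e e0].
  rewrite -sumE lecR; apply: (ub_le_sup hE.2).
  by exists s => //; rewrite sumE.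
have Ee : e = (complex.Re e)%:C by apply: ge0_ReE; exact: ltW.
have e0' : 0 < complex.Re e by rewrite -ltcR -Ee.
have [x [s us xE] hx] := sup_adherent e0' hE.
by exists s => //; rewrite -xE Ee -raddfB lecR ltW.
Qed.

(** A finite list whose sum of norms is within [e] of the supremum leaves at most [e] to any list
    disjoint from it. *)
Lemma abound_tail (I : eqType) (a : I -> C) B : abound a B ->
  forall e, 0 < e -> exists2 s0, uniq s0 &
    abound (fun i => if i \in s0 then 0 else a i) e.
Proof.
move=> /abound_sup[S hS hs] e e0; have [s0 u0 h0] := hs e e0.
exists s0 => // s us.
rewrite (bigID (mem s0))/= big1 ?add0r; last by move=> i ->; rewrite normr0.
under eq_bigr => i /negPf -> do [].
rewrite -big_filter; set t := [seq i <- s | i \notin s0].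
have ut : uniq (s0 ++ t).
  rewrite cat_uniq u0 filter_uniq// andbT; apply/hasPn => i.
  by rewrite mem_filter => /andP[].
have := hS _ ut; rewrite big_cat/= -lerBrDl => /le_trans; apply.
by rewrite lerBlDr addrC -lerBlDr.
Qed.

Lemma summ_ge0_ex (I : eqType) (a : I -> C) B : (forall i, 0 <= a i) ->
  abound a B -> exists l, summ a l.
Proof.
move=> a0 /abound_sup[S hS hs]; exists S%:C => e e0.
have [s0 u0 h0] := hs e e0; exists s0 => // s us ss.
have aE (r : seq I) : \sum_(i <- r) `|a i| = \sum_(i <- r) a i.
  by apply: eq_bigr => i _; rewrite ger0_norm.
rewrite distrC ger0_norm; last by rewrite subr_ge0 -aE hS.
rewrite lerBlDr addrC -lerBlDr; apply: le_trans h0 _.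
by rewrite aE (sum_subset _ u0 us ss) lerDl sumr_ge0.
Qed.

(** The real part is the difference of the nonnegative families [|a i| + Re (a i)] and [|a i|], to
    which the monotone case applies. *)
Lemma summ_Re_ex (I : eqType) (a : I -> C) B : abound a B ->
  exists l, summ (fun i => (complex.Re (a i))%:C) l.
Proof.
move=> ha.
have hr i : `|(complex.Re (a i))%:C| <= `|a i|.
  by rewrite normc_def /= expr0n addr0 sqrtr_sqr; exact: normc_ge_Re.
have hn : abound (fun i => `|a i|) B.
  by apply: abound_le ha => // i; rewrite normr_id.
have [l hl] := summ_ge0_ex (fun i => normr_ge0 _) hn.
have [||l' hl'] := @summ_ge0_ex I (fun i => `|a i| + (complex.Re (a i))%:C) (B + B).
- move=> i; rewrite -lerBlDr sub0r; apply: le_trans (hr i).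
  by rewrite -normrN; apply: real_ler_norm; rewrite rpredN; apply/complex_realP; exists (complex.Re (a i)).
- by apply: abound_add => //; exact: abound_le hr _ ha.
exists (l' + (-1) * l).
by apply: summ_ext (summ_add hl' (summ_scale (-1) hl)) => i; ring.
Qed.

Lemma summ_ex (I : eqType) (a : I -> C) B : abound a B -> exists l, summ a l.
Proof.
move=> ha; have [l hl] := summ_Re_ex ha.
have [l' hl'] := summ_Re_ex (abound_scale (-'i) ha).
exists (l + 'i * l'); apply: summ_ext (summ_add hl (summ_scale 'i hl')) => i.
by case: (a i) => x y; rewrite /=; simpc.
Qed.

(** * Exchange of the order of summation *)

Section Fubini.
Variables (I J : eqType) (a : I -> J -> C) (M : I -> C) (Mt : C).
Hypotheses (hM : forall i, abound (a i) (M i)) (hMt : abound M Mt).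

(** Multiplying column [j] by the phase [th j], with [th j * col j = |col j|], turns a finite sum of
    the [|col j|] into the sum of a single family over [I], whose [i]-th term is at most [M i]. A
    zero column gets phase 0. *)
Lemma abound_col col : (forall j, summ (a^~ j) (col j)) -> abound col Mt.
Proof.
move=> hc s us.
pose th j := if col j == 0 then 0 else `|col j| / col j.
have thE j : th j * col j = `|col j|.
  rewrite /th; case: eqP => [->|/eqP c0]; first by rewrite mul0r normr0.
  by rewrite divfK.
have th1 j : `|th j| <= 1.
  rewrite /th; case: eqP => [_|/eqP c0]; first by rewrite normr0.
  by rewrite normrM normfV normr_id divff// normr_eq0.
have h : summ (fun i => \sum_(j <- s) th j * a i j) (\sum_(j <- s) th j * col j).
  by apply: (@summ_big I J s (fun j i => th j * a i j)) => j; exact: summ_scale.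
under [X in X <= _]eq_bigr do rewrite -thE.
rewrite -[X in X <= _]ger0_norm; last by apply: sumr_ge0 => j _; rewrite thE.
apply: summ_bound h; apply: abound_le hMt => // i.
rewrite [leRHS]ger0_norm ?(abound_ge0 (hM i))//.
apply: le_trans (ler_norm_sum _ _ _) _; apply: le_trans (hM i us).
by apply: ler_sum => j _; rewrite normrM ler_piMl.
Qed.

Lemma summ_col_ex : exists col, forall j, summ (a^~ j) (col j).
Proof.
have h j : exists l, summ (a^~ j) l.
  apply: summ_ex (abound_le _ (lexx Mt) hMt) => i.
  by rewrite [leRHS]ger0_norm ?(abound_ge0 (hM i))//; exact: abound_at.
by have [col hcol] := choice h; exists col.
Qed.

End Fubini.

(** Outside a finite set [s0] of rows the column sums have total norm at most [e / 3], by
    [abound_col], whatever finite set of columns is taken. Inside [s0] only finitely many row sums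
    have to be approximated. *)
Lemma summ_fubini (I J : eqType) (a : I -> J -> C) M Mt row col l :
  (forall i, abound (a i) (M i)) -> abound M Mt ->
  (forall i, summ (a i) (row i)) -> (forall j, summ (a^~ j) (col j)) ->
  summ row l -> summ col l.
Proof.
move=> hM hMt hr hc hl e e0.
have e3 : 0 < e / 3 by rewrite divr_gt0.
have [s1 u1 h1] := abound_tail hMt e3.
have [s2 u2 h2] := hl _ e3.
pose s0 := undup (s1 ++ s2).
have u0 : uniq s0 := undup_uniq _.
have s10 : {subset s1 <= s0} by move=> i hi; rewrite mem_undup mem_cat hi.
have s20 : {subset s2 <= s0} by move=> i hi; rewrite mem_undup mem_cat hi orbT.
have [t0 ut0 ht0] := @summ_big _ _ s0 a row hr _ e3.
exists t0 => // t ut tt.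
have hc' j : summ (fun i => if i \in s0 then 0 else a i j) (col j + (-1) * \sum_(i <- s0) a i j).
  have hs : summ (fun i => if i \in s0 then a i j else 0) (\sum_(i <- s0) a i j).
    move=> d d0; exists s0 => // s us ss.
    rewrite (sum_subset _ u0 us ss) [X in (_ + X) - _]big1 ?addr0; last by move=> i /negPf ->.
    rewrite [X in X - _]big_seq; under eq_bigr => i -> do [].
    by rewrite -big_seq subrr normr0 ltW.
  apply: summ_ext (summ_add (hc j) (summ_scale (-1) hs)) => i.
  by case: ifP => _; ring.
have hM' i : abound (fun j => if i \in s0 then 0 else a i j) (if i \in s0 then 0 else M i).
  case: ifP => _; last exact: hM.
  by move=> s us; rewrite big1// => j _; rewrite normr0.
have hMt' : abound (fun i => if i \in s0 then 0 else M i) (e / 3).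
  apply: abound_le h1 => // i; case: ifP => [_|]; first by rewrite normr0.
  by case: ifP => // /s10 ->.
have h3 := abound_col hM' hMt' hc' ut.
have -> : \sum_(j <- t) col j - l =
   \sum_(j <- t) (col j + -1 * \sum_(i <- s0) a i j)
   + ((\sum_(j <- t) \sum_(i <- s0) a i j - \sum_(i <- s0) row i)
   + (\sum_(i <- s0) row i - l)).
  by rewrite big_split/= -mulr_sumr; ring.
have -> : e = e / 3 + (e / 3 + e / 3) by field.
apply: le_trans (ler_normD _ _) (lerD _ _).
  exact: le_trans (ler_norm_sum _ _ _) h3.
by apply: le_trans (ler_normD _ _) (lerD _ _); [exact: ht0|exact: h2].
Qed.

Lemma abound_reindex (I J : eqType) (phi : J -> I) (a : I -> C) B :
  injective phi -> abound a B -> abound (a \o phi) B.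
Proof.
move=> phiI ha s us; have := ha (map phi s).
by rewrite big_map map_inj_uniq//; exact.
Qed.

Section Extend.
Variables (I J : eqType) (phi : J -> I) (a : I -> C) (b : J -> C) (B : C).
Hypotheses (phiI : injective phi) (ab : forall j, a (phi j) = b j).
Hypothesis (a0 : forall i, (forall j, i <> phi j) -> a i = 0).
Hypothesis (hb : abound b B).

(** The matrix supported on the graph of [phi] has row sums [b] and column sums [a], so that
    reindexing along an injection is a case of [summ_fubini]. *)
Let A j i := if i == phi j then b j else 0.

Let summA i : summ (A^~ i) (a i).
Proof.
have [[j ->]|ni] := pselect (exists j, i = phi j).
  rewrite ab; apply: summ_ext (summ_single j (b j)) => k.
  by rewrite /A (inj_eq phiI) eq_sym; case: eqP => // ->.
rewrite a0; last by move=> j ij; apply: ni; exists j.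
apply: summ_ext (@summ0 J) => j; rewrite /A; case: eqP => // ij.
by case: ni; exists j.
Qed.

Let boundA j : abound (A j) `|b j|. Proof. exact: abound_single. Qed.

Let bound_normb : abound (fun j => `|b j|) B.
Proof. by apply: abound_le hb => // i; rewrite normr_id. Qed.

Lemma abound_extend : abound a B.
Proof. by apply: (abound_col boundA bound_normb) => i; exact: summA. Qed.

Lemma summ_extend l : summ b l -> summ a l.
Proof.
apply: (@summ_fubini _ _ A _ B) boundA bound_normb _ summA => j.
exact: summ_single.
Qed.

End Extend.

End Summation.

(** * Power series on polydiscs *)

Section PolydiscSeries.
Context (R : realType).
Local Notation C := R[i].
Local Notation MI n := {ffun 'I_n -> nat}.

Definition polydisc n (r : C) (z : 'rV[C]_n) := forall i, `|z 0 i| <= r.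

Lemma near0P n (P : 'rV[C]_n -> Prop) :
  (\forall z \near (0 : 'rV[C]_n), P z) <->
  exists2 r : C, 0 < r & forall z, polydisc r z -> P z.
Proof.
split=> [/nbhs_ballP[e /= e0 he]|[r r0 hr]].
  exists (e / 2); first by rewrite divr_gt0.
  move=> z hz; apply: he; split=> // i j; rewrite !ord1 -ball_normE /= mxE sub0r normrN.
  by apply: le_lt_trans (hz j) _; rewrite ltr_pdivrMr// ltr_pMr// (ltr_nat _ 1 2).
apply/nbhs_ballP; exists r => // z hz; apply: hr => i.
by have := hz.2 0 i; rewrite -ball_normE /= mxE sub0r normrN => /ltW.
Qed.

Lemma polydisc0 n (r : C) : 0 <= r -> polydisc r (0 : 'rV[C]_n).
Proof. by move=> r0 i; rewrite mxE normr0. Qed.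

Lemma polydisc_le n (r r' : C) (z : 'rV[C]_n) : r <= r' -> polydisc r z -> polydisc r' z.
Proof. by move=> h hz i; apply: le_trans (hz i) h. Qed.

Definition mdeg n (al : MI n) : nat := \sum_i al i.
Definition mi0 n : MI n := [ffun=> 0%N].
Definition mi1 n (j : 'I_n) : MI n := [ffun i => (i == j : nat)].
Definition miadd n (al be : MI n) : MI n := [ffun i => (al i + be i)%N].
Definition misub n (al be : MI n) : MI n := [ffun i => (al i - be i)%N].

Lemma mdeg_add n (al be : MI n) : mdeg (miadd al be) = (mdeg al + mdeg be)%N.
Proof. by rewrite /mdeg -big_split; apply: eq_bigr => i _; rewrite ffunE. Qed.

Lemma mdeg0 n : mdeg (mi0 n) = 0%N.
Proof. by rewrite /mdeg big1// => i _; rewrite ffunE. Qed.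

Lemma mdeg1 n j : mdeg (@mi1 n j) = 1%N.
Proof.
rewrite /mdeg (bigD1 j)//= big1 ?ffunE ?eqxx// => i /negPf ij.
by rewrite ffunE ij.
Qed.

Lemma mdeg_eq0 n (al : MI n) : mdeg al = 0%N -> al = mi0 n.
Proof.
move=> h; apply/ffunP => i; rewrite ffunE; apply/eqP.
by rewrite -leqn0 -h /mdeg (bigD1 i)//= leq_addr.
Qed.

Lemma mpow_add n (z : 'rV[C]_n) al be : mpow z (miadd al be) = mpow z al * mpow z be.
Proof. by rewrite /mpow -big_split; apply: eq_bigr => i _; rewrite ffunE exprD. Qed.

Lemma mpow0 n (z : 'rV[C]_n) : mpow z (mi0 n) = 1.
Proof. by rewrite /mpow big1// => i _; rewrite ffunE. Qed.

Lemma mpow1 n (z : 'rV[C]_n) j : mpow z (mi1 j) = z 0 j.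
Proof.
rewrite /mpow (bigD1 j)//= big1 ?mulr1 ?ffunE ?eqxx ?expr1// => i /negPf ij.
by rewrite ffunE ij.
Qed.

Lemma mpow_zero n (al : MI n) : al != mi0 n -> mpow (0 : 'rV[C]_n) al = 0.
Proof.
move=> h; have [j hj] : exists j, al j != 0%N.
  apply/existsP; apply: contraR h; rewrite negb_exists => /forallP h.
  by apply/eqP/ffunP => i; rewrite ffunE; apply/eqP; move: (h i); rewrite negbK.
by rewrite /mpow (bigD1 j)//= mxE expr0n (negPf hj) mul0r.
Qed.

Lemma norm_mpow n (r : C) (z : 'rV[C]_n) al : 0 <= r -> polydisc r z ->
  `|mpow z al| <= r ^+ mdeg al.
Proof.
move=> r0 hz; rewrite /mpow /mdeg normr_prod expr_sum; apply: ler_prod => i _.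
by rewrite normr_ge0 normrX lerXn2r ?nnegrE// hz.
Qed.

Lemma miaddK n (al : MI n) : injective (miadd al).
Proof.
move=> b b' /ffunP h; apply/ffunP => i; have := h i.
by rewrite !ffunE => /addnI.
Qed.

Lemma misubK n (al be : MI n) : (forall i, be i <= al i)%N -> miadd be (misub al be) = al.
Proof. by move=> h; apply/ffunP => i; rewrite !ffunE subnKC. Qed.

(** [M] bounds the weighted l^1 norm, the sum of the [|c al| * r ^+ mdeg al], and not only the
    supremum of [f] on the polydisc. This norm is submultiplicative, is controlled under
    composition, and is read off the coefficients. *)
Definition ps n (r M : C) (c : MI n -> C) (f : 'rV[C]_n -> C) :=
  [/\ 0 < r, abound (fun al => c al * r ^+ mdeg al) M &
      forall z, polydisc r z -> summ (fun al => c al * mpow z al) (f z)].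

Definition hb n (r M : C) (f : 'rV[C]_n -> C) := exists c, ps r M c f.

Section Props.
Variable n : nat.
Implicit Types (f g : 'rV[C]_n -> C) (c : MI n -> C) (r M : C).

Lemma ps_abound r M c f z : ps r M c f -> polydisc r z ->
  abound (fun al => c al * mpow z al) M.
Proof.
move=> [r0 hc _] hz; apply: abound_le hc => // al.
rewrite !normrM ler_wpM2l//; apply: le_trans (norm_mpow _ (ltW r0) hz) _.
by rewrite normrX gtr0_norm.
Qed.

Lemma hb_norm r M f z : hb r M f -> polydisc r z -> `|f z| <= M.
Proof. by move=> [c hc] hz; apply: summ_bound (ps_abound hc hz) _; case: hc => _ _; exact. Qed.

Lemma hb_r0 r M f : hb r M f -> 0 < r. Proof. by case=> c []. Qed.
Lemma hb_M0 r M f : hb r M f -> 0 <= M. Proof. by case=> c [_ /abound_ge0]. Qed.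

Lemma hb_ext r M f g : (forall z, polydisc r z -> f z = g z) -> hb r M f -> hb r M g.
Proof. by move=> h [c [r0 hc hf]]; exists c; split=> // z hz; rewrite -h//; exact: hf. Qed.

Lemma hb_le r M r' M' f : 0 < r' -> r' <= r -> M <= M' -> hb r M f -> hb r' M' f.
Proof.
move=> r0' rr MM [c [r0 hc hf]]; exists c; split=> //.
  apply: abound_le MM hc => al; rewrite !normrM ler_wpM2l// !normrX lerXn2r ?nnegrE//.
  by rewrite !gtr0_norm.
by move=> z hz; apply: hf; exact: polydisc_le hz.
Qed.

Lemma ps_at0 r M c f : ps r M c f -> f 0 = c (mi0 n).
Proof.
move=> [r0 _ /(_ 0 (polydisc0 (ltW r0))) h]; apply: summ_uniq h _.
apply: summ_ext (summ_single (mi0 n) (c (mi0 n))) => al.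
case: eqP => [->|/eqP al0]; first by rewrite mpow0 mulr1.
by rewrite mpow_zero// mulr0.
Qed.

Lemma hb_const r k : 0 < r -> hb r `|k| (fun _ : 'rV[C]_n => k).
Proof.
move=> r0; exists (fun al => if al == mi0 n then k else 0); split=> //.
  apply: abound_le (abound_single (mi0 n) k) => // al.
  by case: eqP => [->|_]; rewrite ?mdeg0 ?mulr1 ?mul0r.
move=> z _; apply: summ_ext (summ_single (mi0 n) k) => al.
by case: eqP => [->|_]; rewrite ?mpow0 ?mulr1 ?mul0r.
Qed.

Lemma hb_add r M M' f g : hb r M f -> hb r M' g -> hb r (M + M') (fun z => f z + g z).
Proof.
move=> [c [r0 hc hf]] [d [_ hd hg]]; exists (fun al => c al + d al); split=> //.
  by apply: abound_le (abound_add hc hd) => // al; rewrite mulrDl.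
by move=> z hz; apply: summ_ext (summ_add (hf z hz) (hg z hz)) => al; rewrite mulrDl.
Qed.

Lemma hb_scale r M f k : hb r M f -> hb r (`|k| * M) (fun z => k * f z).
Proof.
move=> [c [r0 hc hf]]; exists (fun al => k * c al); split=> //.
  by apply: abound_le (abound_scale k hc) => // al; rewrite !mulrA.
by move=> z hz; apply: summ_ext (summ_scale k (hf z hz)) => al; rewrite !mulrA.
Qed.

(** Completeness of the weighted l^1 norm: by [summ_fubini] the coefficients of a normally
    convergent series of power series are the column sums of their coefficients. Products,
    compositions, inverses and limits of iterations are all instances. *)
Lemma hb_summ (I : eqType) (F : I -> 'rV[C]_n -> C) (M : I -> C) Mt g r : 0 < r ->
  (forall i, hb r (M i) (F i)) -> abound M Mt ->
  (forall z, polydisc r z -> summ (fun i => F i z) (g z)) -> hb r Mt g.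
Proof.
move=> r0 /choice[c hc] hMt hg.
have rd al : r ^+ mdeg al != 0 by rewrite expf_neq0// gt_eqF.
pose a i al := c i al * r ^+ mdeg al.
have ha i : abound (a i) (M i) by have [] := hc i.
have [col hcol] := summ_col_ex ha hMt.
exists (fun al => col al / r ^+ mdeg al); split=> //.
  apply: abound_le (abound_col ha hMt hcol) => // al.
  by rewrite divfK.
move=> z hz; apply: (@summ_fubini _ I _ (fun i al => c i al * mpow z al) M Mt (fun i => F i z)).
- by move=> i; exact: ps_abound (hc i) hz.
- exact: hMt.
- by move=> i; have [_ _] := hc i; exact.
- move=> al; rewrite -mulrA mulrC.
  by apply: summ_ext (summ_scale _ (hcol al)) => i; rewrite /a; field.
- exact: hg.
Qed.

Lemma hb_mpow_mul r M f be : hb r M f -> hb r (r ^+ mdeg be * M) (fun z => mpow z be * f z).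
Proof.
move=> [c [r0 hc hf]].
pose d (ga : MI n) := if [forall i, be i <= ga i]%N then c (misub ga be) else 0.
have dE al : d (miadd be al) = c al.
  rewrite /d ifT; last by apply/forallP => i; rewrite ffunE leq_addr.
  by congr c; apply/ffunP => i; rewrite !ffunE addKn.
have d0 ga : (forall al, ga <> miadd be al) -> d ga = 0.
  move=> h; rewrite /d; case: forallP => // h'.
  by case: (h (misub ga be)); rewrite misubK.
have hB := abound_scale (r ^+ mdeg be) hc.
rewrite normrX gtr0_norm// in hB.
exists d; split=> //.
  apply: abound_extend (@miaddK n be) _ _ hB.
    by move=> al; rewrite dE mdeg_add exprD; ring.
  by move=> ga h; rewrite d0// mul0r.
move=> z hz; apply: (@summ_extend _ _ _ (miadd be) _ (fun al => mpow z be * (c al * mpow z al)) (`|mpow z be| * M)).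
- exact: miaddK.
- by move=> al; rewrite dE mpow_add; ring.
- by move=> ga h; rewrite d0// mul0r.
- by apply: abound_scale; apply: (@ps_abound r M c f).
- exact: summ_scale (hf z hz).
Qed.

Lemma hb_mul r M M' f g : hb r M f -> hb r M' g -> hb r (M * M') (fun z => f z * g z).
Proof.
move=> hf hg; have M0 := hb_M0 hf; have M0' := hb_M0 hg; have r0 := hb_r0 hg.
move: hf => [c [_ hc hf]].
apply: (@hb_summ _ (fun al z => c al * (mpow z al * g z)) (fun al => `|c al| * (r ^+ mdeg al * M'))) => //.
- by move=> al; apply: hb_scale; exact: hb_mpow_mul.
- have := abound_scale M' hc; rewrite mulrC [`|M'|]ger0_norm//; apply: abound_le => // al.
  rewrite !normrM normr_id !normrX !(ger0_norm (ltW r0)); rewrite le_eqVlt; apply/orP; left; apply/eqP; ring.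
- move=> z hz; rewrite mulrC; apply: summ_ext (summ_scale (g z) (hf z hz)) => al; ring.
Qed.

Lemma hb_prod (J : Type) (s : seq J) r (M : J -> C) (f : J -> 'rV[C]_n -> C) : 0 < r ->
  (forall j, hb r (M j) (f j)) -> hb r (\prod_(j <- s) M j) (fun z => \prod_(j <- s) f j z).
Proof.
move=> r0 h; elim: s => [|j s ih].
  have := hb_const 1 r0; rewrite normr1 [X in hb r X _ -> _](_ : _ = \prod_(j <- [::]) M j) ?big_nil//.
  by apply: hb_ext => z _; rewrite big_nil.
rewrite big_cons; apply: hb_ext (hb_mul (h j) ih) => z _.
by rewrite big_cons.
Qed.

Lemma hb_exp r M f k : hb r M f -> hb r (M ^+ k) (fun z => f z ^+ k).
Proof.
move=> h; elim: k => [|k ih].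
  by rewrite expr0 -(@normr1 C); apply: hb_ext (hb_const 1 (hb_r0 h)) => z _; rewrite expr0.
by rewrite exprS; apply: hb_ext (hb_mul h ih) => z _; rewrite exprS.
Qed.

Lemma hb_coord r j : 0 < r -> hb r r (fun z : 'rV[C]_n => z 0 j).
Proof.
move=> r0; have := hb_mpow_mul (mi1 j) (hb_const 1 r0).
by rewrite normr1 mulr1 mdeg1 expr1; apply: hb_ext => z _; rewrite mpow1 mulr1.
Qed.

End Props.

Lemma hb_mpow n m r s (y : 'rV[C]_n -> 'rV[C]_m) al : 0 < r ->
  (forall j, hb r s (fun z => y z 0 j)) -> hb r (s ^+ mdeg al) (fun z => mpow (y z) al).
Proof.
move=> r0 hy; rewrite /mdeg expr_sum; apply: hb_prod => // j.
exact: hb_exp (hy j).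
Qed.

Lemma hb_comp n m r s M (f : 'rV[C]_m -> C) (y : 'rV[C]_n -> 'rV[C]_m) : 0 < r ->
  hb s M f -> (forall j, hb r s (fun z => y z 0 j)) -> hb r M (fun z => f (y z)).
Proof.
move=> r0 [c [s0 hc hf]] hy.
apply: (@hb_summ _ _ (fun al z => c al * mpow (y z) al) (fun al => `|c al| * s ^+ mdeg al)) => //.
- by move=> al; apply: hb_scale; exact: hb_mpow.
- apply: abound_le hc => // al.
  by rewrite !normrM normr_id.
- by move=> z hz; apply: hf => j; exact: hb_norm (hy j) hz.
Qed.

(** Schwarz lemma for the weighted norm: when the radius shrinks by [t], each surviving monomial has
    degree at least [k] and gains the factor [t ^+ k]. *)
Lemma ps_small n r M c (f : 'rV[C]_n -> C) k t : ps r M c f ->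
  (forall al, (mdeg al < k)%N -> c al = 0) -> 0 < t -> t <= 1 ->
  ps (t * r) (t ^+ k * M) c f.
Proof.
move=> [r0 hc hf] c0 t0 t1; split; first exact: mulr_gt0.
  have := abound_scale (t ^+ k) hc; rewrite normrX (gtr0_norm t0).
  apply: abound_le => // al.
  have [/c0 ->|kd] := ltnP (mdeg al) k; first by rewrite !mul0r mulr0.
  rewrite exprMn mulrCA normrM [leRHS]normrM ler_wpM2r//.
  by rewrite !normrX (gtr0_norm t0) ler_wiXn2l// ltW.
by move=> z hz; apply: hf; apply: polydisc_le hz; rewrite ger_pMl.
Qed.

Lemma hb_small n r M (f : 'rV[C]_n -> C) t : hb r M f -> f 0 = 0 -> 0 < t -> t <= 1 ->
  hb (t * r) (t * M) f.
Proof.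
move=> [c hc] f0 t0 t1; exists c; rewrite -[X in X * M]expr1.
apply: ps_small => // al; rewrite ltnS leqn0 => /eqP/mdeg_eq0 ->.
by rewrite -(ps_at0 hc).
Qed.

Lemma sum_half (s : seq nat) : uniq s -> \sum_(k <- s) (2^-1 : C) ^+ k <= 2.
Proof.
move=> us; pose N := (\max_(k <- s) k).+1.
have sN : {subset s <= iota 0 N}.
  by move=> k ks; rewrite mem_iota /= add0n ltnS; exact: leq_bigmax_seq.
have h2 : (2^-1 : C) != 1 by rewrite invr_eq1 (eqr_nat _ 2 1).
have p0 k : (0 : C) <= 2^-1 ^+ k by rewrite exprn_ge0// invr_ge0.
apply: (@le_trans _ _ (\sum_(k <- iota 0 N) (2^-1 : C) ^+ k)).
  by rewrite (sum_subset _ us (iota_uniq _ _) sN) lerDl sumr_ge0.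
have -> : \sum_(k <- iota 0 N) (2^-1 : C) ^+ k = 2 - 2 * 2^-1 ^+ N.
  elim: (N) => [|N' ih]; first by rewrite big_nil expr0 mulr1 subrr.
  rewrite -(addn1 N') iotaD big_cat ih big_seq1 add0n addn1 exprS /=; by field.
by rewrite gerBl mulr_ge0.
Qed.

Lemma abound_half (x : C) B : `|x| <= 2^-1 -> 0 <= B ->
  abound (fun k : nat => B * x ^+ k) (B * 2).
Proof.
move=> hx B0 s us; under eq_bigr do rewrite normrM (ger0_norm B0).
rewrite -mulr_sumr ler_wpM2l//; apply: le_trans (sum_half us).
by apply: ler_sum => k _; rewrite normrX lerXn2r ?nnegrE// invr_ge0.
Qed.

Lemma summ_geom (x : C) : `|x| <= 2^-1 -> summ (fun k : nat => x ^+ k) (1 - x)^-1.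
Proof.
move=> hx; have hB : abound (fun k : nat => x ^+ k) 2.
  have := abound_half hx (@ler01 C); rewrite mul1r.
  by apply: abound_le => // k; rewrite mul1r.
have [l hl] := summ_ex hB.
have x1 : 1 - x != 0.
  rewrite subr_eq0; apply/eqP => x1; move: hx; rewrite -x1 normr1.
  by rewrite -[leRHS]div1r ler_pdivlMr// mul1r (ler_nat _ 2 1).
suff <- : l = (1 - x)^-1 by [].
have hs : summ (fun k => if k == 0%N then 1 else x ^+ k) l.
  by apply: summ_ext hl => -[|k].
have h1 := summ_scale x hl.
(* The series shifted by one index; adding the term 1 at index 0 restores it, so that
   [l = x * l + 1]. *)
have h2 : summ (fun k => if k is k'.+1 then x * x ^+ k' else 0) (x * l).
  apply: (@summ_extend _ _ _ S _ (fun k => x * x ^+ k) (`|x| * 2)) h1.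
  - exact: succn_inj.
  - by [].
  - by move=> [|k] // /(_ k).
  - exact: abound_scale.
have h3 := summ_add h2 (summ_single 0%N 1).
have : l = x * l + 1.
  apply: summ_uniq hl _; apply: summ_ext h3 => -[|k] /=; first by rewrite add0r.
  by rewrite addr0 exprS.
move=> e; have e1 : (1 - x) * l = 1 by rewrite mulrBl mul1r {1}e; ring.
by apply: (mulfI x1); rewrite e1 mulfV.
Qed.

End PolydiscSeries.
(** * Germs of holomorphic functions as power series *)

HB.lock Definition pd (R : realType) n (j : 'I_n) (f : 'rV[R[i]]_n -> R[i])
  (p : 'rV[R[i]]_n) : R[i] := 'D_(delta_mx 0 j) f p.

Section Bridge.
Context (R : realType).
Local Notation C := R[i].
Local Notation MI n := {ffun 'I_n -> nat}.

Definition box n (N : nat) : seq (MI n) :=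
  [seq [ffun i => nat_of_ord (mu i)] | mu : {ffun 'I_n -> 'I_N} <- enum {: {ffun 'I_n -> 'I_N}}].

Lemma box_sumE n (a : MI n -> C) N : box_sum a N = \sum_(al <- box n N) a al.
Proof. by rewrite /box_sum /box big_map big_enum. Qed.

Lemma box_uniq n N : uniq (box n N).
Proof.
rewrite map_inj_uniq ?enum_uniq// => mu nu /ffunP h; apply/ffunP => i.
by apply: val_inj; have := h i; rewrite !ffunE.
Qed.

Lemma mem_box n N (al : MI n) : (forall i, al i < N)%N -> al \in box n N.
Proof.
move=> h; apply/mapP; exists [ffun i => Ordinal (h i)]; first by rewrite mem_enum.
by apply/ffunP => i; rewrite !ffunE.
Qed.

Lemma box_sup n (s : seq (MI n)) : exists N0, forall N, (N0 <= N)%N -> {subset s <= box n N}.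
Proof.
exists (\max_(al <- s) \max_i al i).+1 => N hN al als; apply: mem_box => i.
apply: leq_trans hN; rewrite ltnS; apply: leq_trans (leq_bigmax_seq _ als _) => //.
exact: leq_bigmax.
Qed.

(** Every finite set of multi-indices lies in a box, so a bound on the boxes bounds all finite sums,
    and an unordered sum is also the limit along the boxes. *)
Lemma sums_toP n (a : MI n -> C) l :
  sums_to a l <-> (exists B, abound a B) /\ summ a l.
Proof.
have to_box B l' : abound a B -> summ a l' -> box_sum a N @[N --> \oo] --> l'.
  move=> hB hl; apply/cvgrPdist_le => e e0; have [s us hs] := hl e e0.
  have [N0 hN0] := box_sup s; near=> N.
  rewrite distrC box_sumE; apply: hs (box_uniq _ _) (hN0 _ _).
  by near: N; exists N0.
split=> [[[B hB] hl]|[[B hB] hl]]; last first.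
  split; last exact: to_box hB hl.
  exists (complex.Re B) => N; rewrite -ge0_ReE ?(abound_ge0 hB)//.
  by rewrite box_sumE; apply: hB; exact: box_uniq.
have hb : abound a B%:C.
  move=> s us; have [N hN] := box_sup s; apply: le_trans (hB N).
  rewrite box_sumE (sum_subset _ us (box_uniq _ _) (hN N (leqnn _))).
  by rewrite lerDl sumr_ge0.
split; first by exists B%:C.
have [l' hl'] := summ_ex hb.
suff -> : l = l' by [].
rewrite -(cvg_lim (@norm_hausdorff _ _) hl).
by apply: cvg_lim; [exact: norm_hausdorff|exact: to_box hb hl'].
Unshelve. all: by end_near. Qed.

Lemma mpow_const n (r : C) (al : MI n) : mpow (const_mx r) al = r ^+ mdeg al.
Proof. by rewrite /mpow /mdeg expr_sum; apply: eq_bigr => i _; rewrite mxE. Qed.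

Lemma holo_at0P n (f : 'rV[C]_n -> C) : holo_at 0 f <-> exists r M, hb r M f.
Proof.
split=> [[c /near0P[r r0 hr]]|[r [M [c [r0 hc hf]]]]].
  (* At the corner [(r, ..., r)] absolute summability is exactly the bound on the weighted norm. *)
  have dr : polydisc r (const_mx r : 'rV[C]_n) by move=> i; rewrite mxE gtr0_norm.
  have /sums_toP[[B hB] _] := hr _ dr.
  exists r, B, c; split=> // [s us|z hz].
    by have := hB s us; under eq_bigr do rewrite mpow_const.
  by have /sums_toP[_] := hr z hz; rewrite add0r.
exists c; apply/near0P; exists r => // z hz; apply/sums_toP; rewrite add0r.
split; last exact: hf.
by exists M; apply: (@ps_abound _ _ r M c f).
Qed.

Lemma coord_le_norm n (z : 'rV[C]_n) i : `|z 0 i| <= `|z|.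
Proof.
rewrite (ge0_ReE (normr_ge0 (z 0 i))) (ge0_ReE (normr_ge0 z)) lecR.
apply/ler_addgt0Pr => e e0.
have h : `|0 - z| < `|z| + e%:C by rewrite sub0r normrN ltrDl ltcR.
have : ball (0 : 'rV[C]_n) (`|z| + e%:C) z by rewrite mx_norm_ball.
move=> [_ /(_ 0 i)]; rewrite -ball_normE /= mxE sub0r normrN => /ltW.
by rewrite (ge0_ReE (normr_ge0 (z 0 i))) (ge0_ReE (normr_ge0 z)) -raddfD lecR.
Qed.

Definition dcoef n (j : 'I_n) (c : MI n -> C) (be : MI n) : C :=
  (be j).+1%:R * c (miadd (mi1 j) be).

(** The second order Taylor remainder, with a growth in [k] of only [4 ^+ k], which the passage from
    radius [r] to [s = r / 4] absorbs. *)
Lemma pow_remainder (x t s : C) k : 0 < s -> `|x| <= s -> `|t| <= s ->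
  `|(x + t) ^+ k - x ^+ k - t * (k%:R * x ^+ k.-1)| <= `|t| ^+ 2 * (4 * s) ^+ k / s ^+ 2.
Proof.
move=> s0 hx ht; elim: k => [|k ih].
  rewrite !expr0 subrr mul0r mulr0 subr0 normr0 mulr1.
  by rewrite mulr_ge0// invr_ge0 exprn_ge0// ltW.
have -> : (x + t) ^+ k.+1 - x ^+ k.+1 - t * (k.+1%:R * x ^+ k.+1.-1) =
    (x + t) * ((x + t) ^+ k - x ^+ k - t * (k%:R * x ^+ k.-1))
    + t ^+ 2 * (k%:R * x ^+ k.-1).
  by case: k {ih} => [|k] /=; rewrite ?expr0 ?expr1 -?natr1 ?exprS; ring.
apply: le_trans (ler_normD _ _) _.
have hk : `|t ^+ 2 * (k%:R * x ^+ k.-1)| <= `|t| ^+ 2 * (k%:R * s ^+ k.-1).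
  rewrite !normrM normr_nat !normrX ler_wpM2l ?exprn_ge0// ler_wpM2l//.
  by rewrite lerXn2r ?nnegrE// ltW.
have hx2 : `|x + t| <= 2 * s.
  by apply: le_trans (ler_normD _ _) _; rewrite mulr_natl mulr2n lerD.
have h1 := ler_pM (normr_ge0 _) (normr_ge0 _) hx2 ih.
rewrite -normrM in h1; apply: le_trans (lerD h1 hk) _.
have sn0 : s != 0 by rewrite gt_eqF.
have hk4 : (k%:R : C) * s ^+ k.-1 <= 2 * s * (4 * s) ^+ k / s ^+ 2.
  case: k {ih hk h1} => [|k] /=.
    by rewrite mul0r mulr_ge0// ?invr_ge0 ?exprn_ge0 ?mulr_ge0// ltW.
  have -> : 2 * s * (4 * s) ^+ k.+1 / s ^+ 2 = (2 * 4 ^+ k.+1) * s ^+ k.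
    by rewrite exprMn !exprS; field.
  rewrite ler_wpM2r ?exprn_ge0 ?(ltW s0)//.
  rewrite -natrX -natrM ler_nat.
  by apply: (@leq_trans (4 ^ k.+1)); [exact/ltnW/ltn_expl|rewrite mul2n -addnn leq_addl].
apply: (@le_trans _ _ (2 * s * (`|t| ^+ 2 * (4 * s) ^+ k / s ^+ 2) + `|t| ^+ 2 * (2 * s * (4 * s) ^+ k / s ^+ 2))).
  by rewrite lerD2l ler_wpM2l ?exprn_ge0.
by rewrite le_eqVlt; apply/orP; left; apply/eqP; rewrite [(4 * s) ^+ k.+1]exprS; move: ((4 * s) ^+ k) => X; ring.
Qed.

Lemma mpow_split n (z : 'rV[C]_n) al j :
  mpow z al = z 0 j ^+ al j * \prod_(i < n | i != j) z 0 i ^+ al i.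
Proof. by rewrite /mpow (bigD1 j). Qed.

Lemma mdeg_split n (al : MI n) j : mdeg al = (al j + \sum_(i < n | i != j) al i)%N.
Proof. by rewrite /mdeg (bigD1 j). Qed.

Lemma mpow_remainder n (p : 'rV[C]_n) j (t s : C) al : 0 < s -> polydisc s p -> `|t| <= s ->
  `|mpow (p + t *: delta_mx 0 j) al - mpow p al
     - t * ((al j)%:R * mpow p (misub al (mi1 j)))| <= `|t| ^+ 2 * (4 * s) ^+ mdeg al / s ^+ 2.
Proof.
move=> s0 hp ht; rewrite !(mpow_split _ _ j) (mdeg_split _ j).
have -> : \prod_(i < n | i != j) (p + t *: delta_mx 0 j) 0 i ^+ al i =
          \prod_(i < n | i != j) p 0 i ^+ al i.
  by apply: eq_bigr => i /negPf ij; rewrite !mxE ij andbF mulr0 addr0.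
have -> : \prod_(i < n | i != j) p 0 i ^+ (misub al (mi1 j)) i =
          \prod_(i < n | i != j) p 0 i ^+ al i.
  by apply: eq_bigr => i /negPf ij; rewrite !ffunE ij subn0.
rewrite !mxE !eqxx /= mulr1 !ffunE eqxx subn1.
set Q := \prod_(i < n | _) _.
have hQ : `|Q| <= (4 * s) ^+ (\sum_(i < n | i != j) al i).
  rewrite /Q normr_prod expr_sum; apply: ler_prod => i _.
  rewrite normr_ge0 normrX lerXn2r ?nnegrE ?mulr_ge0 ?(ltW s0)//.
  by apply: le_trans (hp i) _; rewrite ler_peMl ?(ltW s0)// (ler_nat _ 1 4).
have -> : (p 0 j + t) ^+ al j * Q - p 0 j ^+ al j * Q -
    t * ((al j)%:R * (p 0 j ^+ (al j).-1 * Q)) =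
  ((p 0 j + t) ^+ al j - p 0 j ^+ al j - t * ((al j)%:R * p 0 j ^+ (al j).-1)) * Q by ring.
rewrite normrM exprD.
apply: le_trans (ler_pM (normr_ge0 _) (normr_ge0 _) (pow_remainder (al j) s0 (hp j) ht) hQ) _.
by rewrite le_eqVlt; apply/orP; left; apply/eqP; ring.
Qed.

Lemma polydisc_shift n (p : 'rV[C]_n) j (t s s' : C) : polydisc s p -> `|t| <= s' ->
  0 <= s' -> polydisc (s + s') (p + t *: delta_mx 0 j).
Proof.
move=> hp ht s0 i; rewrite !mxE; apply: le_trans (ler_normD _ _) (lerD (hp i) _).
rewrite normrM normr_nat; case: eqP; case: eqP => //= _ _; rewrite ?mulr1 ?mulr0//.
Qed.

(** With [K = 0] this also computes the derivative of functions that are affine along the line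
    through [p]. *)
Lemma derive_quadratic n (f : 'rV[C]_n -> C) p v (g K s : C) : 0 < s -> 0 <= K ->
  (forall t : C, `|t| <= s -> `|f (p + t *: v) - f p - t * g| <= `|t| ^+ 2 * K) ->
  'D_v f p = g.
Proof.
move=> s0 K0 h; apply: cvg_lim; first exact: norm_hausdorff.
apply/cvgrPdist_le => e e0.
have K1 : 0 < K + 1 by rewrite ltr_wpDl.
near=> t.
have t0 : t != 0 by near: t; exact: nbhs_dnbhs_neq.
have ts : `|t| <= s.
  near: t; apply/nbhs_dnbhs/nbhs_ballP; exists s => // y.
  by rewrite -ball_normE /= sub0r normrN => /ltW.
have te : `|t| <= e / (K + 1).
  near: t; apply/nbhs_dnbhs/nbhs_ballP; exists (e / (K + 1)); first exact: divr_gt0.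
  by move=> y; rewrite -ball_normE /= sub0r normrN => /ltW.
rewrite /= [t *: v + p]addrC -normrN.
have -> : - (g - t^-1 *: (f (p + t *: v) - f p)) = t^-1 * (f (p + t *: v) - f p - t * g).
  by rewrite /GRing.scale /=; field.
rewrite normrM normfV mulrC ler_pdivrMr ?normr_gt0//.
apply: le_trans (h t ts) _; rewrite expr2 -mulrA mulrC ler_wpM2r//.
apply: (@le_trans _ _ (`|t| * (K + 1))); first by rewrite ler_wpM2l// lerDl.
by rewrite -ler_pdivlMr.
Unshelve. all: by end_near. Qed.

Lemma natr_le_exp4 k : (k%:R : C) <= 4 ^+ k.
Proof. by rewrite -natrX ler_nat ltnW// ltn_expl. Qed.

(** The loss of a factor 4 in the radius pays for the exponent [al j], which is at most [4 ^+ al j].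
    The second conclusion says that the field [z_j d/dz_j] acts diagonally on monomials; all
    statements about [euler_diff] go through it. *)
Lemma ps_pd n r M c (f : 'rV[C]_n -> C) j : ps r M c f ->
  ps (r / 4) (M / (r / 4)) (dcoef j c) (pd j f) /\
  (forall z, polydisc (r / 4) z ->
     summ (fun al : MI n => (al j)%:R * c al * mpow z al) (z 0 j * pd j f z)).
Proof.
move=> hps; have [r0 hc hf] := hps; set s := r / 4.
have s0 : 0 < s by rewrite divr_gt0.
have sn0 : s != 0 by rewrite gt_eqF.
have r4 : r = 4 * s by rewrite /s; field.
pose phi := miadd (mi1 j).
(* The truncation in [.-1] only concerns degree 0, where the factor [al j] is 0. *)
pose a0 (al : MI n) := (al j)%:R * c al * s ^+ (mdeg al).-1.
have ha0 : abound a0 (M / s).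
  have := abound_scale s^-1 hc; rewrite normfV (gtr0_norm s0) mulrC.
  apply: abound_le => // al; rewrite /a0.
  have [->|d0] := eqVneq (al j) 0%N; first by rewrite !mul0r normr0.
  have d1 : (0 < mdeg al)%N by rewrite (mdeg_split _ j) addn_gt0 lt0n d0.
  rewrite !normrM normr_nat -mulrA mulrCA [leRHS]mulrCA ler_wpM2l// !normrX -{2}(prednK d1) exprS normfV (gtr0_norm s0) (gtr0_norm r0).
  have -> : s^-1 * (r * r ^+ (mdeg al).-1) = 4 ^+ (mdeg al) * s ^+ (mdeg al).-1.
    by rewrite -{2}(prednK d1) r4 exprMn exprS; field.
  rewrite ler_wpM2r ?exprn_ge0 ?(ltW s0)//; apply: le_trans (natr_le_exp4 _) _.
  by rewrite ler_weXn2l ?(ler_nat _ 1 4)// (mdeg_split _ j) leq_addr.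
have phiI : injective phi := @miaddK _ _.
have off (al : MI n) : (forall be, al <> phi be) -> al j = 0%N.
  move=> h; apply/eqP; apply: contraPT h => aj h; apply: (h (misub al (mi1 j))).
  rewrite /phi misubK// => i; rewrite ffunE; case: eqP => //= ->.
  by rewrite lt0n.
have dE be : dcoef j c be = ((phi be) j)%:R * c (phi be).
  by rewrite /dcoef /phi ffunE /mi1 ffunE eqxx add1n.
have hd : abound (fun be => dcoef j c be * s ^+ mdeg be) (M / s).
  apply: abound_le (abound_reindex phiI ha0) => // be.
  by rewrite /= /a0 dE /phi mdeg_add mdeg1.
have hd' z : polydisc s z -> abound (fun be => dcoef j c be * mpow z be) (M / s).
  move=> hz; apply: abound_le hd => // be; rewrite !normrM ler_wpM2l//.
  by rewrite normrX (gtr0_norm s0); apply: norm_mpow => //; exact: ltW.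
have hg z : exists g, polydisc s z -> summ (fun be => dcoef j c be * mpow z be) g.
  have [hz|nz] := pselect (polydisc s z); last by exists 0.
  by have [g hg] := summ_ex (hd' z hz); exists g.
have {hg} [g hg] := choice hg.
have hs1 z : polydisc s z ->
    summ (fun al => c al * ((al j)%:R * mpow z (misub al (mi1 j)))) (g z).
  move=> hz; apply: summ_extend phiI _ _ (hd' z hz) _ (hg z hz).
    move=> be; rewrite dE mulrA [c _ * _]mulrC; congr (_ * mpow z _).
    by apply/ffunP => i; rewrite !ffunE addKn.
  by move=> al /off ->; rewrite mul0r mulr0.
(* Summing the remainders of [mpow_remainder] over the monomials bounds the error of the linear
   approximation by [|t| ^+ 2 * (M / s ^+ 2)]. *)
have gE z : polydisc s z -> pd j f z = g z.
  move=> hz; rewrite unlock; have M0 := abound_ge0 hc.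
  apply: (@derive_quadratic _ _ _ _ _ (M / s ^+ 2) s) => //.
    by rewrite mulr_ge0// invr_ge0 exprn_ge0// ltW.
  move=> t ht.
  have hz1 : polydisc r (z + t *: delta_mx 0 j).
    apply: polydisc_le (polydisc_shift j hz ht (ltW s0)).
    by rewrite r4 (_ : s + s = 2 * s) ?ler_wpM2r ?(ltW s0) ?ler_nat//; ring.
  have hz2 : polydisc r z.
    by apply: polydisc_le hz; rewrite r4 ler_peMl ?(ltW s0)// (ler_nat _ 1 4).
  have h := summ_add (summ_add (hf _ hz1) (summ_scale (-1) (hf _ hz2)))
                     (summ_scale (-t) (hs1 z hz)).
  have -> : f (z + t *: delta_mx 0 j) - f z - t * g z =
    f (z + t *: delta_mx 0 j) + -1 * f z + - t * g z by ring.
  apply: summ_bound h.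
  have := abound_scale (`|t| ^+ 2 / s ^+ 2) hc.
  rewrite (_ : `|_| * M = `|t| ^+ 2 * (M / s ^+ 2)); last first.
    by rewrite ger0_norm ?mulr_ge0 ?invr_ge0 ?exprn_ge0// ?(ltW s0)//; ring.
  apply: abound_le => // al.
  have -> : c al * mpow (z + t *: delta_mx 0 j) al + -1 * (c al * mpow z al) +
     - t * (c al * ((al j)%:R * mpow z (misub al (mi1 j)))) =
    c al * (mpow (z + t *: delta_mx 0 j) al - mpow z al
     - t * ((al j)%:R * mpow z (misub al (mi1 j)))) by ring.
  rewrite [X in _ <= `|X|]mulrCA normrM [leRHS]normrM ler_wpM2l//.
  apply: le_trans (mpow_remainder j al s0 hz ht) _.
  rewrite -r4 ger0_norm; last first.
    by rewrite mulr_ge0 ?mulr_ge0 ?invr_ge0 ?exprn_ge0// ltW.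
  by rewrite le_eqVlt; apply/orP; left; apply/eqP; ring.
split; first by split=> // z hz; rewrite gE//; exact: hg.
move=> z hz; rewrite gE//; apply: summ_ext (summ_scale (z 0 j) (hs1 z hz)) => al.
have [->|aj] := eqVneq (al j) 0%N; first by rewrite !mul0r !mulr0.
have -> : mpow z al = z 0 j * mpow z (misub al (mi1 j)); last by ring.
rewrite -mpow1 -mpow_add misubK// => i.
by rewrite ffunE; case: eqP => //= ->; rewrite lt0n.
Qed.

Lemma mdeg1_ex n (al : MI n) : mdeg al = 1%N -> exists j, al = mi1 j.
Proof.
move=> h; have [j hj] : exists j, al j != 0%N.
  apply/existsP; apply: contra_eqT h; rewrite negb_exists => /forallP h.
  by rewrite /mdeg big1// => i _; apply/eqP; rewrite -[_ == _]negbK.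
exists j; apply/ffunP => i; rewrite ffunE.
move: h; rewrite (mdeg_split _ j); set S := \sum_(i < n | _) _ => h.
have [aj S0] : al j = 1%N /\ S = 0%N by move: hj h; move: (al j) S => a b; lia.
case: eqP => [->|/eqP ij]; first by rewrite aj.
move/eqP: S0; rewrite sum_nat_eq0 => /forallP/(_ i).
by rewrite ij => /eqP.
Qed.

Lemma near_norm_le n (r : C) : 0 < r -> \forall z \near (0 : 'rV[C]_n), `|z| <= r.
Proof.
move=> r0; apply/nbhs_ballP; exists r => // z.
by rewrite mx_norm_ball /ball_ /= sub0r normrN => /ltW.
Qed.

Lemma hb_taylor1 n r M (f : 'rV[C]_n -> C) : hb r M f -> exists c0 c1,
  hb r M (fun z => f z - (c0 + \sum_j c1 j * z 0 j)) /\
  forall z, `|z| <= r -> `|f z - (c0 + \sum_j c1 j * z 0 j)| <= (`|z| / r) ^+ 2 * M.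
Proof.
move=> [c hc]; have [r0 hB hf] := hc.
exists (c (mi0 n)), (fun j => c (mi1 j)).
pose h z := f z - (c (mi0 n) + \sum_j c (mi1 j) * z 0 j).
pose d (al : MI n) := if (mdeg al < 2)%N then 0 else c al.
have hd : ps r M d h.
  split=> //.
    by apply: abound_le hB => // al; rewrite /d; case: ifP => // _; rewrite mul0r normr0.
  move=> z hz.
  have := summ_add (hf z hz) (summ_scale (-1) (summ_add (summ_single (mi0 n) (c (mi0 n)))
    (@summ_big _ _ _ (index_enum 'I_n) _ _ (fun j => summ_single (mi1 j) (c (mi1 j) * z 0 j))))).
  rewrite mulN1r; apply: summ_ext => al; rewrite mulN1r /d.
  have m10 j : (mi0 n == mi1 j) = false.
    by apply/negP => /eqP e; have := mdeg1 j; rewrite -e mdeg0.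
  case al2 : (mdeg al) => [|[|k]] /=.
  - rewrite (mdeg_eq0 al2) eqxx mpow0 big1 ?addr0; first by ring.
    by move=> j _; rewrite m10.
  - have [j ->] := mdeg1_ex al2; rewrite eq_sym m10 add0r mpow1 (bigD1 j)//= eqxx.
    rewrite big1 ?addr0; first by ring.
    move=> i /negPf ij; case: eqP => // /ffunP/(_ i); rewrite !ffunE eqxx ij; discriminate.
  - have -> : (al == mi0 n) = false by apply/negP => /eqP e; move: al2; rewrite e mdeg0.
    rewrite add0r big1 ?subr0// => j _; case: eqP => // e.
    by move: al2; rewrite e mdeg1.
split; first by exists d.
move=> z zr; have [z0|z0] := eqVneq `|z| 0.
  have -> : z = 0 by apply/eqP; rewrite -normr_eq0 z0.
  rewrite [X in `|X|](ps_at0 hd) /d mdeg0 /= normr0.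
  by rewrite mulr_ge0 ?exprn_ge0 ?divr_ge0// ?(ltW r0)// (abound_ge0 hB).
have rn0 : r != 0 by rewrite gt_eqF.
(* Shrinking the polydisc to radius [|z|] gains [(|z| / r) ^+ 2], because [d] vanishes in degrees 0
   and 1. *)
have hs : ps (`|z| / r * r) ((`|z| / r) ^+ 2 * M) d h.
  apply: ps_small hd _ _ _.
  - by move=> al; rewrite /d => ->.
  - by rewrite divr_gt0// lt_def z0 normr_ge0.
  - by rewrite ler_pdivrMr// mul1r.
apply: (@hb_norm _ _ (`|z| / r * r) _ h); first by exists d.
by rewrite divfK// => i; exact: coord_le_norm.
Qed.

Lemma diff_quadratic n (h : 'rV[C]_n -> C) (r K : C) : 0 < r -> 0 <= K ->
  (forall z, `|z| <= r -> `|h z| <= `|z| ^+ 2 * K) -> differentiable h (0 : 'rV[C]_n).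
Proof.
move=> r0 K0 hK.
have h0 : h 0 = 0.
  apply/eqP; rewrite -normr_le0; apply: le_trans (hK 0 _) _; rewrite normr0 ?(ltW r0)//.
  by rewrite expr0n mul0r.
have K1 : 0 < K + 1 by rewrite ltr_wpDl.
have ho : h \o shift 0 = cst (h 0) + \0 +o_ (0 : 'rV[C]_n) id.
  apply/eqaddoP => e e0.
  have h1 := @near_norm_le n r r0.
  have h2 := @near_norm_le n _ (divr_gt0 e0 K1).
  apply: filterS2 h1 h2 => z zr ze.
  have -> : (h \o shift 0 - (cst (h 0) + \0)) z = h z.
    by rewrite !fctE /= h0 !addr0 subr0.
  apply: le_trans (hK z zr) _; rewrite expr2 -mulrA mulrC ler_wpM2r//.
  apply: (@le_trans _ _ (`|z| * (K + 1))); first by rewrite ler_wpM2l// lerDl.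
  by rewrite -ler_pdivlMr.
have c0 : continuous (\0 : 'rV[C]_n -> C) by move=> x; exact: cst_continuous.
apply/diff_locallyP.
have -> : 'd h (0 : 'rV[C]_n) = \0 :> ('rV[C]_n -> C).
  exact: (@diff_unique _ _ _ h _ 0 c0 ho).
by split.
Qed.

Let differentiable_id n (p : 'rV[C]_n) : differentiable (fun x : 'rV[C]_n => x) p.
Proof. by case: (@is_diff_id C 'rV[C]_n p). Qed.

(** Recentring at [p] is composition with a translation, which maps the polydisc of radius [r / 2]
    into that of radius [r]. The recentred series is an affine function plus a quadratically small
    remainder. *)
Lemma hb_differentiable n r M (f : 'rV[C]_n -> C) p : hb r M f -> polydisc (r / 2) p ->
  differentiable f p.
Proof.
move=> hf hp; have r0 := hb_r0 hf; have r20 : 0 < r / 2 by rewrite divr_gt0.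
have hF : hb (r / 2) M (fun z => f (p + z)).
  apply: (hb_comp r20 hf) => j.
  have := hb_add (@hb_const _ n _ (p 0 j) r20) (hb_coord j r20).
  move=> /(hb_le r20 (lexx _)) h; apply: hb_ext (h r _); last first.
    by rewrite {2}[r](splitr r) lerD2r; exact: hp.
  by move=> z _; rewrite mxE.
have [c0 [c1 [hr2 hq]]] := hb_taylor1 hF.
pose h z := f (p + z) - (c0 + \sum_j c1 j * z 0 j).
have dh : differentiable h (0 : 'rV[C]_n).
  apply: (@diff_quadratic _ _ (r / 2) ((r / 2)^-1 ^+ 2 * M)) => //.
    by rewrite mulr_ge0 ?(hb_M0 hf)// exprn_ge0// invr_ge0 ltW.
  move=> z zr; rewrite mulrA -exprMn; exact: hq.
pose g : 'rV[C]_n -> C := (cst c0 + \sum_(j < n) (c1 j *: (fun y : 'rV[C]_n => y 0 j))) + h.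
have dg : differentiable g (0 : 'rV[C]_n).
  have ds : differentiable (\sum_(j < n) (c1 j *: (fun y : 'rV[C]_n => y 0 j))) 0.
    apply: differentiable_sum => j; apply: differentiableZ.
    exact: differentiable_coord.
  exact: differentiableD (differentiableD (differentiable_cst c0 _) ds) dh.
have -> : f = g \o (fun x => x - p).
  apply/funext => x; rewrite /g /h /= !fctE fct_sumE /= [p + _]addrC subrK.
  under eq_bigr do rewrite !fctE.
  by rewrite addrC subrK.
apply: differentiable_comp; last by rewrite subrr.
exact: differentiableB (differentiable_id _) (differentiable_cst p _).
Qed.

End Bridge.
(** * Operations on germs *)

HB.lock Definition jdet (R : realType) n (T : 'rV[R[i]]_n -> 'rV[R[i]]_n)
  (p : 'rV[R[i]]_n) : R[i] := \det (jacobian T p).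

Section Germs.
Context (R : realType).
Local Notation C := R[i].

(** The inverse of [1 + sum 1 / r_i] plays the role of a minimum in the partial order of [R[i]]; the
    summand 1 covers an empty [I]. *)
Lemma pos_lower_bound (I : finType) (r : I -> C) : (forall i, 0 < r i) ->
  exists2 s, 0 < s & forall i, s <= r i.
Proof.
move=> r0; have h : 0 < 1 + \sum_i (r i)^-1.
  by rewrite ltr_wpDr// sumr_ge0// => i _; rewrite invr_ge0 ltW.
exists (1 + \sum_i (r i)^-1)^-1; first by rewrite invr_gt0.
move=> i; rewrite -[leRHS]invrK lef_pV2 ?posrE ?invr_gt0//.
rewrite (bigD1 i)//= addrCA lerDl addr_ge0// sumr_ge0// => j _.
by rewrite invr_ge0 ltW.
Qed.

Lemma pos_lower_bound2 (a b : C) : 0 < a -> 0 < b ->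
  exists s, [/\ 0 < s, s <= a & s <= b].
Proof.
move=> a0 b0; have [|s s0 h] := @pos_lower_bound bool (fun x => if x then a else b).
  by case.
by exists s; split=> //; [exact: (h true)|exact: (h false)].
Qed.

Lemma holo_hb n (f : 'rV[C]_n -> C) : holo_at 0 f -> exists r M, hb r M f.
Proof. by move/holo_at0P. Qed.

Lemma hb_holo n r M (f : 'rV[C]_n -> C) : hb r M f -> holo_at 0 f.
Proof. by move=> h; apply/holo_at0P; exists r, M. Qed.

Local Opaque holo_at.

Lemma holo_hb_fin n (I : finType) (f : I -> 'rV[C]_n -> C) : (forall i, holo_at 0 (f i)) ->
  exists r (M : I -> C), 0 < r /\ forall i, hb r (M i) (f i).
Proof.
move=> h; have h' i : exists rM : C * C, hb rM.1 rM.2 (f i).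
  by have [r [M hM]] := holo_hb (h i); exists (r, M).
have [rM hrM] := choice h'.
have [i|r r0 hr] := @pos_lower_bound I (fun i => (rM i).1); first exact: hb_r0 (hrM i).
by exists r, (fun i => (rM i).2); split=> // i; apply: hb_le (hrM i).
Qed.

Lemma holo_hb2 n (f g : 'rV[C]_n -> C) : holo_at 0 f -> holo_at 0 g ->
  exists r M M', hb r M f /\ hb r M' g.
Proof.
move=> hf hg; have [|r [M [r0 h]]] := @holo_hb_fin n bool (fun b => if b then f else g).
  by case.
by exists r, (M true), (M false); split; [exact: (h true)|exact: (h false)].
Qed.

Lemma holo_near n (f g : 'rV[C]_n -> C) :
  (\forall z \near (0 : 'rV[C]_n), f z = g z) -> holo_at 0 f -> holo_at 0 g.
Proof.
move=> /near0P[r r0 fg] /holo_hb[s [M h]].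
have [t [t0 tr ts]] := pos_lower_bound2 r0 (hb_r0 h).
apply: (@hb_holo _ t M); apply: (@hb_ext _ _ _ _ f); last exact: hb_le h.
by move=> z hz; apply: fg; exact: polydisc_le hz.
Qed.

Lemma holo_const n (k : C) : holo_at 0 (fun _ : 'rV[C]_n => k).
Proof. by apply: (@hb_holo _ 1); apply: hb_const. Qed.

Lemma holo_coord n (j : 'I_n) : holo_at 0 (fun z : 'rV[C]_n => z 0 j).
Proof. by apply: (@hb_holo _ 1); apply: hb_coord. Qed.

Lemma holo_add n (f g : 'rV[C]_n -> C) : holo_at 0 f -> holo_at 0 g ->
  holo_at 0 (fun z => f z + g z).
Proof.
by move=> hf hg; have [r [M [M' [h h']]]] := holo_hb2 hf hg; apply: hb_holo (hb_add h h').
Qed.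

Lemma holo_mul n (f g : 'rV[C]_n -> C) : holo_at 0 f -> holo_at 0 g ->
  holo_at 0 (fun z => f z * g z).
Proof.
by move=> hf hg; have [r [M [M' [h h']]]] := holo_hb2 hf hg; apply: hb_holo (hb_mul h h').
Qed.

Lemma holo_scale n k (f : 'rV[C]_n -> C) : holo_at 0 f -> holo_at 0 (fun z => k * f z).
Proof. exact: holo_mul (holo_const n k). Qed.

Lemma holo_opp n (f : 'rV[C]_n -> C) : holo_at 0 f -> holo_at 0 (fun z => - f z).
Proof.
by move=> /(holo_scale (-1)); apply: holo_near; near=> z; rewrite mulN1r.
Unshelve. all: by end_near. Qed.

Lemma holo_sub n (f g : 'rV[C]_n -> C) : holo_at 0 f -> holo_at 0 g ->
  holo_at 0 (fun z => f z - g z).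
Proof. by move=> hf /holo_opp; exact: holo_add. Qed.

Lemma holo_sum n (J : Type) (s : seq J) (f : J -> 'rV[C]_n -> C) :
  (forall j, holo_at 0 (f j)) -> holo_at 0 (fun z => \sum_(j <- s) f j z).
Proof.
move=> h; elim: s => [|j s ih].
  by apply: holo_near (holo_const n 0); near=> z; rewrite big_nil.
by apply: holo_near (holo_add (h j) ih); near=> z; rewrite big_cons.
Unshelve. all: by end_near. Qed.

Lemma holo_prod n (J : Type) (s : seq J) (P : pred J) (f : J -> 'rV[C]_n -> C) :
  (forall j, holo_at 0 (f j)) -> holo_at 0 (fun z => \prod_(j <- s | P j) f j z).
Proof.
move=> h; elim: s => [|j s ih].
  by apply: holo_near (holo_const n 1); near=> z; rewrite big_nil.
case Pj : (P j); last by apply: holo_near ih; near=> z; rewrite big_cons Pj.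
by apply: holo_near (holo_mul (h j) ih); near=> z; rewrite big_cons Pj.
Unshelve. all: by end_near. Qed.

Lemma holo_prodP n : holo_at 0 (@coord_prod R n).
Proof. by apply: holo_prod => j; exact: holo_coord. Qed.

Lemma hb_small_norm n (f : 'rV[C]_n -> C) e : holo_at 0 f -> f 0 = 0 -> 0 < e ->
  exists r, hb r e f.
Proof.
move=> /holo_hb[r [M hM]] f0 e0; have M0 := hb_M0 hM.
have t0 : 0 < 1 + M / e by rewrite ltr_wpDr// divr_ge0// ltW.
(* As [f 0 = 0], scaling the radius by [(1 + M / e)^-1] scales the bound [M] likewise, and
   [M / (1 + M / e) <= e]. *)
exists ((1 + M / e)^-1 * r).
have h : hb ((1 + M / e)^-1 * r) ((1 + M / e)^-1 * M) f.
  apply: hb_small => //; first by rewrite invr_gt0.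
  by rewrite invf_le1// lerDl divr_ge0// ltW.
apply: (hb_le (hb_r0 h) (lexx _) _ h).
rewrite mulrC ler_pdivrMr// mulrDr mulr1 mulrCA divff ?gt_eqF// mulr1.
by rewrite lerDr ltW.
Qed.

Lemma hb_small_norm_fin n (I : finType) (f : I -> 'rV[C]_n -> C) e :
  (forall i, holo_at 0 (f i)) -> (forall i, f i 0 = 0) -> 0 < e ->
  exists2 r, 0 < r & forall i, hb r e (f i).
Proof.
move=> hf f0 e0; have [r hr] := choice (fun i => hb_small_norm (hf i) (f0 i) e0).
have [i|s s0 hs] := @pos_lower_bound I r; first exact: hb_r0 (hr i).
by exists s => // i; apply: hb_le (hr i).
Qed.

Lemma holo_comp n m (f : 'rV[C]_m -> C) (y : 'rV[C]_n -> 'rV[C]_m) :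
  holo_at 0 f -> holo_map_at 0 y -> y 0 = 0 -> holo_at 0 (fun z => f (y z)).
Proof.
move=> /holo_hb[s [M hM]] hy y0.
have [|r r0 hr] := hb_small_norm_fin hy _ (hb_r0 hM).
  by move=> i; rewrite y0 mxE.
exact: hb_holo (hb_comp r0 hM hr).
Qed.

(** Geometric series in [g = 1 - f / f 0], on a polydisc where the norm of [g] is at most 1/2. *)
Lemma holo_inv n (f : 'rV[C]_n -> C) : holo_at 0 f -> f 0 != 0 ->
  holo_at 0 (fun z => (f z)^-1).
Proof.
move=> hf f0; pose g z := 1 - (f 0)^-1 * f z.
have hg : holo_at 0 g by apply: holo_sub (holo_const _ _) (holo_scale _ hf).
have g0 : g 0 = 0 by rewrite /g mulVf// subrr.
have h2 : (0 : C) < 2^-1 by rewrite invr_gt0.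
have [r hr] := hb_small_norm hg g0 h2.
have hr' : hb r 2 (fun z => (1 - g z)^-1).
  apply: (@hb_summ _ _ _ (fun k z => g z ^+ k) (fun k => 2^-1 ^+ k)) (hb_r0 hr) _ _ _.
  - by move=> k; exact: hb_exp.
  - have := @abound_half _ (2^-1 : C) 1; rewrite mul1r; move=> /(_ _ ler01) h.
    by apply: abound_le (h _) => // [k|]; rewrite ?mul1r// gtr0_norm.
  - by move=> z hz; apply: summ_geom; exact: hb_norm hr hz.
apply: holo_near (holo_scale (f 0)^-1 (hb_holo hr')); near=> z.
by rewrite /g opprB addrC subrK invfM invrK mulrA mulVf// mul1r.
Unshelve. all: by end_near. Qed.

Lemma near_polydisc n (r : C) : 0 < r -> \forall z \near (0 : 'rV[C]_n), polydisc r z.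
Proof. by move=> r0; apply/near0P; exists r. Qed.

Lemma holo_diff n (f : 'rV[C]_n -> C) : holo_at 0 f ->
  \forall z \near (0 : 'rV[C]_n), differentiable f z.
Proof.
move=> /holo_hb[r [M h]]; apply/near0P; exists (r / 2).
  by rewrite divr_gt0// (hb_r0 h).
by move=> z hz; exact: hb_differentiable h hz.
Qed.

Lemma holo_pd n (f : 'rV[C]_n -> C) j : holo_at 0 f -> holo_at 0 (pd j f).
Proof.
move=> /holo_hb[r [M [c h]]]; apply: (@hb_holo _ (r / 4) (M / (r / 4))).
by exists (dcoef j c); have [] := ps_pd j h.
Qed.

Lemma holo_map_continuous n m (T : 'rV[C]_n -> 'rV[C]_m) (P : 'rV[C]_m -> Prop) :
  holo_map_at 0 T -> T 0 = 0 -> (\forall z \near (0 : 'rV[C]_m), P z) ->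
  \forall z \near (0 : 'rV[C]_n), P (T z).
Proof.
move=> hT T0 /near0P[e e0 hP].
have [|r r0 hr] := hb_small_norm_fin hT _ e0; first by move=> i; rewrite T0 mxE.
apply/near0P; exists r => // z hz; apply: hP => i.
exact: hb_norm (hr i) hz.
Qed.

Lemma near_near n (P : 'rV[C]_n -> Prop) : (\forall z \near (0 : 'rV[C]_n), P z) ->
  \forall z \near (0 : 'rV[C]_n), \forall y \near z, P y.
Proof. by move=> h; apply/near_join/h. Qed.

Lemma holo_ne0 n (f : 'rV[C]_n -> C) : holo_at 0 f -> f 0 != 0 ->
  \forall z \near (0 : 'rV[C]_n), f z != 0.
Proof.
move=> hf f0; have e0 : 0 < `|f 0| / 2 by rewrite divr_gt0// normr_gt0.
have h0 : f 0 - f 0 = 0 by rewrite subrr.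
have [r hr] := hb_small_norm (holo_sub hf (holo_const n (f 0))) h0 e0.
apply/near0P; exists r => [|z hz]; first exact: hb_r0 hr.
apply/eqP => fz; have := hb_norm hr hz; rewrite fz sub0r normrN.
by rewrite ler_pdivlMr// ger_pMr ?normr_gt0// (ler_nat _ 2 1).
Qed.

Section PartialDerivatives.
Variables (n : nat) (j : 'I_n).
Implicit Types (f g : 'rV[C]_n -> C).

Lemma pd_near f g p : (\forall z \near p, f z = g z) -> pd j f p = pd j g p.
Proof. by rewrite unlock; exact: near_eq_derive. Qed.

Lemma pd_const (k : C) (p : 'rV[C]_n) : pd j (fun _ => k) p = 0.
Proof. by rewrite unlock; exact: derive_cst. Qed.

Lemma pd_coord i p : pd j (fun z : 'rV[C]_n => z 0 i) p = (i == j)%:R.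
Proof.
rewrite unlock; apply: (@derive_quadratic _ _ _ _ _ _ 0 1) => // t _.
rewrite (_ : _ - _ - _ = 0) ?normr0 ?mulr0//.
by rewrite !mxE eqxx /=; ring.
Qed.

Lemma pd_add f g p : differentiable f p -> differentiable g p ->
  pd j (fun z => f z + g z) p = pd j f p + pd j g p.
Proof. by move=> df dg; rewrite unlock; apply: deriveD; exact: diff_derivable. Qed.

Lemma pd_sub f g p : differentiable f p -> differentiable g p ->
  pd j (fun z => f z - g z) p = pd j f p - pd j g p.
Proof. by move=> df dg; rewrite unlock; apply: deriveB; exact: diff_derivable. Qed.

Lemma pd_mul f g p : differentiable f p -> differentiable g p ->
  pd j (fun z => f z * g z) p = f p * pd j g p + g p * pd j f p.
Proof. by move=> df dg; rewrite unlock; apply: deriveM; exact: diff_derivable. Qed.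

End PartialDerivatives.

Lemma differentiable_row n m (T : 'rV[C]_n -> 'rV[C]_m) p :
  (forall i, differentiable (fun z => T z 0 i) p) -> differentiable T p.
Proof.
move=> h; have -> : T = \sum_(i < m) (fun z => T z 0 i *: delta_mx 0 i).
  apply/funext => z; rewrite fct_sumE; exact: row_sum_delta.
by apply: differentiable_sum => i; exact: differentiableZl.
Qed.

Lemma diff_coord n m (T : 'rV[C]_n -> 'rV[C]_m) p i v : differentiable T p ->
  'd T p v 0 i = 'D_v (fun z => T z 0 i) p.
Proof.
move=> dT; have dc := @differentiable_coord C 1 m (T p) 0 i.
have := deriveE v (differentiable_comp dT dc).
rewrite (diff_comp dT dc) /= -(deriveE _ dc) => ->.
apply/esym/(@derive_quadratic _ _ _ _ _ _ 0 1) => // t _.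
rewrite (_ : _ - _ - _ = 0) ?normr0 ?mulr0//.
by rewrite !mxE; ring.
Qed.

Lemma jacobianE n m (T : 'rV[C]_n -> 'rV[C]_m) p i j : differentiable T p ->
  jacobian T p i j = pd i (fun z => T z 0 j) p.
Proof. by move=> dT; rewrite unlock mxE diff_coord. Qed.

Lemma pd_comp n m (h : 'rV[C]_m -> C) (T : 'rV[C]_n -> 'rV[C]_m) p j :
  (forall i, differentiable (fun z => T z 0 i) p) -> differentiable h (T p) ->
  pd j (fun z => h (T z)) p = \sum_i pd j (fun z => T z 0 i) p * pd i h (T p).
Proof.
move=> /differentiable_row dT dh.
rewrite unlock (deriveE _ (differentiable_comp dT dh)) (diff_comp dT dh) /=.
rewrite {1}(row_sum_delta ('d T p (delta_mx 0 j))) linear_sum; apply: eq_bigr => i _.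
by rewrite linearZ /= -diff_coord// [in RHS](deriveE _ dh).
Qed.

(** Points are row vectors, so the rows of a Jacobian are indexed by the variables and the factor of
    the inner map stands on the left. *)
Lemma jacobian_comp n m k (S : 'rV[C]_m -> 'rV[C]_k) (T : 'rV[C]_n -> 'rV[C]_m) p :
  (forall i, differentiable (fun z => T z 0 i) p) ->
  (forall i, differentiable (fun z => S z 0 i) (T p)) ->
  jacobian (fun z => S (T z)) p = jacobian T p *m jacobian S (T p).
Proof.
move=> dT dS; have dT' := differentiable_row dT; have dS' := differentiable_row dS.
apply/matrixP => i j; rewrite jacobianE; last exact: differentiable_comp.
rewrite (@pd_comp _ _ (fun z => S z 0 j))// mxE; apply: eq_bigr => l _.
by rewrite !jacobianE.
Qed.

Lemma near_forall n (I : finType) (P : I -> 'rV[C]_n -> Prop) :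
  (forall i, \forall z \near (0 : 'rV[C]_n), P i z) ->
  \forall z \near (0 : 'rV[C]_n), forall i, P i z.
Proof.
move=> h; have h' i : exists r : C, 0 < r /\ forall z, polydisc r z -> P i z.
  by have /near0P[r r0 hr] := h i; exists r.
have [r hr] := choice h'.
have [i|s s0 hs] := @pos_lower_bound I r; first by case: (hr i).
apply/near0P; exists s => // z hz i; case: (hr i) => _; apply.
exact: polydisc_le hz.
Qed.

End Germs.

Arguments holo_coord {R n} j.
Arguments holo_const {R} n k.
(** * Identity theorem and division *)

Section Coefficients.
Context (R : realType).
Local Notation C := R[i].
Local Notation MI n := {ffun 'I_n -> nat}.
Local Opaque holo_at.

Lemma near_polydiscP n (p : 'rV[C]_n) (P : 'rV[C]_n -> Prop) :
  (\forall y \near p, P y) <->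
  exists2 r : C, 0 < r & forall z, polydisc r z -> P (p + z).
Proof.
split=> [/nbhs_ballP[e /= e0 he]|[r r0 hr]].
  exists (e / 2); first by rewrite divr_gt0.
  move=> z hz; apply: he; split=> // i j.
  rewrite !ord1 -ball_normE /= mxE opprD addNKr normrN.
  by apply: le_lt_trans (hz j) _; rewrite ltr_pdivrMr// ltr_pMr// (ltr_nat _ 1 2).
apply/nbhs_ballP; exists r => // z [_ hz]; rewrite -[z](subrK p) addrC; apply: hr => i.
by have := hz 0 i; rewrite -ball_normE /= -normrN opprB !mxE => /ltW.
Qed.

Lemma ps_ex n r M (c : MI n -> C) : 0 < r -> abound (fun al => c al * r ^+ mdeg al) M ->
  exists f, ps r M c f.
Proof.
move=> r0 hc; have h z : exists l, polydisc r z -> summ (fun al => c al * mpow z al) l.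
  have [hz|nz] := pselect (polydisc r z); last by exists 0.
  have [|l hl] := @summ_ex _ _ (fun al => c al * mpow z al) M; last by exists l.
  apply: abound_le hc => // al; rewrite !normrM ler_wpM2l//.
  by rewrite [leRHS]normrX (gtr0_norm r0) norm_mpow// ltW.
by have [f hf] := choice h; exists f.
Qed.

Lemma ps_le n r r' M (c : MI n -> C) f : 0 < r' -> r' <= r -> ps r M c f -> ps r' M c f.
Proof.
move=> r0' rr [r0 hc hf]; split=> //.
  apply: abound_le hc => // al; rewrite !normrM ler_wpM2l// !normrX lerXn2r ?nnegrE//.
  by rewrite !gtr0_norm.
by move=> z hz; apply: hf; exact: polydisc_le hz.
Qed.

Lemma ps_add n r M M' (c d : MI n -> C) f g : ps r M c f -> ps r M' d g ->
  ps r (M + M') (fun al => c al + d al) (fun z => f z + g z).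
Proof.
move=> [r0 hc hf] [_ hd hg]; split=> //.
  by apply: abound_le (abound_add hc hd) => // al; rewrite mulrDl.
by move=> z hz; apply: summ_ext (summ_add (hf z hz) (hg z hz)) => al; rewrite mulrDl.
Qed.

Lemma ps_near n r M (c : MI n -> C) f g : ps r M c f ->
  (\forall z \near (0 : 'rV[C]_n), f z = g z) -> exists2 r', 0 < r' & ps r' M c g.
Proof.
move=> hf /near0P[s s0 fg].
have r0 : 0 < r by case: hf.
have [t [t0 ts tr]] := pos_lower_bound2 s0 r0; exists t => //.
have [_ hc hf'] := ps_le t0 tr hf; split=> // z hz.
by rewrite -fg; [exact: hf'|exact: polydisc_le hz].
Qed.

Lemma holo_ps n (f : 'rV[C]_n -> C) : holo_at 0 f -> exists r M c, ps r M c f.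
Proof. by move=> /holo_hb[r [M [c h]]]; exists r, M, c. Qed.

Lemma ps_holo n r M (c : MI n -> C) f : ps r M c f -> holo_at 0 f.
Proof. by move=> h; apply: (@hb_holo _ _ r M); exists c. Qed.

(** Induction on the degree: up to a nonzero integer, the coefficient at [al] is a coefficient of
    [pd j f] of degree one less, for any [j] with [al j] positive. *)
Lemma ps_zero n r M (c : MI n -> C) f al : ps r M c f ->
  (\forall z \near (0 : 'rV[C]_n), f z = 0) -> c al = 0.
Proof.
have [k hk] : exists k, mdeg al = k by exists (mdeg al).
elim: k al hk r M c f => [|k ih] al hk r M c f hf f0.
  by rewrite (mdeg_eq0 hk) -(ps_at0 hf); exact: nbhs_singleton f0.
have [j hj] : exists j, al j != 0%N.
  apply/existsP; apply: contra_eqT hk; rewrite negb_exists => /forallP h.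
  by rewrite /mdeg big1// => i _; apply/eqP; rewrite -[_ == _]negbK.
pose be := misub al (mi1 j).
have alE : miadd (mi1 j) be = al.
  by rewrite misubK// => i; rewrite ffunE; case: eqP => //= ->; rewrite lt0n.
have bk : mdeg be = k.
  by apply/eqP; rewrite -eqSS -hk -alE mdeg_add mdeg1.
have [hd _] := ps_pd j hf.
have d0 : \forall z \near (0 : 'rV[C]_n), pd j f z = 0.
  apply: filterS (near_near f0) => z hz.
  by rewrite (pd_near j hz) pd_const.
have /eqP := ih be bk _ _ _ _ hd d0.
by rewrite /dcoef alE mulf_eq0 pnatr_eq0 /= => /eqP.
Qed.

(** Restriction to the complex line [t |-> p + t (w - p)] gives a series in one variable which
    vanishes near 0, hence also at [t = 1]. With [p] and [w] in the polydisc of radius [r / 4], the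
    line stays in that of radius [r] for [|t| <= 1]. *)
Lemma hb_zero_open n r M (g : 'rV[C]_n -> C) p : hb r M g -> polydisc (r / 4) p ->
  (\forall y \near p, g y = 0) -> forall w, polydisc (r / 4) w -> g w = 0.
Proof.
move=> hg hp /near_polydiscP[e e0 he] w hw; have r0 := hb_r0 hg.
have r4 : r / 4 + (r / 4 + r / 4) <= r.
  rewrite -[leRHS]mulr1 -!mulrDr ler_wpM2l ?(ltW r0)//.
  have -> : (4^-1 + (4^-1 + 4^-1) : C) = 3 / 4 by field.
  by rewrite ler_pdivrMr// mul1r ler_nat.
pose y (t : 'rV[C]_1) := p + t 0 0 *: (w - p).
have hy i : hb 1 r (fun t => y t 0 i).
  have h := hb_add (@hb_const _ 1 _ (p 0 i) ltr01) (hb_scale (w 0 i - p 0 i) (hb_coord 0 ltr01)).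
  have h' := hb_le ltr01 (lexx _) _ h; apply: hb_ext (h' r _).
    by move=> t _; rewrite !mxE mulrC.
  rewrite mulr1; apply: le_trans r4; apply: lerD (hp i) _.
  by apply: le_trans (ler_normB _ _) _; apply: lerD.
have [c hc] := hb_comp ltr01 hg hy.
have z0 : \forall t \near (0 : 'rV[C]_1), g (y t) = 0.
  apply/near0P; exists (e / (r + 1)); first by rewrite divr_gt0// ltr_wpDr// ltW.
  move=> t ht; apply: he => i; rewrite !mxE normrM.
  apply: (@le_trans _ _ (e / (r + 1) * r)).
    apply: ler_pM => //; apply: le_trans (ler_normB _ _) _.
    apply: le_trans (lerD (hw i) (hp i)) _; apply: le_trans r4.
    by rewrite lerDr divr_ge0// ltW.
  rewrite mulrAC ler_pdivrMr ?ltr_wpDr ?(ltW r0)// ler_wpM2l ?(ltW e0)//.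
  by rewrite lerDl.
have c0 al : c al = 0 by exact: ps_zero hc z0.
have [_ _ /(_ (const_mx 1))] := hc.
rewrite /y mxE scale1r addrC subrK => h.
apply: summ_uniq (h _) _; first by move=> i; rewrite mxE normr1.
by apply: summ_ext (@summ0 _ _) => al; rewrite c0 mul0r.
Qed.

(** If [f] is nonzero at a point arbitrarily close to 0, it is nonzero around that point by
    continuity. There [g] must vanish, and the identity theorem carries this to a neighbourhood of
    0. *)
Lemma holo_domain n (f g : 'rV[C]_n -> C) : holo_at 0 f -> holo_at 0 g ->
  (\forall z \near (0 : 'rV[C]_n), f z * g z = 0) ->
  (\forall z \near (0 : 'rV[C]_n), f z = 0) \/ (\forall z \near (0 : 'rV[C]_n), g z = 0).
Proof.
move=> hf hg /near0P[e e0 fg]; have [r [M [M' [h h']]]] := holo_hb2 hf hg.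
have r0 := hb_r0 h; have r40 : 0 < r / 4 by rewrite divr_gt0.
have e20 : 0 < e / 2 by rewrite divr_gt0.
have [s [s0 se sr]] := pos_lower_bound2 e20 r40.
have [f0|nf] := pselect (forall z, polydisc s z -> f z = 0).
  by left; apply/near0P; exists s.
right; have [p hp] : exists p, polydisc s p /\ f p <> 0.
  apply: contrapT => hn; apply: nf => z hz; apply: contrapT => fz.
  by apply: hn; exists z.
case: hp => hp fp.
have cf : {for p, continuous f}.
  apply: differentiable_continuous; apply: (hb_differentiable h).
  apply: polydisc_le hp; apply: le_trans sr _.
  by rewrite ler_wpM2l ?(ltW r0)// lef_pV2 ?posrE// ler_nat.
have fn0 : \forall y \near p, f y != 0.
  have /cvgrPdist_lt/(_ `|f p|) := cf; rewrite normr_gt0 => /(_ (introN eqP fp)).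
  apply: filterS => y hy; apply/eqP => fy; move: hy.
  by rewrite fy subr0 ltxx.
apply/near0P; exists (r / 4) => //; apply: (hb_zero_open h' (polydisc_le sr hp)).
move/near_polydiscP: fn0 => [d d0 hd].
have [t [t0 td te]] := pos_lower_bound2 d0 e20.
apply/near_polydiscP; exists t => // z hz.
have fpz : f (p + z) != 0 by apply: hd; exact: polydisc_le hz.
have /eqP : f (p + z) * g (p + z) = 0.
  apply: fg => i; rewrite mxE [e]splitr; apply: le_trans (ler_normD _ _) _.
  by apply: lerD; [exact: le_trans (hp i) se|exact: le_trans (hz i) te].
by rewrite mulf_eq0 (negPf fpz) => /eqP.
Qed.

Lemma holo_domain_prod n (I : eqType) (s : seq I) (f : I -> 'rV[C]_n -> C) :
  (forall i, holo_at 0 (f i)) ->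
  (\forall z \near (0 : 'rV[C]_n), \prod_(i <- s) f i z = 0) ->
  exists i, \forall z \near (0 : 'rV[C]_n), f i z = 0.
Proof.
move=> hf; elim: s => [|i s ih] h.
  by have := nbhs_singleton h; rewrite big_nil => /eqP; rewrite oner_eq0.
have hp : holo_at 0 (fun z => \prod_(i <- s) f i z) by exact: holo_prod.
have [||h'] := holo_domain (hf i) hp; first by apply: filterS h => z; rewrite big_cons.
  by exists i.
exact: ih.
Qed.

(** With [z'] the projection of [z] to the hyperplane, [f z = f z - f z'], and this difference
    cancels every monomial that [z_j] does not divide. *)
Lemma holo_factor n (j : 'I_n) (f : 'rV[C]_n -> C) : holo_at 0 f ->
  (\forall z \near (0 : 'rV[C]_n), (z : 'rV[C]_n) 0 j = 0 -> f z = 0) ->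
  exists2 u : 'rV[C]_n -> C, holo_at 0 u & \forall z \near (0 : 'rV[C]_n), (f z = z 0 j * u z).
Proof.
move=> /holo_ps[r [M [c hc]]] /near0P[e e0 hf0].
have r0 : 0 < r by case: hc.
have [s [s0 sr se]] := pos_lower_bound2 r0 e0.
have [_ hB hf] := ps_le s0 sr hc; pose phi := miadd (mi1 j).
have phiI : injective phi := @miaddK _ _.
have [||u hu] := @ps_ex n s (`|s^-1| * M) (c \o phi) => //.
  apply: abound_le (abound_scale s^-1 (abound_reindex phiI hB)) => // al.
  rewrite /= /phi mdeg_add mdeg1 exprD expr1 mulrCA mulKf// gt_eqF//.
exists u; first exact: ps_holo hu.
apply/near0P; exists s => // z hz.
pose z' : 'rV[C]_n := \row_i if i == j then 0 else z 0 i.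
have hz' : polydisc s z'.
  by move=> i; rewrite mxE; case: eqP => // _; rewrite normr0 ltW.
have fz' : f z' = 0.
  by apply: hf0; [exact: polydisc_le hz'|rewrite mxE eqxx].
have mz' al : mpow z' al = if al j == 0%N then mpow z al else 0.
  rewrite !(mpow_split _ _ j) mxE eqxx.
  have -> : \prod_(i < n | i != j) z' 0 i ^+ al i = \prod_(i < n | i != j) z 0 i ^+ al i.
    by apply: eq_bigr => i /negPf ij; rewrite mxE ij.
  by rewrite expr0n; case: eqP => [->|_] /=; rewrite ?expr0// mul0r.
have h1 := summ_add (hf z hz) (summ_scale (-1) (hf z' hz')).
rewrite fz' mulr0 addr0 in h1.
apply: summ_uniq h1 _.
have [_ huB hu'] := hu.
apply: (@summ_extend _ _ _ phi _ (fun be => z 0 j * (c (phi be) * mpow z be)) (`|z 0 j| * (`|s^-1| * M))) => //.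
- move=> be; rewrite mz' {3}/phi ffunE /mi1 ffunE eqxx /= mulr0 mulr0 addr0.
  by rewrite {2}/phi mpow_add mpow1; ring.
- move=> al h; rewrite mz'; case: eqP => [_|/eqP aj]; first by ring.
  case: (h (misub al (mi1 j))); rewrite /phi misubK// => i.
  by rewrite ffunE; case: eqP => //= ->; rewrite lt0n.
- by apply: abound_scale; apply: (ps_abound hu hz).
- exact: summ_scale (hu' z hz).
Qed.

(** The left-hand side is the derivative of [z_j mu] in [z_j]; it multiplies the monomial of
    exponent [al] by [al j + 1], and the division by these integers does not increase the norm. *)
Lemma holo_primitive n (j : 'I_n) (b : 'rV[C]_n -> C) : holo_at 0 b ->
  exists2 mu, holo_at 0 mu &
    \forall z \near (0 : 'rV[C]_n), mu z + z 0 j * pd j mu z = b z.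
Proof.
move=> /holo_ps[r [M [c hc]]]; have [r0 hB hb] := hc.
pose d (al : MI n) := (al j).+1%:R^-1 * c al.
have [||mu hmu] := @ps_ex n r M d => //.
  apply: abound_le hB => // al; rewrite /d -mulrA normrM ler_piMl//.
  by rewrite normfV normr_nat invf_le1 ?ltr0n// (ler_nat _ 1).
exists mu; first exact: ps_holo hmu.
have [_ hd] := ps_pd j hmu; have [_ _ hm] := hmu.
apply/near0P; exists (r / 4) => [|z hz]; first by rewrite divr_gt0.
have hz' : polydisc r z.
  by apply: polydisc_le hz; rewrite ler_pdivrMr// ler_peMr ?(ltW r0)// (ler_nat _ 1).
apply: summ_uniq (summ_add (hm z hz') (hd z hz)) _.
apply: summ_ext (hb z hz') => al.
have k0 : (al j)%:R + 1 != 0 :> C by rewrite natr1 pnatr_eq0.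
by rewrite /d -natr1; field.
Qed.

End Coefficients.
(** * Inverse function theorem *)

Section InverseFunction.
Context (R : realType).
Local Notation C := R[i].
Local Notation MI n := {ffun 'I_n -> nat}.
Local Opaque holo_at.

Section Lipschitz.
Variables (k : nat) (rho s D : C).
Hypotheses (rho0 : 0 < rho) (s0 : 0 < s).

(** Models two monomials of degree [d] in quantities of size [s] and mutual distance [D]. The factor
    [d * s ^+ d / s] stands for [d * s ^+ (d - 1)]; written this way it is right at [d = 0] and
    follows the Leibniz rule under products. *)
Definition close_pair (d : nat) (F G : 'rV[C]_k -> C) :=
  [/\ hb rho (s ^+ d) F, hb rho (s ^+ d) G &
      hb rho (d%:R * s ^+ d / s * D) (fun z => F z - G z)].

Lemma close_pair_mul d d' F G F' G' : close_pair d F G -> close_pair d' F' G' ->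
  close_pair (d + d') (fun z => F z * F' z) (fun z => G z * G' z).
Proof.
move=> [hF hG hD] [hF' hG' hD']; split; rewrite ?exprD.
- exact: hb_mul.
- exact: hb_mul.
- have := hb_add (hb_mul hF hD') (hb_mul hD hG').
  rewrite (_ : _ + _ = (d + d')%:R * (s ^+ d * s ^+ d') / s * D); last first.
    by rewrite natrD; ring.
  by apply: hb_ext => z _; ring.
Qed.

Lemma close_pair1 : close_pair 0 (fun _ => 1) (fun _ => 1).
Proof.
have h := @hb_const R k rho 1 rho0; rewrite normr1 in h.
split; rewrite ?expr0//.
have := @hb_const R k rho 0 rho0; rewrite normr0 !mul0r.
by apply: hb_ext => z _; rewrite subrr.
Qed.

Lemma close_pair_ext d F G F' G' : F =1 F' -> G =1 G' ->
  close_pair d F G -> close_pair d F' G'.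
Proof. by move=> /funext -> /funext ->. Qed.

Lemma close_pair_exp d F G e : close_pair d F G ->
  close_pair (d * e) (fun z => F z ^+ e) (fun z => G z ^+ e).
Proof.
move=> h; elim: e => [|e ih].
  by rewrite muln0; apply: close_pair_ext close_pair1 => z; rewrite expr0.
by rewrite mulnS; apply: close_pair_ext (close_pair_mul h ih) => z; rewrite exprS.
Qed.

Lemma close_pair_prod (I : Type) (r : seq I) (d : I -> nat) (F G : I -> 'rV[C]_k -> C) :
  (forall i, close_pair (d i) (F i) (G i)) ->
  close_pair (\sum_(i <- r) d i) (fun z => \prod_(i <- r) F i z) (fun z => \prod_(i <- r) G i z).
Proof.
move=> h; elim: r => [|i r ih].
  by rewrite big_nil; apply: close_pair_ext close_pair1 => z; rewrite big_nil.
by rewrite big_cons; apply: close_pair_ext (close_pair_mul (h i) ih) => z; rewrite big_cons.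
Qed.

Lemma close_pair_mpow n (y y' : 'rV[C]_k -> 'rV[C]_n) al :
  (forall i, hb rho s (fun z => y z 0 i)) -> (forall i, hb rho s (fun z => y' z 0 i)) ->
  (forall i, hb rho D (fun z => y z 0 i - y' z 0 i)) ->
  close_pair (mdeg al) (fun z => mpow (y z) al) (fun z => mpow (y' z) al).
Proof.
move=> hy hy' hD; apply: close_pair_prod => i.
have h : close_pair 1 (fun z => y z 0 i) (fun z => y' z 0 i).
  split; rewrite ?expr1//.
  by rewrite mul1r divff ?mul1r// gt_eqF.
by have := close_pair_exp (al i) h; rewrite mul1n.
Qed.

End Lipschitz.

(** In degree [d >= 2] and for [s <= r / 4], the Lipschitz constant [d * s ^+ (d - 1)] of a monomial
    is at most [16 s / r^2] times its weight [r ^+ d]. The sum over all monomials is then at most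
    [16 s M / r^2], which is small with [s]. The estimate concerns norms of composites, so that it
    can be iterated on power series. *)
Lemma lipschitz_small n r M (c : MI n -> C) f kap : ps r M c f ->
  (forall al, (mdeg al < 2)%N -> c al = 0) -> 0 < kap ->
  exists2 s0 : C, 0 < s0 & forall k rho s D (y y' : 'rV[C]_k -> 'rV[C]_n),
    0 < rho -> 0 < s -> s <= s0 ->
    (forall i, hb rho s (fun z => y z 0 i)) -> (forall i, hb rho s (fun z => y' z 0 i)) ->
    (forall i, hb rho D (fun z => y z 0 i - y' z 0 i)) -> 0 <= D ->
    hb rho (kap * D) (fun z => f (y z) - f (y' z)).
Proof.
move=> [r0 hc hf] c0 kap0; have M0 := abound_ge0 hc.
have M1 : 0 < 16 * (M + 1) by rewrite mulr_gt0// ltr_wpDl.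
have a0 : 0 < r / 4 by rewrite divr_gt0.
(* The bound on [s] that makes [16 s M / r^2 <= kap], with [M + 1] in place of [M] to avoid a zero
   denominator. *)
have b0 : 0 < kap * r ^+ 2 / (16 * (M + 1)) by rewrite divr_gt0// mulr_gt0// exprn_gt0.
have [s0 [s00 sa sb]] := pos_lower_bound2 a0 b0.
exists s0 => // k rho s D y y' rho0 sp ss hy hy' hD D0.
have rn0 : r != 0 by rewrite gt_eqF.
have sn0 : s != 0 by rewrite gt_eqF.
pose t := s / r; have t0 : 0 < t by rewrite divr_gt0.
have t4 : t <= 4^-1 by rewrite ler_pdivrMr// mulrC; apply: le_trans ss sa.
have sr : s = t * r by rewrite /t divfK.
have key d : (2 <= d)%N -> d%:R * s ^+ d / s <= 16 * s / r ^+ 2 * r ^+ d.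
  case: d => [|[|d]]// _; rewrite sr exprMn.
  have -> : d.+2%:R * (t ^+ d.+2 * r ^+ d.+2) / (t * r) = r ^+ d.+1 * t * (d.+2%:R * t ^+ d).
    by rewrite !exprS; field; rewrite rn0 gt_eqF.
  have -> : 16 * (t * r) / r ^+ 2 * r ^+ d.+2 = r ^+ d.+1 * t * 16.
    by rewrite !exprS; field.
  have rt0 : 0 <= r ^+ d.+1 * t by apply: mulr_ge0; [exact/exprn_ge0/ltW|exact: ltW].
  apply: (ler_wpM2l rt0).
  apply: (@le_trans _ _ (4 ^+ d.+2 * 4^-1 ^+ d)).
    apply: ler_pM; [exact: ler0n|exact/exprn_ge0/ltW|exact: natr_le_exp4|].
    by apply: lerXn2r; rewrite ?nnegrE ?invr_ge0// ltW.
  have -> : (4 : C) ^+ d.+2 * 4^-1 ^+ d = 16 * (4 * 4^-1) ^+ d.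
    by rewrite exprMn !exprS; ring.
  by rewrite divff// expr1n mulr1.
have rp2 : 16 * s / r ^+ 2 * M <= kap.
  have : s <= kap * r ^+ 2 / (16 * (M + 1)) by exact: le_trans ss sb.
  rewrite ler_pdivlMr// => h.
  have -> : 16 * s / r ^+ 2 * M = (s * (16 * M)) / r ^+ 2 by ring.
  rewrite ler_pdivrMr ?exprn_gt0//; apply: le_trans h.
  by apply: (ler_wpM2l (ltW sp)); apply: ler_wpM2l => //; rewrite lerDl.
have p0 : 0 <= 16 * s / r ^+ 2 * D.
  apply: mulr_ge0 D0; apply: divr_ge0; last exact/exprn_ge0/ltW.
  by apply: mulr_ge0 => //; exact: ltW.
apply: (@hb_summ _ _ _ (fun al z => c al * (mpow (y z) al - mpow (y' z) al))
   (fun al => `|c al| * ((mdeg al)%:R * s ^+ mdeg al / s * D))) => //.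
- move=> al; apply: hb_scale.
  by have [] := close_pair_mpow rho0 sp al hy hy' hD.
- have := abound_scale (16 * s / r ^+ 2 * D) hc; rewrite ger0_norm//.
  apply: abound_le => [al|]; last first.
    have -> : 16 * s / r ^+ 2 * D * M = 16 * s / r ^+ 2 * M * D by ring.
    exact: ler_wpM2r.
  have [/c0 ->|d2] := ltnP (mdeg al) 2; first by rewrite normr0 !mul0r normr0 mulr0.
  rewrite normrM normr_id [X in _ <= `|X|]mulrCA [leRHS]normrM ler_wpM2l//.
  have q0 : 0 <= (mdeg al)%:R * s ^+ mdeg al / s * D.
    apply: mulr_ge0 D0; apply: divr_ge0; last exact: ltW.
    by apply: mulr_ge0; [exact: ler0n|exact/exprn_ge0/ltW].
  rewrite (ger0_norm q0) ger0_norm; last by apply: mulr_ge0 p0 _; exact/exprn_ge0/ltW.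
  have -> : 16 * s / r ^+ 2 * D * r ^+ mdeg al = 16 * s / r ^+ 2 * r ^+ mdeg al * D by ring.
  by apply: (ler_wpM2r D0); exact: key.
move=> z hz.
have hyz : polydisc r (y z).
  move=> i; apply: le_trans (hb_norm (hy i) hz) _; apply: le_trans ss _.
  by apply: le_trans sa _; rewrite ler_pdivrMr// ler_peMr ?(ltW r0)// (ler_nat _ 1).
have hyz' : polydisc r (y' z).
  move=> i; apply: le_trans (hb_norm (hy' i) hz) _; apply: le_trans ss _.
  by apply: le_trans sa _; rewrite ler_pdivrMr// ler_peMr ?(ltW r0)// (ler_nat _ 1).
have h := summ_add (hf _ hyz) (summ_scale (-1) (hf _ hyz')).
by rewrite mulN1r in h; apply: summ_ext h => al; ring.
Qed.

Lemma coef_vanish n r M (c : MI n -> C) f : ps r M c f -> f 0 = 0 ->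
  (forall j, pd j f 0 = 0) -> forall al, (mdeg al < 2)%N -> c al = 0.
Proof.
move=> hc f0 df al; case e : (mdeg al) => [|[|k]]// _.
  by rewrite (mdeg_eq0 e) -(ps_at0 hc).
have [j alj] := mdeg1_ex e; have [hd _] := ps_pd j hc.
have := ps_at0 hd; rewrite df /dcoef ffunE mul1r => ->; congr c.
by rewrite alj; apply/ffunP => i; rewrite !ffunE addn0.
Qed.

Lemma holo_map_id n : holo_map_at 0 (fun z : 'rV[C]_n => z).
Proof. by move=> j; exact: holo_coord. Qed.

(** Picard iteration [W_(k+1) = x - h(W_k)] from [W_0 = 0]. As [h] has order at least two, it
    contracts by 1/2 in the weighted norm, so the increments are summable there and the limit is
    again a power series. *)
Lemma inverse_near_id n (h : 'rV[C]_n -> 'rV[C]_n) : holo_map_at 0 h -> h 0 = 0 ->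
  (forall i j, pd i (fun z => h z 0 j) 0 = 0) ->
  exists W, biholo (fun w => w + h w) W.
Proof.
move=> hh h0 dh.
have hl j : exists2 s0 : C, 0 < s0 & forall k rho s D (y y' : 'rV[C]_k -> 'rV[C]_n),
    0 < rho -> 0 < s -> s <= s0 ->
    (forall i, hb rho s (fun z => y z 0 i)) -> (forall i, hb rho s (fun z => y' z 0 i)) ->
    (forall i, hb rho D (fun z => y z 0 i - y' z 0 i)) -> 0 <= D ->
    hb rho (2^-1 * D) (fun z => h (y z) 0 j - h (y' z) 0 j).
  have [r [M [c hc]]] := holo_ps (hh j).
  apply: (lipschitz_small hc); last by rewrite invr_gt0.
  by apply: coef_vanish hc _ _ => [|i]; [rewrite h0 mxE|exact: dh].
have [sj hsj] := choice (fun j => let: ex_intro2 s a b := hl j in ex_intro _ s (conj a b)).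
have [|s s0 hs] := @pos_lower_bound R 'I_n sj; first by move=> i; case: (hsj i).
have lip k rho D (y y' : 'rV[C]_k -> 'rV[C]_n) j : 0 < rho ->
    (forall i, hb rho s (fun z => y z 0 i)) -> (forall i, hb rho s (fun z => y' z 0 i)) ->
    (forall i, hb rho D (fun z => y z 0 i - y' z 0 i)) -> 0 <= D ->
    hb rho (2^-1 * D) (fun z => h (y z) 0 j - h (y' z) 0 j).
  by case: (hsj j) => _ H rho0; exact: H.
(* Constant functions of one auxiliary variable turn the norm estimate into a pointwise one. *)
have lip_pt w w' e j : polydisc s w -> polydisc s w' -> 0 <= e ->
    polydisc e (w - w') -> `|h w 0 j - h w' 0 j| <= 2^-1 * e.
  move=> hw hw' e0 hww.
  have H1 (k : C) B : `|k| <= B -> hb 1 B (fun _ : 'rV[C]_1 => k).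
    by move=> kB; apply: hb_le kB (@hb_const _ 1 _ k ltr01).
  have := @lip 1%N 1 e (fun _ => w) (fun _ => w') j ltr01.
  move=> /(_ (fun i => H1 _ _ (hw i)) (fun i => H1 _ _ (hw' i))).
  move=> /(_ _ e0) H2.
  have H3 : forall i, hb 1 e (fun _ : 'rV[C]_1 => w 0 i - w' 0 i).
    by move=> i; apply: H1; have := hww i; rewrite !mxE.
  by apply: (hb_norm (H2 H3) (z := 0)); exact: polydisc0.
pose rho := s / 2; have rho0 : 0 < rho by rewrite divr_gt0.
pose W := fix W k (x : 'rV[C]_n) := if k is k'.+1 then x - h (W k' x) else 0.
have WE k x : W k.+1 x = x - h (W k x) by [].
pose q k : C := 2^-1 ^+ k.
have q0 k : 0 <= q k by rewrite exprn_ge0// invr_ge0.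
have qS k : q k.+1 = 2^-1 * q k by rewrite /q exprS.
(* [rho * (2 - 2 * q k)] is the partial sum of the bounds [rho * q i] on the increments; it stays
   below [2 * rho = s], where [h] contracts. *)
have Whs k : (forall j, hb rho (rho * (2 - 2 * q k)) (fun x => W k x 0 j)) ->
   forall j, hb rho s (fun x => W k x 0 j).
  move=> H j; apply: hb_le (H j) => //.
  rewrite -[leRHS](divfK (_ : 2 != 0))// ler_wpM2l ?(ltW rho0)//.
  by rewrite lerBlDr lerDl mulr_ge0.
have hW k : (forall j, hb rho (rho * (2 - 2 * q k)) (fun x => W k x 0 j)) /\ (forall j, hb rho (rho * q k) (fun x => W k.+1 x 0 j - W k x 0 j)).
  elim: k => [|k [ih1 ih2]].
    split=> j.
      have := @hb_const R n rho 0 rho0; rewrite normr0 /q expr0 mulr1 subrr mulr0.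
      by apply: hb_ext => x _; rewrite mxE.
    have := @hb_coord R n rho j rho0; rewrite /q expr0 mulr1.
    by apply: hb_ext => x _; rewrite /= h0 !mxE !subr0.
  have ih1' j : hb rho (rho * (2 - 2 * q k.+1)) (fun x => W k.+1 x 0 j).
    have := hb_add (ih1 j) (ih2 j).
    rewrite (_ : _ + _ = rho * (2 - 2 * q k.+1)); last by rewrite qS; field.
    by apply: hb_ext => x _; ring.
  split=> // j.
  have D0 : 0 <= rho * q k by rewrite mulr_ge0// ltW.
  have := hb_scale (-1) (lip _ _ _ _ _ j rho0 (Whs _ ih1') (Whs _ ih1) ih2 D0).
  rewrite normrN normr1 mul1r (_ : 2^-1 * (rho * q k) = rho * q k.+1); last by rewrite qS mulrCA.
  by apply: hb_ext => x _; rewrite !WE !mxE; ring.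
have Ws k := Whs k (hW k).1.
have habs : abound (fun k => rho * q k) s.
  have := @abound_half R (2^-1 : C) rho; rewrite /rho divfK//; apply; last exact: ltW.
  by rewrite ger0_norm// invr_ge0.
have hlim x j : exists l, polydisc rho x -> summ (fun k => W k.+1 x 0 j - W k x 0 j) l.
  have [hx|nx] := pselect (polydisc rho x); last by exists 0.
  have [|l Hl] := @summ_ex _ _ (fun k => W k.+1 x 0 j - W k x 0 j) s; last by exists l.
  apply: abound_le habs => // k; rewrite [leRHS]ger0_norm; last by rewrite mulr_ge0// ltW.
  exact: hb_norm ((hW k).2 j) hx.
have hlim' x : exists Vx : 'I_n -> C, forall j, polydisc rho x ->
    summ (fun k => W k.+1 x 0 j - W k x 0 j) (Vx j) by have [Vx hVx] := choice (hlim x); exists Vx.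
have [V hV] := choice hlim'.
pose Wi x : 'rV[C]_n := \row_j V x j.
have hWi j : hb rho s (fun x => Wi x 0 j).
  apply: (@hb_summ _ _ _ (fun k x => W k.+1 x 0 j - W k x 0 j) (fun k => rho * q k)) => //.
    by move=> k; exact: (hW k).2.
  by move=> x hx; rewrite mxE; exact: hV.
have lim x e : polydisc rho x -> 0 < e -> exists N0, forall N, (N0 <= N)%N ->
    polydisc e (W N x - Wi x).
  move=> hx e0.
  have H j : exists N0, forall N, (N0 <= N)%N -> `|W N x 0 j - Wi x 0 j| <= e.
    have [t ut ht] := hV x j hx e e0.
    exists (\max_(k <- t) k).+1 => N hN.
    have := ht (iota 0 N) (iota_uniq _ _).
    have -> : \sum_(k <- iota 0 N) (W k.+1 x 0 j - W k x 0 j) = W N x 0 j.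
      rewrite -[N in iota 0 N]subn0 -/(index_iota 0 N) telescope_sumr// [W 0 x]/= mxE.
      by rewrite subr0.
    rewrite mxE; apply => k kt; rewrite mem_iota /= add0n.
    by apply: leq_trans hN; rewrite ltnS; exact: leq_bigmax_seq.
  have [N0 hN0] := choice H.
  exists (\max_j N0 j) => N hN j; have := hN0 j N; rewrite !mxE; apply.
  by apply: leq_trans hN; exact: leq_bigmax.
have Wid x : polydisc rho x -> polydisc s (Wi x).
  by move=> hx j; exact: hb_norm (hWi j) hx.
(* Limit of the recursion [W N.+1 x + h (W N x) = x]. *)
have TW x : polydisc rho x -> Wi x + h (Wi x) = x.
  move=> hx; apply/rowP => j; apply/eqP; rewrite -subr_eq0; apply/eqP/le_eps_eq0 => e e0.
  have e2 : 0 < e / 2 by rewrite divr_gt0.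
  have [N hN] := lim x _ hx e2.
  have h1 := hN N (leqnn _); have h2 := hN N.+1 (leqnSn _).
  have h3 : `|h (W N x) 0 j - h (Wi x) 0 j| <= 2^-1 * (e / 2).
    apply: lip_pt => //; last exact: ltW.
      by move=> i; exact: hb_norm (Ws N i) hx.
    exact: Wid.
  have -> : (Wi x + h (Wi x)) 0 j - x 0 j =
     - ((W N.+1 x - Wi x) 0 j) - (h (W N x) 0 j - h (Wi x) 0 j).
    by rewrite WE !mxE; ring.
  rewrite [e]splitr; apply: le_trans (ler_normB _ _) _; rewrite normrN.
  apply: lerD (h2 j) (le_trans h3 _).
  by rewrite ler_piMl ?(ltW e2)// invf_le1// (ler_nat _ 1 2).
(* At a coordinate that realises the norm of [w - w'], equality of the images contradicts the
   contraction by 1/2 unless [w = w']. *)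
have inj w w' : polydisc s w -> polydisc s w' -> w + h w = w' + h w' -> w = w'.
  move=> hw hw' e; apply/eqP; rewrite -subr_eq0 -normr_eq0; apply/negPn/negP => n0.
  have [[i j] /= hij] := mx_norm_neq0 n0.
  have hww : polydisc `|w - w'| (w - w') by move=> l; exact: coord_le_norm.
  have := lip_pt w w' _ j hw hw' (normr_ge0 _) hww.
  have -> : h w 0 j - h w' 0 j = - ((w - w') i j).
    have /rowP/(_ j) := e; rewrite !mxE (ord1 i) => e'.
    have -> : h w 0 j = w' 0 j + h w' 0 j - w 0 j by rewrite -e'; ring.
    ring.
  have hij' : `|w - w'| = `|(w - w') i j| := hij.
  have np : 0 < `|w - w'| by rewrite normr_gt0 -normr_eq0.
  rewrite normrN -hij' -[X in X <= _]mul1r ler_pM2r//.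
  by rewrite -[leRHS]div1r ler_pdivlMr// mul1r (ler_nat _ 2 1).
have near_T : \forall w \near (0 : 'rV[C]_n), polydisc rho (w + h w).
  apply: (@holo_map_continuous _ _ _ (fun w => w + h w)); last exact: near_polydisc.
    move=> j; have H := holo_add (holo_coord j) (hh j).
    by rewrite (_ : (fun z => _) = (fun z : 'rV[C]_n => z 0 j + h z 0 j))//; apply/funext => z; rewrite mxE.
  by rewrite h0 addr0.
have WT : \forall w \near (0 : 'rV[C]_n), Wi (w + h w) = w.
  have H1 := near_T; have H2 := @near_polydisc R n s s0.
  apply: filterS2 H1 H2 => w hw hw'.
  by apply: inj => //; [exact: Wid|exact: TW].
exists Wi; split.
- move=> j; have H := holo_add (holo_coord j) (hh j).
  by rewrite (_ : (fun z => _) = (fun z : 'rV[C]_n => z 0 j + h z 0 j))//; apply/funext => z; rewrite mxE.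
- by move=> j; apply: hb_holo (hWi j).
- split; first by rewrite h0 addr0.
  by have := nbhs_singleton WT; rewrite h0 addr0.
- exact: WT.
- by apply: filterS (@near_polydisc R n rho rho0) => x; exact: TW.
Qed.

End InverseFunction.

(** * Germs of biholomorphisms; logarithm and exponential of germs *)

Section Biholo.
Context (R : realType).
Local Notation C := R[i].
Local Opaque holo_at.

Lemma holo_linear n m (A : 'M[C]_(n, m)) : holo_map_at 0 (fun z : 'rV[C]_n => z *m A).
Proof.
move=> j; have H : holo_at 0 (fun z : 'rV[C]_n => \sum_i z 0 i * A i j).
  apply: holo_sum => i; exact: (holo_mul (holo_coord i) (holo_const n (A i j))).
by rewrite (_ : (fun z => _) = (fun z : 'rV[C]_n => \sum_i z 0 i * A i j))//; apply/funext => z; rewrite mxE.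
Qed.

Lemma holo_map_comp n m k (S : 'rV[C]_m -> 'rV[C]_k) (T : 'rV[C]_n -> 'rV[C]_m) :
  holo_map_at 0 S -> holo_map_at 0 T -> T 0 = 0 -> holo_map_at 0 (fun z => S (T z)).
Proof. by move=> hS hT T0 j; exact: (@holo_comp _ _ _ (fun z => S z 0 j)) (hS j) hT T0. Qed.

Lemma holo_map_diff n m (T : 'rV[C]_n -> 'rV[C]_m) : holo_map_at 0 T ->
  \forall z \near (0 : 'rV[C]_n), forall i, differentiable (fun y => T y 0 i) z.
Proof. by move=> hT; apply: near_forall => i; exact: holo_diff (hT i). Qed.

Lemma holo_const_mx n (g : 'rV[C]_n -> C) : holo_at 0 g ->
  holo_map_at 0 (fun z => const_mx (g z) : 'rV[C]_1).
Proof.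
move=> hg j; rewrite (_ : (fun z => _) = g)//.
by apply/funext => z; rewrite mxE.
Qed.

Lemma biholo_comp n (S Si T Ti : 'rV[C]_n -> 'rV[C]_n) :
  biholo S Si -> biholo T Ti -> biholo (fun z => S (T z)) (fun z => Ti (Si z)).
Proof.
move=> [hS hSi [S0 Si0] SiS SSi] [hT hTi [T0 Ti0] TiT TTi]; split.
- exact: holo_map_comp.
- exact: holo_map_comp.
- by rewrite T0 Si0.
- have H := holo_map_continuous hT T0 SiS.
  by apply: filterS2 H TiT => z -> ->.
- have H := holo_map_continuous hSi Si0 TTi.
  by apply: filterS2 H SSi => z -> ->.
Qed.

Lemma biholo_sym n (S Si : 'rV[C]_n -> 'rV[C]_n) : biholo S Si -> biholo Si S.
Proof. by case=> h1 h2 [h3 h4] h5 h6; split. Qed.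

Lemma biholo_id n : biholo (fun z : 'rV[C]_n => z) (fun z => z).
Proof.
by split; try exact: holo_map_id; try (by split); apply/near0P; exists 1.
Qed.

Lemma jacobian_linear n m (A : 'M[C]_(n, m)) p : jacobian (fun z : 'rV[C]_n => z *m A) p = A.
Proof.
have dA : differentiable (fun z : 'rV[C]_n => z *m A) p.
  apply: differentiable_row => j.
  rewrite (_ : (fun z => _) = \sum_i (A i j *: (fun z : 'rV[C]_n => z 0 i))).
    apply: differentiable_sum => i; apply: differentiableZ; exact: differentiable_coord.
  apply/funext => z; rewrite mxE fct_sumE; apply: eq_bigr => i _.
  by rewrite mulrC.
apply/matrixP => i j; rewrite jacobianE// unlock.
apply: (@derive_quadratic _ _ _ _ _ _ 0 1) => // t _.
rewrite (_ : _ - _ - _ = 0) ?normr0 ?mulr0//.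
by rewrite mulmxDl -scalemxAl -rowE !mxE; ring.
Qed.

Lemma jacobian_id n p : jacobian (fun z : 'rV[C]_n => z) p = 1%:M.
Proof.
by rewrite -[RHS](jacobian_linear 1%:M p); congr jacobian; apply/funext => z; rewrite mulmx1.
Qed.

Lemma biholo_linear n (A : 'M[C]_n) : A \in unitmx ->
  biholo (fun z : 'rV[C]_n => z *m A) (fun z => z *m invmx A).
Proof.
move=> uA; split; [exact: holo_linear|exact: holo_linear|by rewrite !mul0mx| |].
  by apply/near0P; exists 1 => // z _; rewrite mulmxK.
by apply/near0P; exists 1 => // z _; rewrite mulmxKV.
Qed.

(** Composition with the inverse of the Jacobian at 0 reduces to a map of the form [z + h z] with
    [h] of order at least two. *)
Lemma inverse_function n (T : 'rV[C]_n -> 'rV[C]_n) : holo_map_at 0 T -> T 0 = 0 ->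
  jdet T 0 != 0 -> exists Ti, biholo T Ti.
Proof.
rewrite unlock => hT T0 dT; set A := jacobian T 0 in dT.
have uA : A \in unitmx by rewrite unitmxE unitfE.
pose T' z := T z *m invmx A; pose h z := T' z - z.
have hT' : holo_map_at 0 T' := holo_map_comp (holo_linear (invmx A)) hT T0.
have hh : holo_map_at 0 h.
  move=> j; have H := holo_sub (hT' j) (holo_coord j).
  by rewrite (_ : (fun z => _) = (fun z => T' z 0 j - z 0 j))//; apply/funext => z; rewrite !mxE.
have T'0 : T' 0 = 0 by rewrite /T' T0 mul0mx.
have dT0 := nbhs_singleton (holo_map_diff hT).
have dT'0 := nbhs_singleton (holo_map_diff hT').
have [||W hW] := inverse_near_id hh.
- by rewrite /h T'0 subrr.
- move=> i j; rewrite (_ : (fun z => _) = (fun z => T' z 0 j - z 0 j)); last first.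
    by apply/funext => z; rewrite !mxE.
  rewrite (pd_sub _ (dT'0 j) (differentiable_coord _ _ _)) pd_coord.
  rewrite -(jacobianE i j (differentiable_row dT'0)).
  rewrite (jacobian_comp (S := fun z => z *m invmx A) dT0); last first.
    by move=> l; have := nbhs_singleton (holo_map_diff (holo_linear (invmx A))); rewrite T0.
  by rewrite jacobian_linear -/A mulmxV// mxE eq_sym subrr.
exists (fun x => W (x *m invmx A)).
have := biholo_comp (biholo_linear uA) hW.
rewrite (_ : (fun z => (z + h z) *m A) = T)//.
by apply/funext => z; rewrite /h addrC subrK /T' mulmxKV.
Qed.

Lemma pd_comp1 n (L : 'rV[C]_1 -> C) (g : 'rV[C]_n -> C) p j : differentiable g p ->
  differentiable L (const_mx (g p)) ->
  pd j (fun z => L (const_mx (g z))) p = pd j g p * pd 0 L (const_mx (g p)).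
Proof.
move=> dg dL; have gE : (fun z => (const_mx (g z) : 'rV[C]_1) 0 0) = g.
  by apply/funext => z; rewrite mxE.
rewrite (@pd_comp _ _ _ L (fun z => const_mx (g z)))//; first by rewrite big_ord1 gE.
by move=> i; rewrite ord1 gE.
Qed.

Lemma rV1E (t : 'rV[C]_1) : t = const_mx (t 0 0).
Proof. by apply/rowP => i; rewrite mxE ord1. Qed.

Lemma rV1_near (P : 'rV[C]_1 -> Prop) n (g : 'rV[C]_n -> C) : holo_at 0 g -> g 0 = 0 ->
  (\forall t \near (0 : 'rV[C]_1), P t) -> \forall z \near (0 : 'rV[C]_n), P (const_mx (g z)).
Proof.
move=> hg g0 hP; apply: holo_map_continuous (holo_const_mx hg) _ hP.
by rewrite g0; apply/rowP => i; rewrite !mxE.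
Qed.

Lemma holo_comp1 n (L : 'rV[C]_1 -> C) (g : 'rV[C]_n -> C) : holo_at 0 L -> holo_at 0 g ->
  g 0 = 0 -> holo_at 0 (fun z => L (const_mx (g z))).
Proof.
move=> hL hg g0; apply: (@holo_comp _ _ _ L (fun z => const_mx (g z))) hL _ _.
  exact: holo_const_mx.
by rewrite g0; apply/rowP => i; rewrite !mxE.
Qed.

(** The primitive vanishing at 0 comes factored as [t * mu t]: [mu] is what the radial map
    multiplies a coordinate by. *)
Lemma holo_primitive1 (b : 'rV[C]_1 -> C) : holo_at 0 b ->
  exists mu, [/\ holo_at 0 mu, mu 0 = b 0 &
    \forall t \near (0 : 'rV[C]_1), pd 0 (fun t => t 0 0 * mu t) t = b t].
Proof.
move=> hb; have [mu hmu mub] := holo_primitive 0 hb; exists mu; split=> //.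
  by have := nbhs_singleton mub; rewrite mxE mul0r addr0.
have H1 := holo_diff hmu.
apply: filterS2 mub H1 => t <- dmu.
rewrite pd_mul ?pd_coord ?eqxx ?mulr1 1?addrC//.
exact: differentiable_coord.
Qed.

(** [L] is log(1 + t), defined as a primitive; the exponential is obtained from its inverse germ. *)
Let log1p_ex : exists L, [/\ holo_at 0 L, L 0 = 0 &
  \forall t \near (0 : 'rV[C]_1), pd 0 L t = (1 + t 0 0)^-1].
Proof.
have hb : holo_at 0 (fun t : 'rV[C]_1 => (1 + t 0 0)^-1).
  apply: holo_inv; first exact: holo_add (holo_const _ _) (holo_coord _).
  by rewrite mxE addr0 oner_eq0.
have [mu [hmu _ H]] := holo_primitive1 hb.
exists (fun t : 'rV[C]_1 => t 0 0 * mu t); split; last exact: H.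
  exact: holo_mul (holo_coord _) hmu.
by rewrite mxE mul0r.
Qed.

(** [g] is the logarithm of [u / u 0]; the constant disappears in the logarithmic differential,
    which is all that is used of [g]. *)
Lemma unit_log n (u : 'rV[C]_n -> C) : holo_at 0 u -> u 0 != 0 ->
  exists2 g, holo_at 0 g & \forall z \near (0 : 'rV[C]_n), forall j, pd j u z = u z * pd j g z.
Proof.
move=> hu u0; have [L [hL _ dL]] := log1p_ex.
pose v z := (u 0)^-1 * u z - 1.
have hv : holo_at 0 v := holo_sub (holo_scale _ hu) (holo_const _ _).
have v0 : v 0 = 0 by rewrite /v mulVf// subrr.
exists (fun z => L (const_mx (v z))); first exact: holo_comp1.
have H1 := rV1_near hv v0 dL; have H2 := rV1_near hv v0 (holo_diff hL).
have H3 := holo_diff hv; have H4 := holo_diff hu; have H5 := holo_ne0 hu u0.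
near=> z => j.
have dv : differentiable v z by near: z.
have du : differentiable u z by near: z.
have dLz : differentiable L (const_mx (v z)) by near: z.
have uz : u z != 0 by near: z.
rewrite pd_comp1//.
have -> : pd 0 L (const_mx (v z)) = (1 + (const_mx (v z) : 'rV[C]_1) 0 0)^-1 by near: z.
have -> : pd j v z = (u 0)^-1 * pd j u z.
  have dk : differentiable (fun _ : 'rV[C]_n => (u 0)^-1) z by exact: differentiable_cst.
  have d1 : differentiable (fun _ : 'rV[C]_n => 1 : C) z by exact: differentiable_cst.
  rewrite /v (pd_sub _ _ d1); last exact: differentiableM dk du.
  by rewrite (pd_mul _ dk du) !pd_const; ring.
by rewrite mxE /v addrC subrK; field; rewrite u0.
Unshelve. all: by end_near. Qed.

(** [u] is the exponential of [g], written [1 + e(g)] where [e] is the inverse germ of log(1 +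
    t). *)
Lemma unit_exp n (g : 'rV[C]_n -> C) : holo_at 0 g -> g 0 = 0 ->
  exists u, [/\ holo_at 0 u, u 0 = 1 &
    \forall z \near (0 : 'rV[C]_n), forall j, pd j u z = u z * pd j g z].
Proof.
move=> hg g0; have [L [hL L0 dL]] := log1p_ex.
pose T (t : 'rV[C]_1) : 'rV[C]_1 := const_mx (L t).
have TE : (fun t => T t 0 0) = L by apply/funext => t; rewrite mxE.
have hT : holo_map_at 0 T by exact: holo_const_mx.
have T0 : T 0 = 0 by rewrite /T L0; apply/rowP => i; rewrite !mxE.
have dT := nbhs_singleton (holo_map_diff hT).
have [|E [_ hE [_ E0] _ TTi]] := inverse_function hT T0.
  rewrite unlock det_mx11 (jacobianE _ _ (differentiable_row dT)) TE (nbhs_singleton dL).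
  by rewrite mxE addr0 invr1 oner_eq0.
pose e t := E t 0 0.
have he : holo_at 0 e := hE 0.
have e0 : e 0 = 0 by rewrite /e E0 mxE.
(* Differentiating [L (e t) = t] with [L' = 1 / (1 + t)] gives [e' = 1 + e]. *)
have de : \forall t \near (0 : 'rV[C]_1), pd 0 e t = 1 + e t.
  have H1 := holo_map_continuous hE E0 dL; have H2 := holo_map_continuous hE E0 (holo_diff hL).
  have H3 := holo_diff he; have H4 := near_near TTi.
  have h1 : holo_at 0 (fun t : 'rV[C]_1 => 1 + t 0 0) := holo_add (holo_const _ _) (holo_coord _).
  have h10 : 1 + (0 : 'rV[C]_1) 0 0 != 0 by rewrite mxE addr0 oner_eq0.
  have H5 := holo_map_continuous hE E0 (holo_ne0 h1 h10).
  have EE s : E s = const_mx (e s) by rewrite {1}[E s]rV1E.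
  apply: filterS (filterI H1 (filterI H2 (filterI H3 (filterI H4 H5)))).
  move=> t [d1 [d2 [d3 [d4 ne]]]].
  have dLE := d2; rewrite EE in dLE.
  have := pd_comp1 0 d3 dLE.
  have -> : pd 0 (fun z => L (const_mx (e z))) t = 1.
    rewrite (@pd_near _ _ _ _ (fun z => z 0 0)) ?pd_coord ?eqxx//.
    by apply: filterS d4 => y Ty; rewrite -EE -[in RHS]Ty mxE.
  rewrite -EE d1 -/(e t).
  by move=> h; rewrite -[LHS](divfK ne) -h mul1r.
exists (fun z => 1 + e (const_mx (g z))); split.
- exact: holo_add (holo_const _ _) (holo_comp1 he hg g0).
- by rewrite g0 (_ : const_mx 0 = 0) ?e0 ?addr0//; apply/rowP => i; rewrite !mxE.
have H1 := rV1_near hg g0 de; have H2 := rV1_near hg g0 (holo_diff he).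
have H3 := holo_diff hg; have H4 := holo_diff (holo_comp1 he hg g0).
apply: filterS (filterI H1 (filterI H2 (filterI H3 H4))) => z [e1 [e2 [dg dh]]] j.
have d1 : differentiable (fun _ : 'rV[C]_n => 1 : C) z by exact: differentiable_cst.
by rewrite (pd_add j d1 dh) pd_const add0r (pd_comp1 j dg e2) mulrC e1.
Qed.

End Biholo.
(** * Maps scaling the coordinates *)

Section ScalingMaps.
Context (R : realType).
Local Notation C := R[i].
Local Opaque holo_at.

(** The two orders of multiplying the block matrices [M] and [N] give block triangular matrices
    whose determinants are the two sides. *)
Lemma det_add_rank1 n (u : 'cV[C]_n) (v : 'rV[C]_n) :
  \det (1%:M + u *m v) = 1 + (v *m u) 0 0.
Proof.
pose M := block_mx (1%:M : 'M[C]_1) (- v) u (1%:M : 'M[C]_n).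
pose N := block_mx (1%:M : 'M[C]_1) v 0 (1%:M : 'M[C]_n).
have dN : \det N = 1 by rewrite det_ublock !det1 mulr1.
have MN : M *m N = block_mx 1%:M 0 u (1%:M + u *m v).
  by rewrite mulmx_block !mul1mx !mulmx1 !mulmx0 !addr0 subrr addrC addrC [u *m v + _]addrC.
have NM : N *m M = block_mx (1%:M + v *m u) 0 u 1%:M.
  by rewrite mulmx_block !mul1mx !mulmx1 !mul0mx !add0r addNr.
have : \det (M *m N) = \det (N *m M) by rewrite !det_mulmx mulrC.
by rewrite MN NM !det_lblock !det1 mul1r mulr1 det_mx11 !mxE eqxx => ->.
Qed.

Definition scaling n (U : 'I_n -> 'rV[C]_n -> C) (w : 'rV[C]_n) : 'rV[C]_n :=
  \row_i (w 0 i * U i w).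

Lemma scalingE n (U : 'I_n -> 'rV[C]_n -> C) w i : scaling U w 0 i = w 0 i * U i w.
Proof. by rewrite mxE. Qed.

Section AtPoint.
Variables (n : nat) (U : 'I_n -> 'rV[C]_n -> C) (w : 'rV[C]_n) (beta theta : 'I_n -> C).
Hypothesis dU : forall i, differentiable (U i) w.
(** The logarithmic differentials of all factors are multiples [beta i] of one covector [theta]. The
    Jacobian is then a rank one perturbation of the identity times a diagonal matrix. Both the torus
    substitutions and the radial map have this form. *)
Hypothesis pdU : forall i j, pd j (U i) w = U i w * beta i * theta j.

Lemma diff_scaling i : differentiable (fun z => scaling U z 0 i) w.
Proof.
rewrite (_ : (fun z => _) = (fun z : 'rV[C]_n => z 0 i) * U i); last first.
  by apply/funext => z; rewrite mxE.
exact: differentiableM (differentiable_coord _ _ _) (dU i).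
Qed.

Lemma pd_scaling i j :
  pd j (fun z => scaling U z 0 i) w = ((i == j)%:R + w 0 i * beta i * theta j) * U i w.
Proof.
rewrite (_ : (fun z => _) = (fun z : 'rV[C]_n => z 0 i * U i z)); last first.
  by apply/funext => z; rewrite mxE.
have dc := @differentiable_coord C 1 n w 0 i.
rewrite (pd_mul _ dc (dU i)) pd_coord pdU.
by move: (w 0 i) (U i w) (beta i) (theta j) ((i == j)%:R : C) => a b c d e; ring.
Qed.

Lemma det_scaling :
  jdet (scaling U) w = (\prod_i U i w) * (1 + \sum_i beta i * w 0 i * theta i).
Proof.
rewrite unlock; have -> : jacobian (scaling U) w = (1%:M + (\col_i theta i) *m (\row_i (w 0 i * beta i)))
    *m diag_mx (\row_i U i w).
  apply/matrixP => i j; rewrite (jacobianE _ _ (differentiable_row diff_scaling)).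
  rewrite pd_scaling mul_mx_diag !mxE big_ord1 !mxE eq_sym; ring.
rewrite det_mulmx det_add_rank1 det_diag mulrC; congr (_ * (1 + _)).
  by apply: eq_bigr => i _; rewrite mxE.
by rewrite mxE; apply: eq_bigr => i _; rewrite !mxE; ring.
Qed.

(** The chain rule for the fields [z_j d/dz_j]: component [i] has logarithmic differential
    [dw_i / w_i + beta i * theta]. The identity is multiplied out so as to hold on the coordinate
    hyperplanes too. *)
Lemma euler_scaling (h : 'rV[C]_n -> C) j : differentiable h (scaling U w) ->
  w 0 j * pd j (fun z => h (scaling U z)) w =
  scaling U w 0 j * pd j h (scaling U w) +
  w 0 j * theta j * \sum_i beta i * (scaling U w 0 i * pd i h (scaling U w)).
Proof.
move=> dh; rewrite (pd_comp j diff_scaling dh).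
under eq_bigr do rewrite pd_scaling.
rewrite (_ : \sum_i _ = U j w * pd j h (scaling U w) +
    theta j * \sum_i beta i * (scaling U w 0 i * pd i h (scaling U w))); last first.
  rewrite mulr_sumr -[U j w * _](_ : \sum_i (i == j)%:R * (U i w * pd i h (scaling U w)) = _).
    rewrite -big_split; apply: eq_bigr => i _; rewrite scalingE /=.
    by move: (pd i h _) (w 0 i) (U i w) (beta i) (theta j) ((i == j)%:R : C) => a b c d e f; ring.
  rewrite (bigD1 j)//= eqxx mul1r big1 ?addr0// => i /negPf ->.
  by rewrite mul0r.
by rewrite mulrDr scalingE; ring.
Qed.

End AtPoint.

Lemma pd_inv n (u : 'rV[C]_n -> C) j : holo_at 0 u -> u 0 != 0 ->
  \forall w \near (0 : 'rV[C]_n), pd j (fun z => (u z)^-1) w = - ((u w)^-1 * ((u w)^-1 * pd j u w)).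
Proof.
move=> hu u0; have hv := holo_inv hu u0.
have H1 := holo_diff hu; have H2 := holo_diff hv; have H3 := near_near (holo_ne0 hu u0).
apply: filterS (filterI H1 (filterI H2 H3)) => w [du [dv n0]].
have uw : u w != 0 := nbhs_singleton n0.
have := pd_mul j du dv.
rewrite (@pd_near _ _ _ _ (fun _ => 1)); last by apply: filterS n0 => y; exact: divff.
rewrite pd_const => /esym/eqP; rewrite addr_eq0 => /eqP e.
by apply: (mulfI uw); rewrite e mulrN mulVKf.
Qed.

Definition euler_diff n (o k : 'I_n) (f : 'rV[C]_n -> C) (z : 'rV[C]_n) : C :=
  z 0 k * pd k f z - z 0 o * pd o f z.

Lemma euler_mul n (o k : 'I_n) (f g : 'rV[C]_n -> C) w : differentiable f w -> differentiable g w ->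
  euler_diff o k (fun z => f z * g z) w = f w * euler_diff o k g w + g w * euler_diff o k f w.
Proof. by move=> df dg; rewrite /euler_diff !(pd_mul _ df dg); ring. Qed.

Lemma euler_near n (o k : 'I_n) f g w : (\forall z \near w, f z = g z) ->
  euler_diff o k f w = euler_diff o k g w.
Proof. by move=> h; rewrite /euler_diff !(pd_near _ h). Qed.

Section Elementary.
Variables (n : nat) (o k : 'I_n) (u : 'rV[C]_n -> C).
Hypotheses (ok : o != k) (hu : holo_at 0 u) (u0 : u 0 != 0).

Definition elem_factor (i : 'I_n) (w : 'rV[C]_n) : C :=
  if i == k then u w else if i == o then (u w)^-1 else 1.

Definition elem := scaling elem_factor.

Lemma holo_elem_factor i : holo_at 0 (elem_factor i).
Proof.
rewrite /elem_factor; case: (i == k); first exact: hu.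
case: (i == o); last exact: holo_const.
exact: holo_inv hu u0.
Qed.

Lemma holo_elem : holo_map_at 0 elem.
Proof.
move=> i; have H := holo_mul (holo_coord i) (holo_elem_factor i).
by rewrite (_ : (fun z => _) = (fun z : 'rV[C]_n => z 0 i * elem_factor i z))//; apply/funext => z; rewrite mxE.
Qed.

Lemma elem0 : elem 0 = 0.
Proof. by apply/rowP => i; rewrite !mxE mul0r. Qed.

Lemma prod_elem_factor w : u w != 0 -> \prod_i elem_factor i w = 1.
Proof.
move=> uw; rewrite (bigD1 k)//= (bigD1 o)//= /elem_factor eqxx eqxx (negPf ok).
by rewrite mulrA divff// mul1r big1// => i /andP[/negPf -> /negPf ->].
Qed.

Lemma coord_prod_elem w : u w != 0 -> coord_prod (elem w) = coord_prod w.
Proof.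
move=> uw; have -> : coord_prod (elem w) = coord_prod w * \prod_i elem_factor i w.
  by rewrite /coord_prod -big_split; apply: eq_bigr => i _; rewrite scalingE.
by rewrite prod_elem_factor// mulr1.
Qed.

Let beta (i : 'I_n) : C := if i == k then 1 else if i == o then -1 else 0.

Let sum_beta (x : 'I_n -> C) : \sum_i beta i * x i = x k - x o.
Proof.
rewrite (bigD1 k)//= (bigD1 o)//= /beta eqxx eqxx (negPf ok) big1.
  by rewrite mul1r mulN1r addr0.
by move=> i /andP[/negPf -> /negPf ->]; rewrite mul0r.
Qed.

Lemma elem_near : \forall w \near (0 : 'rV[C]_n),
  [/\ u w != 0, forall i, differentiable (elem_factor i) w &
  forall i j, pd j (elem_factor i) w = elem_factor i w * beta i * ((u w)^-1 * pd j u w)].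
Proof.
have H1 := holo_ne0 hu u0.
have H2 := near_forall (fun i => holo_diff (holo_elem_factor i)).
have H3 := near_forall (fun j => pd_inv j hu u0).
apply: filterS (filterI H1 (filterI H2 H3)) => w [uw [dw pw]]; split=> // i j.
rewrite /elem_factor /beta; case: (i == k); first by rewrite mulr1 mulVKf.
case: (i == o); first by rewrite pw; ring.
by rewrite pd_const mulr0 mul0r.
Qed.

(** The factors multiply to 1 and [theta] is [du / u], so only the rank one term is left: the
    Jacobian is [1 + E_k (log u)]. *)
Lemma det_elem : \forall w \near (0 : 'rV[C]_n),
  jdet elem w = 1 + (u w)^-1 * euler_diff o k u w.
Proof.
apply: filterS elem_near => w [uw dw pw].
rewrite (det_scaling dw pw) prod_elem_factor// mul1r; congr (1 + _).
under eq_bigr do rewrite -mulrA.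
by rewrite sum_beta /euler_diff; ring.
Qed.

(** The map respects the orbits of [E_k] and so carries this field to a multiple of itself; the
    multiplier is the Jacobian of [det_elem]. Hence the pullback of a density [E_k h] is the density
    [E_k (h o elem)]. *)
Lemma euler_elem (h : 'rV[C]_n -> C) : holo_at 0 h -> \forall w \near (0 : 'rV[C]_n),
  euler_diff o k (fun z => h (elem z)) w =
  euler_diff o k h (elem w) * (1 + (u w)^-1 * euler_diff o k u w).
Proof.
move=> hh; have H := holo_map_continuous holo_elem elem0 (holo_diff hh).
apply: filterS2 H elem_near => w dh [uw dw pw].
rewrite /euler_diff !(euler_scaling dw pw _ dh) sum_beta -/elem; ring.
Qed.

Lemma biholo_elem : exists Ti, biholo elem Ti.
Proof.
apply: inverse_function holo_elem elem0 _.
rewrite (nbhs_singleton det_elem) /euler_diff ![(0 : 'rV[C]_n) _ _]mxE !mul0r subrr mulr0 addr0.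
exact: oner_neq0.
Qed.

End Elementary.
End ScalingMaps.
(** * Normal form of volume forms *)

Section NormalForm.
Context (R : realType).
Local Notation C := R[i].
Local Notation MI n := {ffun 'I_n -> nat}.
Local Opaque holo_at.

Lemma holo_det n (A : 'rV[C]_n -> 'M[C]_n) : (forall i j, holo_at 0 (fun z => A z i j)) ->
  holo_at 0 (fun z => \det (A z)).
Proof.
move=> hA; rewrite /determinant; apply: holo_sum => s.
by apply: holo_scale; apply: holo_prod => i; exact: hA.
Qed.

Lemma holo_det_jacobian n (T : 'rV[C]_n -> 'rV[C]_n) : holo_map_at 0 T ->
  holo_at 0 (fun z => jdet T z).
Proof.
move=> hT; have H : holo_at 0 (fun z => \det (\matrix_(i, j) pd i (fun y => T y 0 j) z)).
  apply: holo_det => i j; rewrite (_ : (fun z => _) = pd i (fun y => T y 0 j)).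
    exact: holo_pd (hT j).
  by apply/funext => z; rewrite mxE.
apply: holo_near H; apply: filterS (holo_map_diff hT) => z dT.
rewrite jdet.unlock; congr (\det _); apply/matrixP => i j; by rewrite (jacobianE _ _ (differentiable_row dT)) mxE.
Qed.

Lemma det_jacobian_comp n (S T : 'rV[C]_n -> 'rV[C]_n) : holo_map_at 0 S -> holo_map_at 0 T ->
  T 0 = 0 -> \forall z \near (0 : 'rV[C]_n),
  jdet (fun y => S (T y)) z = jdet T z * jdet S (T z).
Proof.
move=> hS hT T0; have H1 := holo_map_continuous hT T0 (holo_map_diff hS).
apply: filterS2 H1 (holo_map_diff hT) => z dS dT.
by rewrite jdet.unlock (jacobian_comp dT dS) det_mulmx.
Qed.

Lemma jacobian_near n m (S T : 'rV[C]_n -> 'rV[C]_m) p :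
  (\forall z \near p, S z = T z) -> differentiable S p -> differentiable T p ->
  jacobian S p = jacobian T p.
Proof.
move=> ST dS dT; apply/matrixP => i j; apply: (etrans (jacobianE i j dS)); apply: etrans (esym (jacobianE i j dT)).
by apply: pd_near; apply: filterS ST => z ->.
Qed.

Lemma det_jacobian_inv n (S Si : 'rV[C]_n -> 'rV[C]_n) : biholo S Si ->
  \forall z \near (0 : 'rV[C]_n), jdet S z * jdet Si (S z) = 1.
Proof.
move=> [hS hSi [S0 Si0] SiS _].
have H1 := holo_map_continuous hS S0 (holo_map_diff hSi).
apply: filterS (filterI H1 (filterI (holo_map_diff hS) (near_near SiS))) => z [dSi [dS e]].
rewrite jdet.unlock -det_mulmx -(jacobian_comp dS dSi).
rewrite (@jacobian_near _ _ _ (fun y => y)) ?jacobian_id ?det1//.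
  by have := differentiable_comp (differentiable_row dS) (differentiable_row dSi); exact.
Qed.

Lemma mpow_scaling n (U : 'I_n -> 'rV[C]_n -> C) w al :
  mpow (scaling U w) al = mpow w al * \prod_i U i w ^+ al i.
Proof.
by rewrite /mpow -big_split; apply: eq_bigr => i _; rewrite scalingE exprMn.
Qed.

(** * Averaging over a one-dimensional torus *)

Section Torus.
Variables (n : nat) (o k : 'I_n).

(** No small divisors: the nonzero eigenvalues of [E_k] are integers, so dividing by them preserves
    the norm bounds. *)
Lemma natr_sub_norm (a b : nat) : a != b -> 1 <= `|a%:R - b%:R : C|.
Proof.
wlog ab : a b / (b <= a)%N.
  move=> h ne; have [ba|/ltnW ab] := leqP b a; first exact: h.
  by rewrite distrC; apply: h => //; rewrite eq_sym.
move=> ne; rewrite -natrB// normr_nat (ler_nat _ 1) subn_gt0.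
by rewrite ltn_neqAle eq_sym ne.
Qed.

Lemma euler_ps r M (c : MI n -> C) b z : ps r M c b -> polydisc (r / 4) z ->
  summ (fun al : MI n => ((al k)%:R - (al o)%:R) * c al * mpow z al) (euler_diff o k b z).
Proof.
move=> hb hz; have [_ h1] := ps_pd k hb; have [_ h2] := ps_pd o hb.
have := summ_add (h1 z hz) (summ_scale (-1) (h2 z hz)).
rewrite mulN1r; apply: summ_ext => al.
by move: (mpow z al) (c al) ((al k)%:R : C) ((al o)%:R : C) => x y s t; ring.
Qed.

(* The monomials with [al k = al o] are the invariants of the torus
   [(z_o, z_k) -> (z_o / t, t * z_k)]; [euler_diff o k] is its generator and acts
   on any other monomial by the nonzero scalar [al k - al o]. *)
Lemma torus_decomposition r M (c : MI n -> C) b : ps r M c b ->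
  exists b1 h, [/\ ps r M (fun al => if al k == al o then c al else 0) b1,
    holo_at 0 h, h 0 = 0 &
    \forall z \near (0 : 'rV[C]_n), b z = b1 z + euler_diff o k h z].
Proof.
move=> hc; have [r0 hB hf] := hc.
pose c1 (al : MI n) := if al k == al o then c al else 0.
pose d (al : MI n) := if al k == al o then 0 else ((al k)%:R - (al o)%:R)^-1 * c al.
have [||b1 hb1] := @ps_ex R n r M c1 => //.
  apply: abound_le hB => // al; rewrite /c1; case: ifP => // _.
  by rewrite mul0r normr0.
have [||h hh] := @ps_ex R n r M d => //.
  apply: abound_le hB => // al; rewrite /d; case: ifP => [_|/negbT ne].
    by rewrite mul0r normr0.
  rewrite -mulrA normrM ler_piMl// normfV invf_le1 ?natr_sub_norm//.
  exact: lt_le_trans (natr_sub_norm ne).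
exists b1, h; split=> //; first exact: ps_holo hh.
  by rewrite (ps_at0 hh) /d !ffunE eqxx.
apply/near0P; exists (r / 4) => [|z hz]; first by rewrite divr_gt0.
have hz' : polydisc r z.
  by apply: polydisc_le hz; rewrite ler_pdivrMr// ler_peMr ?(ltW r0)// (ler_nat _ 1).
have [_ _ hf1] := hb1.
apply: summ_uniq (hf z hz') _.
apply: summ_ext (summ_add (hf1 z hz') (euler_ps hh hz)) => al.
rewrite /c1 /d; case: ifP => [_|/negbT ne]; first by rewrite mulr0 mul0r addr0.
rewrite mul0r add0r mulVKf//.
by rewrite -normr_gt0; exact: lt_le_trans (natr_sub_norm ne).
Qed.

Section Invariant.
Hypothesis ok : o != k.
Variables (r M : C) (c : MI n -> C) (b : 'rV[C]_n -> C).
Hypothesis hb : ps r M c b.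
Hypothesis inv : forall al, c al != 0 -> al k = al o.

Lemma euler_invariant : \forall z \near (0 : 'rV[C]_n), euler_diff o k b z = 0.
Proof.
have [r0 _ _] := hb; apply/near0P; exists (r / 4) => [|z hz]; first by rewrite divr_gt0.
apply: summ_uniq (euler_ps hb hz) _; apply: summ_ext (@summ0 _ _) => al.
have [->|/inv ->] := eqVneq (c al) 0; first by rewrite mulr0 mul0r.
by rewrite subrr !mul0r.
Qed.

Lemma elem_invariant u : holo_at 0 u -> u 0 != 0 ->
  \forall w \near (0 : 'rV[C]_n), b (elem o k u w) = b w.
Proof.
move=> hu u0; have [r0 _ hf] := hb.
have H1 := @near_polydisc R n r r0.
have H2 := holo_map_continuous (holo_elem o k hu u0) (elem0 o k u) H1.
apply: filterS (filterI H1 (filterI H2 (holo_ne0 hu u0))) => w [hw [hw' uw]].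
apply: summ_uniq (hf _ hw') _; apply: summ_ext (hf w hw) => al.
have [->|/inv e] := eqVneq (c al) 0; first by rewrite !mul0r.
rewrite mpow_scaling (bigD1 k)//= (bigD1 o)//= /elem_factor eqxx eqxx (negPf ok) e.
rewrite big1 ?mulr1 -?exprMn ?divff ?expr1n ?mulr1//.
by move=> i /andP[/negPf -> /negPf ->]; rewrite expr1n.
Qed.

End Invariant.
End Torus.

Definition torus_supp n (o : 'I_n) (s : seq 'I_n) (b : 'rV[C]_n -> C) :=
  exists r M c, ps r M c b /\ forall al, c al != 0 -> forall j, j \in s -> al j = al o.

(** As [E_k b1 = 0], the quotient [g = h / b1] satisfies [b1 * E_k g = E_k h]. For [u = exp g] the
    Jacobian is [1 + E_k g], and [b1] is invariant under the map, so its pullback is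
    [b1 + E_k h = b]. The series of [b1] is part of that of [b], so the invariance already gained
    for [s] persists. *)
Lemma torus_step n (o k : 'I_n) s (b : 'rV[C]_n -> C) : o != k -> torus_supp o s b -> b 0 != 0 ->
  exists T Ti b', [/\ biholo T Ti,
    \forall w \near (0 : 'rV[C]_n), coord_prod (T w) = coord_prod w,
    \forall w \near (0 : 'rV[C]_n), jdet T w * b' (T w) = b w,
    torus_supp o (k :: s) b' & b' 0 != 0].
Proof.
move=> ok [r [M [c [hc supp]]]] b0.
have [b1 [h [hb1 hh h0 bE]]] := torus_decomposition o k hc.
have inv (al : MI n) : (if al k == al o then c al else 0) != 0 -> al k = al o.
  by case: (al k =P al o) => // _; rewrite eqxx.
have b10 : b1 0 != 0 by rewrite (ps_at0 hb1) !ffunE eqxx -(ps_at0 hc).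
have holb1 := ps_holo hb1.
pose g z := h z * (b1 z)^-1.
have hg : holo_at 0 g := holo_mul hh (holo_inv holb1 b10).
have g0 : g 0 = 0 by rewrite /g h0 mul0r.
have [u [hu u1 du]] := unit_exp hg g0.
have u0 : u 0 != 0 by rewrite u1 oner_eq0.
have [Ti hT] := biholo_elem ok hu u0.
exists (elem o k u), Ti, b1; split=> //; last first.
- exists r, M, (fun al : MI n => if al k == al o then c al else 0); split=> // al ne j.
  rewrite inE => /orP[/eqP ->|js]; first exact: inv.
  by apply: supp => //; move: ne; case: (al k =P al o) => // _; rewrite eqxx.
- have H1 := near_near (holo_ne0 holb1 b10).
  have H2 := euler_invariant hb1 inv.
  have H3 := elem_invariant ok hb1 inv hu u0.
  have H4 := det_elem ok hu u0.
  apply: filterS (filterI H1 (filterI H2 (filterI H3 (filterI H4 (filterI (holo_diff holb1)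
    (filterI (holo_diff hg) (filterI bE (filterI du (holo_ne0 hu u0))))))))).
  move=> w [n1 [e1 [-> [-> [db [dg [-> [duw uw]]]]]]]].
  have b1w : b1 w != 0 := nbhs_singleton n1.
  have hE : euler_diff o k h w = b1 w * euler_diff o k g w.
    have -> : euler_diff o k h w = euler_diff o k (fun z => b1 z * g z) w.
      apply: euler_near; apply: filterS n1 => z b1z.
      by rewrite /g mulrCA divff// mulr1.
    by rewrite (euler_mul _ _ db dg) e1 mulr0 addr0.
  have -> : (u w)^-1 * euler_diff o k u w = euler_diff o k g w.
    apply: (mulfI uw); rewrite mulVKf// /euler_diff !duw.
    by move: (pd k g w) (pd o g w) => x y; ring.
  by rewrite hE; ring.
- by apply: filterS (holo_ne0 hu u0) => w; exact: coord_prod_elem.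
Qed.

Lemma torus_iterate n (o : 'I_n) s (b : 'rV[C]_n -> C) : o \notin s -> holo_at 0 b -> b 0 != 0 ->
  exists T Ti b', [/\ biholo T Ti,
    \forall w \near (0 : 'rV[C]_n), coord_prod (T w) = coord_prod w,
    \forall w \near (0 : 'rV[C]_n), jdet T w * b' (T w) = b w,
    torus_supp o s b' & b' 0 != 0].
Proof.
move=> + hb b0; elim: s => [_|k s ih].
  exists (fun w => w), (fun w => w), b; split=> //.
  - exact: biholo_id.
  - by apply/near0P; exists 1.
  - by apply/near0P; exists 1 => // w _; rewrite jdet.unlock jacobian_id det1 mul1r.
  - by have [r [M [c hc]]] := holo_ps hb; exists r, M, c.
rewrite inE negb_or => /andP[ok os].
have [T [Ti [b' [hT PT dT sb' b'0]]]] := ih os.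
have [S [Si [b'' [hS PS dS sb'' b''0]]]] := torus_step ok sb' b'0.
have [holT _ [T0 _] _ _] := hT; have [holS _ _ _ _] := hS.
exists (fun w => S (T w)), (fun w => Ti (Si w)), b''; split; last 2 first.
- exact: sb''.
- exact: b''0.
- exact: biholo_comp.
- have H := holo_map_continuous holT T0 PS.
  by apply: filterS2 H PT => w -> ->.
- have H1 := holo_map_continuous holT T0 dS.
  apply: filterS (filterI H1 (filterI dT (det_jacobian_comp holS holT T0))) => w [e1 [e2 ->]].
  by rewrite -mulrA [X in _ * X]e1.
Qed.

Lemma mdeg_diag n m : mdeg ([ffun=> m] : MI n) = (n * m)%N.
Proof.
rewrite /mdeg (eq_bigr (fun=> m)) => [|i _]; last by rewrite ffunE.
by rewrite sum_nat_const card_ord.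
Qed.

Lemma mpow_diag n m (w : 'rV[C]_n) : mpow w [ffun=> m] = coord_prod w ^+ m.
Proof.
by rewrite /mpow /coord_prod -prodrXl; apply: eq_bigr => i _; rewrite ffunE.
Qed.

Lemma mpow1var (t : 'rV[C]_1) mu : mpow t mu = t 0 0 ^+ mu 0.
Proof. by rewrite /mpow big_ord1. Qed.

Lemma mdeg1var (mu : MI 1) : mdeg mu = mu 0.
Proof. by rewrite /mdeg big_ord1. Qed.

Definition diag n (mu : MI 1) : MI n := [ffun=> mu 0].

Lemma diag_inj n : (0 < n)%N -> injective (@diag n).
Proof.
move=> n0 mu nu /ffunP/(_ (Ordinal n0)); rewrite !ffunE => e.
by apply/ffunP => i; rewrite ord1.
Qed.

Lemma norm_coord_prod n r (w : 'rV[C]_n) : polydisc r w -> `|coord_prod w| <= r ^+ n.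
Proof.
move=> hw; rewrite /coord_prod normr_prod.
have -> : r ^+ n = \prod_(i < n) r by rewrite prodr_const card_ord.
by apply: ler_prod => i _; rewrite normr_ge0 hw.
Qed.

(** Only powers of the product P are left. The weight of [P ^ m] is [(r ^+ n) ^+ m], so the bound on
    [b] at radius [r] is one on [beta] at radius [r ^+ n], and [|P| <= r ^+ n] on the polydisc. *)
Lemma diagonal_germ n (o : 'I_n) s (b : 'rV[C]_n -> C) : (forall j, j != o -> j \in s) ->
  torus_supp o s b -> exists beta : 'rV[C]_1 -> C, [/\ holo_at 0 beta,
    beta 0 = b 0 & \forall w \near (0 : 'rV[C]_n), b w = beta (const_mx (coord_prod w))].
Proof.
move=> all_s [r [M [c [hc supp]]]]; have [r0 hB hf] := hc.
have n0 : (0 < n)%N by case: o {supp all_s} => i; exact: leq_trans.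
have rn0 : 0 < r ^+ n by rewrite exprn_gt0.
have dI := diag_inj n0.
have off al : (forall mu, al <> @diag n mu) -> c al = 0.
  move=> h; apply/eqP/negPn/negP => /supp h'; apply: (h [ffun=> al o]).
  apply/ffunP => i; rewrite !ffunE; have [->//|/all_s] := eqVneq i o; exact: h'.
have [||beta hbeta] := @ps_ex R 1 (r ^+ n) M (c \o @diag n) => //.
  apply: abound_le (lexx M) (abound_reindex dI hB) => mu.
  by rewrite /= mdeg_diag mdeg1var exprM.
have [_ _ hfb] := hbeta.
exists beta; split; first exact: ps_holo hbeta.
  rewrite (ps_at0 hc) (ps_at0 hbeta); congr c.
  by apply/ffunP => i; rewrite !ffunE.
apply/near0P; exists r => // w hw.
have hP : polydisc (r ^+ n) (const_mx (coord_prod w) : 'rV[C]_1).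
  by move=> i; rewrite mxE; exact: norm_coord_prod.
apply: summ_uniq (hf w hw) _.
apply: (summ_extend dI _ _ (ps_abound hbeta hP) (hfb _ hP)).
  by move=> mu; rewrite mpow_diag mpow1var mxE.
by move=> al /off ->; rewrite mul0r.
Qed.

Lemma pd_coord_prod n (o : 'I_n) (w : 'rV[C]_n) :
  pd o (@coord_prod R n) w = \prod_(i < n | i != o) w 0 i.
Proof.
rewrite unlock; apply: (@derive_quadratic _ _ _ _ _ _ 0 1) => // t _.
rewrite (_ : _ - _ - _ = 0) ?normr0 ?mulr0//.
have E v : coord_prod v = v 0 o * \prod_(i < n | i != o) v 0 i :> C.
  by rewrite /coord_prod (bigD1 o).
rewrite !E.
have -> : \prod_(i < n | i != o) (w + t *: delta_mx 0 o) 0 i = \prod_(i < n | i != o) w 0 i.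
  by apply: eq_bigr => i /negPf io; rewrite !mxE io andbF mulr0 addr0.
by rewrite !mxE !eqxx /=; move: (\prod_(i < n | _) _) => q; ring.
Qed.

(** * Rescaling one coordinate by a function of the product *)

Section Radial.
Variables (n : nat) (o : 'I_n) (mu : 'rV[C]_1 -> C).
Hypotheses (hmu : holo_at 0 mu) (mu0 : mu 0 != 0).

Definition radial_factor (i : 'I_n) (w : 'rV[C]_n) : C :=
  if i == o then mu (const_mx (coord_prod w)) else 1.

Definition radial := scaling radial_factor.

Lemma coord_prod0 : coord_prod (0 : 'rV[C]_n) = 0.
Proof. by rewrite /coord_prod (bigD1 o)//= mxE mul0r. Qed.

Let holo_muP : holo_at 0 (fun w : 'rV[C]_n => mu (const_mx (coord_prod w))).
Proof. exact: holo_comp1 hmu (holo_prodP _ n) coord_prod0. Qed.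

Let muP0 : mu (const_mx (coord_prod (0 : 'rV[C]_n))) != 0.
Proof. by rewrite coord_prod0 (_ : const_mx 0 = 0)//; apply/rowP => i; rewrite !mxE. Qed.

Lemma holo_radial : holo_map_at 0 radial.
Proof.
move=> i; have H : holo_at 0 (radial_factor i).
  rewrite /radial_factor; case: (i == o); first exact: holo_muP.
  exact: holo_const.
have H' := holo_mul (holo_coord i) H.
by rewrite (_ : (fun z => _) = (fun z : 'rV[C]_n => z 0 i * radial_factor i z))//; apply/funext => z; rewrite mxE.
Qed.

Lemma radial0 : radial 0 = 0.
Proof. by apply/rowP => i; rewrite !mxE mul0r. Qed.

Lemma coord_prod_radial w :
  coord_prod (radial w) = coord_prod w * mu (const_mx (coord_prod w)).
Proof.
have -> : coord_prod (radial w) = coord_prod w * \prod_i radial_factor i w.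
  by rewrite /coord_prod -big_split; apply: eq_bigr => i _; rewrite scalingE.
rewrite (bigD1 o)//= [radial_factor o w]/radial_factor eqxx big1 ?mulr1//.
by move=> i /negPf io; rewrite /radial_factor io.
Qed.

(** On functions of P the field [z_o d/dz_o] acts as [t d/dt], so the determinant is [mu + t mu'] at
    [t = P]. *)
Lemma det_radial : \forall w \near (0 : 'rV[C]_n), jdet radial w =
  pd 0 (fun t => t 0 0 * mu t) (const_mx (coord_prod w)).
Proof.
have H1 := holo_diff holo_muP; have H2 := holo_ne0 holo_muP muP0.
have H3 := rV1_near (holo_prodP _ n) coord_prod0 (holo_diff hmu).
have H4 := holo_diff (holo_prodP R n).
apply: filterS (filterI H1 (filterI H2 (filterI H3 H4))) => w [dm [m0 [dmu dP]]].
pose m := mu (const_mx (coord_prod w)).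
have dU i : differentiable (radial_factor i) w.
  rewrite /radial_factor; case: (i == o); [exact: dm|exact: differentiable_cst].
have pU i j : pd j (radial_factor i) w =
    radial_factor i w * (i == o)%:R * (m^-1 * pd j (fun z => mu (const_mx (coord_prod z))) w).
  rewrite /radial_factor; case: (i == o); first by rewrite mulr1 mulVKf.
  by rewrite pd_const mulr0 mul0r.
rewrite (det_scaling dU pU).
rewrite (bigD1 o)//= [radial_factor o w]/radial_factor eqxx big1 ?mulr1; last first.
  by move=> i /negPf io; rewrite /radial_factor io.
rewrite (bigD1 o)//= eqxx mul1r big1 ?addr0; last by move=> i /negPf ->; rewrite !mul0r.
have dc := @differentiable_coord C 1 1 (const_mx (coord_prod w)) 0 0.
rewrite (pd_comp1 o dP dmu) pd_coord_prod (pd_mul _ dc dmu).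
rewrite pd_coord eqxx mulr1 mxE.
move: m0; rewrite /m; move: (pd 0 mu _) (mu (const_mx _)) => D q q0.
have -> : coord_prod w = w 0 o * \prod_(i < n | i != o) w 0 i by rewrite /coord_prod (bigD1 o).
by field.
Qed.

End Radial.

(** The torus maps reduce [b] to a density [beta(P)] without changing P. The radial map with
    [(t mu)' = beta] has Jacobian [beta(P)], which absorbs it, and sends P to [L(P)] with
    [L = t mu]. *)
Lemma volume_normal_form n (o : 'I_n) (b : 'rV[C]_n -> C) : holo_at 0 b -> b 0 != 0 ->
  exists X Xi (L : 'rV[C]_1 -> C), [/\ biholo X Xi, [/\ holo_at 0 L, L 0 = 0 & pd 0 L 0 != 0],
    \forall w \near (0 : 'rV[C]_n), jdet X w = b w &
    \forall w \near (0 : 'rV[C]_n), coord_prod (X w) = L (const_mx (coord_prod w))].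
Proof.
move=> hb b0; pose s := [seq j <- enum 'I_n | j != o].
have os : o \notin s by rewrite mem_filter eqxx.
have [T [Ti [b' [hT PT dT sb' b'0]]]] := torus_iterate os hb b0.
have [|beta [hbeta beta0 b'E]] := diagonal_germ _ sb'.
  by move=> j jo; rewrite mem_filter jo mem_enum.
have [mu [hmu mu0 dmu]] := holo_primitive1 hbeta.
have mu0' : mu 0 != 0 by rewrite mu0 beta0.
have c0 := coord_prod0 o.
have detK : \forall w \near (0 : 'rV[C]_n), jdet (radial o mu) w = b' w.
  have H := rV1_near (holo_prodP _ n) c0 dmu.
  by apply: filterS (filterI H (filterI b'E (det_radial o hmu mu0'))) => w [e [-> ->]].
have hK := holo_radial o hmu.
have [|Ki bK] := inverse_function hK (radial0 o mu).
  by rewrite (nbhs_singleton detK).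
have [holT _ [T0 _] _ _] := hT.
exists (fun w => radial o mu (T w)), (fun w => Ti (Ki w)), (fun t : 'rV[C]_1 => t 0 0 * mu t); split.
- exact: biholo_comp.
- split; first exact: holo_mul (holo_coord _) hmu.
    by rewrite mxE mul0r.
  by rewrite (nbhs_singleton dmu) beta0.
- have H1 := holo_map_continuous holT T0 detK.
  apply: filterS (filterI H1 (filterI dT (det_jacobian_comp hK holT T0))) => w [e1 [<- ->]].
  by rewrite [X in _ * X]e1.
- by apply: filterS PT => w Pw; rewrite coord_prod_radial Pw mxE.
Qed.

End NormalForm.
(** * Periods over tori *)

Section Periods.
Context (R : realType).
Local Notation C := R[i].
Local Notation MI n := {ffun 'I_n -> nat}.
Local Opaque holo_at.

Lemma ps_scale n r M (c : MI n -> C) f k : ps r M c f ->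
  ps r (`|k| * M) (fun al => k * c al) (fun z => k * f z).
Proof.
move=> [r0 hc hf]; split=> //.
  by apply: abound_le (lexx _) (abound_scale k hc) => al; rewrite !mulrA.
by move=> z hz; apply: summ_ext (summ_scale k (hf z hz)) => al; rewrite !mulrA.
Qed.

Lemma ps_zero_series n r M (c : MI n -> C) f : ps r M c f -> (forall al, c al = 0) ->
  \forall z \near (0 : 'rV[C]_n), f z = 0.
Proof.
move=> [r0 _ hf] c0; apply/near0P; exists r => // z hz.
apply: summ_uniq (hf z hz) _; apply: summ_ext (@summ0 _ _) => al.
by rewrite c0 mul0r.
Qed.

Lemma ps_unique n r M r' M' (c d : MI n -> C) f g al : ps r M c f -> ps r' M' d g ->
  (\forall z \near (0 : 'rV[C]_n), f z = g z) -> c al = d al.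
Proof.
move=> hf hg fg; have r0 : 0 < r by case: hf.
have r0' : 0 < r' by case: hg.
have [s [s0 sr sr']] := pos_lower_bound2 r0 r0'.
have h := ps_add (ps_le s0 sr hf) (ps_scale (-1) (ps_le s0 sr' hg)).
have /eqP : c al + -1 * d al = 0.
  by apply: ps_zero h _; apply: filterS fg => z ->; rewrite mulN1r subrr.
by rewrite mulN1r subr_eq0 => /eqP.
Qed.

(* The coefficient of [(z_1 ... z_n)^m] in [f] is, up to a constant, the period of
   [(z_1 ... z_n)^(- m - 1) f dz] over the tori [|z_i| = const]. *)
Definition diag0 n (f : 'rV[C]_n -> C) :=
  exists r M c, ps r M c f /\ forall mu, c (@diag n mu) = 0.

Lemma diag0_near n (f g : 'rV[C]_n -> C) : diag0 f ->
  (\forall z \near (0 : 'rV[C]_n), f z = g z) -> diag0 g.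
Proof.
move=> [r [M [c [hc c0]]]] fg; have [s _ hs] := ps_near hc fg.
by exists s, M, c.
Qed.

Lemma diag0_add n (f g : 'rV[C]_n -> C) : diag0 f -> diag0 g ->
  diag0 (fun z => f z + g z).
Proof.
move=> [r [M [c [hc c0]]]] [r' [M' [d [hd d0]]]].
have r0 : 0 < r by case: hc.
have r0' : 0 < r' by case: hd.
have [s [s0 sr sr']] := pos_lower_bound2 r0 r0'.
exists s, (M + M'), (fun al => c al + d al); split; last by move=> mu; rewrite c0 d0 addr0.
exact: ps_add (ps_le s0 sr hc) (ps_le s0 sr' hd).
Qed.

(** [E_k] multiplies a monomial by [al k - al o], which is 0 on the diagonal. The estimate shows
    that these factors are absorbed by the smaller radius [r / 4]. *)
Lemma diag0_euler n (o k : 'I_n) h : holo_at 0 h -> diag0 (euler_diff o k h).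
Proof.
move=> /holo_ps[r [M [c hc]]]; have [r0 hB hf] := hc.
have r40 : 0 < r / 4 by rewrite divr_gt0.
exists (r / 4), (`|2| * M), (fun al : MI n => ((al k)%:R - (al o)%:R) * c al); split; last first.
  by move=> mu; rewrite !ffunE subrr mul0r.
split=> //; last by move=> z hz; exact: euler_ps hc hz.
apply: abound_le (lexx _) (abound_scale 2 hB) => al.
have le_deg (j : 'I_n) : (al j)%:R <= 4 ^+ mdeg al :> C.
  apply: le_trans (natr_le_exp4 _ _) _.
  by rewrite ler_weXn2l ?(ler_nat _ 1 4)// (mdeg_split _ j) leq_addr.
have -> : ((al k)%:R - (al o)%:R) * c al * (r / 4) ^+ mdeg al =
  ((al k)%:R - (al o)%:R) * 4^-1 ^+ mdeg al * (c al * r ^+ mdeg al).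
  by rewrite exprMn; move: (r ^+ _) (4^-1 ^+ _) => x y; ring.
rewrite normrM [leRHS]normrM ler_wpM2r// normrM normr_nat.
rewrite normrX normfV normr_nat exprVn ler_pdivrMr ?exprn_gt0//.
apply: le_trans (ler_normB _ _) _; rewrite !normr_nat mulrDl !mul1r.
exact: lerD.
Qed.

(** The expansion of [f(P)] has the coefficients of [f] on the diagonal and 0 elsewhere, so
    uniqueness of coefficients applies. *)
Lemma diag0_radial n (f : 'rV[C]_1 -> C) : (0 < n)%N -> holo_at 0 f ->
  diag0 (fun w : 'rV[C]_n => f (const_mx (coord_prod w))) ->
  \forall t \near (0 : 'rV[C]_1), f t = 0.
Proof.
move=> n0 /holo_ps[r [M [e he]]] [r' [M' [c [hc c0]]]].
apply: (ps_zero_series he) => mu; have [r0 heB hef] := he.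
have dI := @diag_inj n n0.
pose d (al : MI n) := if pselect (exists mu, al = diag n mu) is left h then e (projT1 (cid h)) else 0.
have dE nu : d (diag n nu) = e nu.
  rewrite /d; case: pselect => [h|[]]; last by exists nu.
  by congr e; apply: dI; case: cid.
have d0 al : (forall nu, al <> diag n nu) -> d al = 0.
  by move=> h; rewrite /d; case: pselect => [h'|//]; exfalso; case: h' => nu; exact: h.
(* With [s <= 1] and [n] positive, [s ^+ n <= s <= r], so P maps the polydisc of radius [s] into the
   domain of the series of [f]. *)
have [s [s0 sr s1]] := pos_lower_bound2 r0 (@ltr01 C).
have sn : s ^+ n <= r.
  by case: n n0 {c0 hc c dI d dE d0} => // n _; rewrite exprS; apply: le_trans sr; rewrite ler_piMr ?(ltW s0)// exprn_ile1// ltW.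
have sn0 : 0 <= s ^+ n by rewrite exprn_ge0// ltW.
have hd : ps s M d (fun w : 'rV[C]_n => f (const_mx (coord_prod w))).
  split=> //.
    apply: (@abound_extend _ _ _ (@diag n) _ (fun nu => e nu * (s ^+ n) ^+ nu 0) M) => //.
    - by move=> nu; rewrite dE mdeg_diag exprM.
    - by move=> al /d0 ->; rewrite mul0r.
    - apply: abound_le (lexx _) heB => nu; rewrite !normrM ler_wpM2l//.
      by rewrite mdeg1var !normrX (gtr0_norm s0) (gtr0_norm r0) lerXn2r ?nnegrE// ltW.
  move=> w hw.
  have hP : polydisc r (const_mx (coord_prod w) : 'rV[C]_1).
    by move=> i; rewrite mxE; apply: le_trans (norm_coord_prod hw) sn.
  apply: (summ_extend dI _ _ (ps_abound he hP) (hef _ hP)).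
    by move=> nu; rewrite dE mpow_diag mpow1var mxE.
  by move=> al /d0 ->; rewrite mul0r.
rewrite -dE -(c0 mu); apply: (ps_unique _ hd hc).
by apply/near0P; exists 1.
Qed.

Lemma pd_zero (k : 'rV[C]_1 -> C) : holo_at 0 k -> k 0 = 0 ->
  (\forall t \near (0 : 'rV[C]_1), pd 0 k t = 0) -> \forall t \near (0 : 'rV[C]_1), k t = 0.
Proof.
move=> /holo_ps[r [M [c hc]]] k0 dk; apply: (ps_zero_series hc) => al.
have [a0|a0] := eqVneq (al 0) 0%N.
  have -> : al = mi0 1 by apply/ffunP => i; rewrite ord1 a0 ffunE.
  by rewrite -(ps_at0 hc).
have [hd _] := ps_pd 0 hc.
have /eqP := ps_zero (misub al (mi1 0)) hd dk.
rewrite /dcoef misubK; first by rewrite mulf_eq0 pnatr_eq0 /= => /eqP.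
by move=> i; rewrite ffunE ord1 eqxx lt0n.
Qed.

(** [b (T w) * jdet T w] is the density of the pullback of [b dz]. When [T] preserves P, this is the
    invariance of the periods of [P^(-m-1) b dz]. *)
Definition preserves_periods n (T : 'rV[C]_n -> 'rV[C]_n) :=
  forall b : 'rV[C]_n -> C, holo_at 0 b -> diag0 (fun w => b (T w) * jdet T w - b w).

(** Write [b = b1 + E_k h] and [g = log u]. The pullback has density
    [b1 * (1 + E_k g) + E_k (h o elem)], and [E_k b1 = 0]. The difference with [b] is therefore
    [E_k (b1 * g + h o elem - h)], which has no diagonal coefficients. *)
Lemma elem_preserves_periods n (o k : 'I_n) u : o != k -> holo_at 0 u -> u 0 != 0 ->
  preserves_periods (elem o k u).
Proof.
move=> ok hu u0 b hb; have [g hg du] := unit_log hu u0.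
have [r [M [c hc]]] := holo_ps hb.
have [b1 [h [hb1 hh h0 bE]]] := torus_decomposition o k hc.
have inv (al : MI n) : (if al k == al o then c al else 0) != 0 -> al k = al o.
  by case: (al k =P al o) => // _; rewrite eqxx.
have holb1 := ps_holo hb1.
have holT := holo_elem o k hu u0; have T0 := elem0 o k u.
have hhT : holo_at 0 (fun w => h (elem o k u w)) := holo_comp hh holT T0.
have hm := holo_mul holb1 hg.
apply: diag0_near (diag0_euler o k (holo_sub (holo_add hm hhT) hh)) _.
have H1 := euler_invariant hb1 inv.
have H2 := elem_invariant ok hb1 inv hu u0.
have H3 := det_elem ok hu u0.
have H6 := holo_map_continuous holT T0 bE.
have H7 := euler_elem ok hu u0 hh.
apply: filterS (filterI H1 (filterI H2 (filterI H3 (filterI (holo_diff holb1)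
    (filterI (holo_diff hg) (filterI (holo_diff hhT) (filterI (holo_diff hh)
    (filterI H6 (filterI H7 (filterI bE (filterI du (holo_ne0 hu u0)))))))))))).
move=> w [e1 [e2 [e3 [db [dg [dhT [dh [e6 [e7 [e8 [duw uw]]]]]]]]]]].
have eg : (u w)^-1 * euler_diff o k u w = euler_diff o k g w.
  apply: (mulfI uw); rewrite mulVKf// /euler_diff !duw.
  by move: (pd k g w) (pd o g w) => x y; ring.
rewrite eg in e3 e7.
have dm : differentiable (fun z => b1 z * g z) w := differentiableM db dg.
have -> : euler_diff o k (fun z => b1 z * g z + h (elem o k u z) - h z) w =
   b1 w * euler_diff o k g w + euler_diff o k (fun z => h (elem o k u z)) w
   - euler_diff o k h w.
  have da : differentiable (fun z => b1 z * g z + h (elem o k u z)) w := differentiableD dm dhT.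
  rewrite {1}/euler_diff !(pd_sub _ da dh) !(pd_add _ dm dhT) !(pd_mul _ db dg).
  move: e1; rewrite /euler_diff.
  move: (pd k b1 w) (pd o b1 w) (pd k g w) (pd o g w) (pd k h w) (pd o h w)
    (pd k (fun z => h (elem o k u z)) w) (pd o (fun z => h (elem o k u z)) w).
  move: (w 0 k) (w 0 o) (b1 w) (g w) => x y a' b' s1 s2 s3 s4 s5 s6 s7 s8 e1.
  have -> : x * (a' * s3 + b' * s1 + s7 - s5) - y * (a' * s4 + b' * s2 + s8 - s6) =
    a' * (x * s3 - y * s4) + (x * s7 - y * s8) - (x * s5 - y * s6) + b' * (x * s1 - y * s2) by ring.
  by rewrite e1 mulr0 addr0.
rewrite e7 e3 e6 e2 e8.
by move: (euler_diff o k h (elem o k u w)) (euler_diff o k g w) (euler_diff o k h w) (b1 w) => x y z t; ring.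
Qed.

(** The property of [T] is applied to the density already pulled back by [S]; hence the
    quantification over all densities in [preserves_periods]. *)
Lemma comp_preserves_periods n (S T : 'rV[C]_n -> 'rV[C]_n) :
  holo_map_at 0 S -> S 0 = 0 -> holo_map_at 0 T -> T 0 = 0 ->
  preserves_periods S -> preserves_periods T -> preserves_periods (fun w => S (T w)).
Proof.
move=> hS S0 hT T0 pS pT b hb.
have hbS : holo_at 0 (fun w => b (S w) * jdet S w).
  exact: holo_mul (holo_comp hb hS S0) (holo_det_jacobian hS).
apply: diag0_near (diag0_add (pT _ hbS) (pS _ hb)) _.
apply: filterS (det_jacobian_comp hS hT T0) => w ->.
move: (b (S (T w))) (jdet S (T w)) (jdet T w) (b (S w)) (jdet S w) (b w) => x y z t s v.
by ring.
Qed.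

Lemma biholo_near n (T T' Ti : 'rV[C]_n -> 'rV[C]_n) :
  (\forall w \near (0 : 'rV[C]_n), T w = T' w) -> biholo T Ti -> biholo T' Ti.
Proof.
move=> TT [hT hTi [T0 Ti0] TiT TTi]; split.
- move=> j; apply: holo_near (hT j); apply: filterS TT => w -> //.
- exact: hTi.
- by rewrite -(nbhs_singleton TT).
- by apply: filterS2 TT TiT => w ->.
- have H := holo_map_continuous hTi Ti0 TT.
  by apply: filterS2 H TTi => w ->.
Qed.

Lemma det_jacobian_near n (T T' : 'rV[C]_n -> 'rV[C]_n) : holo_map_at 0 T ->
  holo_map_at 0 T' -> (\forall w \near (0 : 'rV[C]_n), T w = T' w) ->
  \forall w \near (0 : 'rV[C]_n), jdet T w = jdet T' w.
Proof.
move=> hT hT' TT.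
apply: filterS (filterI (near_near TT) (filterI (holo_map_diff hT) (holo_map_diff hT'))).
move=> w [e [d d']]; rewrite jdet.unlock; apply: congr1.
exact: jacobian_near e (differentiable_row d) (differentiable_row d').
Qed.

Lemma near_preserves_periods n (T T' : 'rV[C]_n -> 'rV[C]_n) : holo_map_at 0 T ->
  holo_map_at 0 T' -> (\forall w \near (0 : 'rV[C]_n), T w = T' w) ->
  preserves_periods T -> preserves_periods T'.
Proof.
move=> hT hT' TT pT b hb; apply: diag0_near (pT b hb) _.
by apply: filterS2 TT (det_jacobian_near hT hT' TT) => w -> ->.
Qed.

Section Unimodular.
Variables (n : nat) (o : 'I_n) (u : 'I_n -> 'rV[C]_n -> C).
Hypotheses (hu : forall i, holo_at 0 (u i)) (u0 : forall i, u i 0 != 0).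

Definition unimod_factor (s : seq 'I_n) (i : 'I_n) (w : 'rV[C]_n) : C :=
  if i == o then (\prod_(j <- s) u j w)^-1 else if i \in s then u i w else 1.

Definition unimod s := scaling (unimod_factor s).

(** Adding an index [k] to [s] amounts to composing with one more elementary substitution, so
    periods are preserved by induction on [s]. *)
Lemma unimod_preserves_periods s : uniq s -> o \notin s ->
  (exists Ti, biholo (unimod s) Ti) /\ preserves_periods (unimod s).
Proof.
elim: s => [_ _|k s ih].
  have E : unimod [::] = fun w => w.
    apply/funext => w; apply/rowP => i; rewrite scalingE /unimod_factor big_nil invr1.
    by case: (i == o); rewrite mulr1.
  rewrite E; split; first by exists (fun w => w); exact: biholo_id.
  move=> b hb; have [r [M [c hc]]] := holo_ps hb.
  have h0 := ps_scale 0 hc.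
  apply: (@diag0_near _ (fun z => 0 * b z)).
    by exists r, (`|0 : C| * M), (fun al => 0 * c al); split=> // mu; rewrite mul0r.
  apply/near0P; exists 1 => // z _.
  by rewrite jdet.unlock jacobian_id det1 mulr1 subrr mul0r.
move=> /= /andP[ks us]; rewrite inE negb_or => /andP[ok os].
have [[Ti bT] pT] := ih us os; have [hT hTi [T0 Ti0] TiT _] := bT.
(* The new substitution evaluates its multiplier after [unimod s] has been applied; composing with
   [Ti] brings it back to [u k w]. *)
pose v z := u k (Ti z).
have hv : holo_at 0 v := holo_comp (hu k) hTi Ti0.
have v0 : v 0 != 0 by rewrite /v Ti0.
have [Si bS] := biholo_elem ok hv v0; have [hS _ [S0 _] _ _] := bS.
have near_eq : \forall w \near (0 : 'rV[C]_n), elem o k v (unimod s w) = unimod (k :: s) w.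
  apply: filterS TiT => w e; apply/rowP => i.
  rewrite [in LHS]scalingE [in LHS]scalingE [in RHS]scalingE /elem_factor /v e -mulrA; congr (_ * _).
  rewrite /unimod_factor inE big_cons.
  have [->|ik] := eqVneq i k; first by rewrite eq_sym (negPf ok) (negPf ks) mul1r.
  by case: (eqVneq i o) => [_|io]; [rewrite invfM mulrC|rewrite mulr1].
have b' := biholo_near near_eq (biholo_comp bS bT).
split; first by exists (fun w => Ti (Si w)).
have [h' _ _ _ _] := b'; have [h'' _ _ _ _] := biholo_comp bS bT.
apply: (near_preserves_periods h'' h' near_eq).
apply: comp_preserves_periods hS S0 hT T0 _ pT.
exact: elem_preserves_periods.
Qed.

End Unimodular.
End Periods.
(** * Uniqueness *)

Section Uniqueness.
Context (R : realType).
Local Notation C := R[i].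
Local Opaque holo_at.

Lemma det_zero_col n (A : 'M[C]_n) i : (forall l, A l i = 0) -> \det A = 0.
Proof. by move=> h; rewrite (expand_det_col A i) big1// => l _; rewrite h mul0r. Qed.

Lemma pd_coord_mul0 n (j l : 'I_n) (u f : 'rV[C]_n -> C) : holo_at 0 u ->
  (\forall z \near (0 : 'rV[C]_n), f z = z 0 j * u z) -> pd l f 0 = u 0 * (j == l)%:R.
Proof.
move=> hu fu; rewrite (pd_near _ fu).
have dc := @differentiable_coord C 1 n 0 0 j.
rewrite (pd_mul _ dc (nbhs_singleton (holo_diff hu))) mxE mul0r add0r.
by rewrite pd_coord.
Qed.

Lemma coord_prod_neq0 n : ~ \forall z \near (0 : 'rV[C]_n), coord_prod z = 0.
Proof.
move=> /near0P[r r0 h]; have := h (const_mx r).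
have -> : coord_prod (const_mx r : 'rV[C]_n) = r ^+ n.
  by rewrite /coord_prod (eq_bigr (fun=> r)) ?prodr_const ?card_ord// => i _; rewrite mxE.
move=> /(_ _)/eqP; rewrite expf_eq0 (gt_eqF r0) andbF => H.
by apply: notF; apply: H => i; rewrite mxE gtr0_norm.
Qed.

Section MonomialFactorization.
Variables (n : nat) (X : 'rV[C]_n -> 'rV[C]_n) (L : 'rV[C]_1 -> C).
Hypotheses (hX : holo_map_at 0 X) (L0 : L 0 = 0).
Hypothesis XL : \forall w \near (0 : 'rV[C]_n), coord_prod (X w) = L (const_mx (coord_prod w)).

(* On [z_j = 0] the product of the components of [X] vanishes, hence one of them does. *)
Lemma component_factor j : exists i (u : 'rV[C]_n -> C), holo_at 0 u /\
  \forall z \near (0 : 'rV[C]_n), X z 0 i = z 0 j * u z.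
Proof.
pose pr := @scaling R n (fun i _ => (i != j)%:R).
have hpr : holo_map_at 0 pr.
  move=> i; have H := holo_mul (holo_coord i) (holo_const n ((i != j)%:R : C)).
  by rewrite (_ : (fun z => _) = (fun z : 'rV[C]_n => z 0 i * (i != j)%:R))//; apply/funext => z; rewrite mxE.
have pr0 : pr 0 = 0 by apply/rowP => i; rewrite !mxE mul0r.
have cpr z : coord_prod (pr z) = 0.
  by rewrite /coord_prod (bigD1 j)//= scalingE eqxx mulr0 mul0r.
have hF i : holo_at 0 (fun z => X (pr z) 0 i) := holo_map_comp hX hpr pr0 i.
have H := holo_map_continuous hpr pr0 XL.
have [|i hi] := @holo_domain_prod R n _ (index_enum 'I_n) (fun i z => X (pr z) 0 i) hF.
  apply: filterS H => z e; rewrite -[LHS]/(coord_prod (X (pr z))) e cpr.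
  by rewrite (_ : const_mx 0 = 0)//; apply/rowP => k; rewrite !mxE.
have [|u hu Xu] := holo_factor (hX i) (j := j); last by exists i, u.
apply: filterS hi => z Xz zj; rewrite -[RHS]Xz; congr (X _ 0 i).
apply/rowP => k; rewrite scalingE; have [->|kj] := eqVneq k j; first by rewrite zj mul0r.
by rewrite mulr1.
Qed.

Hypothesis dX : jdet X 0 != 0.

(** At 0 the gradient of the component attached to [j] is [u j 0] times the [j]-th basis covector.
    If [u j 0 = 0], or if one component were attached to two indices, a column of the Jacobian at 0
    would vanish. *)
Lemma monomial_factor : exists (s : 'S_n) (u : 'I_n -> 'rV[C]_n -> C),
  [/\ forall j, holo_at 0 (u j), forall j, u j 0 != 0 &
   forall j, \forall z \near (0 : 'rV[C]_n), X z 0 (s j) = z 0 j * u j z].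
Proof.
have [sg hsg] := choice component_factor; have [u hu] := choice hsg.
have dX0 := nbhs_singleton (holo_map_diff hX).
have col j l : pd l (fun z => X z 0 (sg j)) 0 = u j 0 * (j == l)%:R.
  by case: (hu j) => h1 h2; exact: pd_coord_mul0 h1 h2.
have JE l i : jacobian X 0 l i = pd l (fun z => X z 0 i) 0.
  exact: jacobianE (differentiable_row dX0).
have u0 j : u j 0 != 0.
  apply/eqP => uj; move: dX; rewrite jdet.unlock (@det_zero_col _ _ (sg j)) ?eqxx// => l.
  by rewrite JE col uj mul0r.
have sgI : injective sg.
  move=> j k e; apply/eqP/negPn/negP => jk.
  move: dX; rewrite jdet.unlock (@det_zero_col _ _ (sg j)) ?eqxx// => l.
  rewrite JE; have [lj|lj] := eqVneq j l.
    by rewrite e col -lj eq_sym (negPf jk) mulr0.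
  by rewrite col (negPf lj) mulr0.
exists (perm sgI), u; split.
- by move=> j; have [hj _] := hu j; exact: hj.
- exact: u0.
- by move=> j; rewrite permE; have [_ hj] := hu j; exact: hj.
Qed.

End MonomialFactorization.

Lemma coord_prod_unimod n (o : 'I_n) (u : 'I_n -> 'rV[C]_n -> C) w :
  (forall j, u j w != 0) ->
  coord_prod (unimod o u [seq j <- enum 'I_n | j != o] w) = coord_prod w.
Proof.
move=> uw; set s := [seq _ <- _ | _].
have -> : coord_prod (unimod o u s w) = coord_prod w * \prod_i unimod_factor o u s i w.
  by rewrite /coord_prod -big_split; apply: eq_bigr => i _; rewrite scalingE.
rewrite (bigD1 o)//= [unimod_factor o u s o w]/unimod_factor eqxx.
have -> : \prod_(i < n | i != o) unimod_factor o u s i w = \prod_(j <- s) u j w.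
  rewrite big_filter big_enum_cond /=; apply: eq_bigr => i io.
  by rewrite /unimod_factor (negPf io) mem_filter io mem_enum.
rewrite mulVf ?mulr1//.
by rewrite big_filter prodf_seq_neq0; apply/allP => j _; apply/implyP => _; exact: uw.
Qed.

(** After a permutation of its components, [X] is the composite of a radial map with factor [mu],
    where [L = t mu], and of a product of torus substitutions. The latter preserves periods, and its
    Jacobian turns out to be a function of P, which forces it to be 1. *)
Lemma radial_unique n (o : 'I_n) (X Xi : 'rV[C]_n -> 'rV[C]_n) (L : 'rV[C]_1 -> C) :
  biholo X Xi -> (\forall w \near (0 : 'rV[C]_n), jdet X w = 1) ->
  holo_at 0 L -> L 0 = 0 ->
  (\forall w \near (0 : 'rV[C]_n), coord_prod (X w) = L (const_mx (coord_prod w))) ->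
  exists b : bool, \forall t \near (0 : 'rV[C]_1), L t = (-1) ^+ b * t 0 0.
Proof.
move=> [hX _ [X0 _] _ _] dX hL L0 XL.
have n0 : (0 < n)%N by case: o => i; exact: leq_trans.
have [|s [u [hu u0 Xu]]] := monomial_factor hX L0 XL.
  by rewrite (nbhs_singleton dX) oner_neq0.
exists (odd_perm s); set eps := (-1) ^+ odd_perm s.
have eps0 : eps != 0 by rewrite /eps signr_eq0.
(* Reordering the components by [s] leaves each coordinate multiplied by a unit, and changes the
   Jacobian by the sign of [s]. *)
pose Xt w : 'rV[C]_n := \row_j X w 0 (s j).
have hXt : holo_map_at 0 Xt.
  by move=> j; rewrite (_ : (fun z => _) = (fun z => X z 0 (s j))); [exact: hX|apply/funext => z; rewrite mxE].
have dXt : \forall w \near (0 : 'rV[C]_n), jdet Xt w = eps.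
  apply: filterS (filterI dX (filterI (holo_map_diff hX) (holo_map_diff hXt))) => w [e [d dt]].
  have -> : eps = eps * jdet X w by rewrite e mulr1.
  rewrite jdet.unlock -[eps]/((-1) ^+ odd_perm s) -odd_permV -(@det_perm C).
  rewrite mulrC -det_mulmx -col_permE; congr (\det _); apply/matrixP => l j.
  rewrite [RHS]mxE; apply: (etrans (jacobianE l j (differentiable_row dt))).
  apply: (etrans _ (esym (jacobianE l (s j) (differentiable_row d)))).
  by rewrite (_ : (fun z => Xt z 0 j) = (fun z => X z 0 (s j)))//; apply/funext => z; rewrite mxE.
have c0 := @coord_prod0 R n o.
have [|mu hmu Lmu] := @holo_factor R 1 0 L hL.
  by apply/near0P; exists 1 => // t _ t0; rewrite (rV1E t) t0 -L0; congr L; apply/rowP => i; rewrite !mxE.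
have hP := holo_prodP R n.
(* Multiplied by P, both sides become the product of the components of [X]; P is cancelled in the
   integral domain of germs. *)
have near_mu : \forall w \near (0 : 'rV[C]_n), \prod_j u j w = mu (const_mx (coord_prod w)).
  have hprod : holo_at 0 (fun w => \prod_j u j w) := holo_prod _ _ hu.
  have hmuP := holo_comp1 hmu hP c0.
  have [||h] := holo_domain hP (holo_sub hprod hmuP); last first.
  - by apply: filterS h => w /eqP; rewrite subr_eq0 => /eqP.
  - by move=> h; case: (coord_prod_neq0 h).
  have H := near_forall Xu.
  apply: filterS (filterI H (filterI XL (rV1_near hP c0 Lmu))) => w [e1 [e2 e3]].
  rewrite mulrBr; apply/eqP; rewrite subr_eq0; apply/eqP.
  have <- : coord_prod (X w) = coord_prod w * mu (const_mx (coord_prod w)).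
    by rewrite e2 e3 mxE.
  rewrite /coord_prod [RHS](reindex_inj (@perm_inj _ s)) -big_split /=.
  by apply: eq_bigr => j _; rewrite e1.
have z0 : const_mx (coord_prod (0 : 'rV[C]_n)) = 0 :> 'rV[C]_1.
  by rewrite c0; apply/rowP => i; rewrite !mxE.
have mu0 : mu 0 != 0.
  rewrite -z0 -(nbhs_singleton near_mu) prodf_seq_neq0.
  by apply/allP => j _; apply/implyP => _; exact: u0.
pose sq := [seq j <- enum 'I_n | j != o].
have [|Y pY] := @unimod_preserves_periods R n o u hu u0 sq (filter_uniq _ (enum_uniq _)).
  by rewrite mem_filter eqxx.
case: Y => Yi [hY _ [Y0 _] _ _].
have near_u := near_forall (fun j => holo_ne0 (hu j) (u0 j)).
have hK := holo_radial o hmu.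
(* At [o] the factor [mu(P)] is the product of all [u j], and [unimod] divides by those with
   [j != o], so that [u o] is left. *)
have XtE : \forall w \near (0 : 'rV[C]_n), radial o mu (unimod o u sq w) = Xt w.
  apply: filterS (filterI near_u (filterI near_mu (near_forall Xu))) => w [uw [e1 e2]].
  apply/rowP => i; rewrite [LHS]scalingE [unimod _ _ _ _ _ _]scalingE mxE e2 -mulrA; congr (_ * _).
  rewrite /radial_factor /unimod_factor coord_prod_unimod// -e1.
  have [->|io] := eqVneq i o; last by rewrite mem_filter io mem_enum mulr1.
  rewrite (bigD1 o)//= [X in _ * X = _](_ : _ = u o w * \prod_(j <- sq) u j w).
    rewrite mulrCA mulVf ?mulr1//.
    by rewrite big_filter prodf_seq_neq0; apply/allP => j _; apply/implyP => _; exact: uw.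
  by rewrite big_filter big_enum_cond.
pose D := pd 0 (fun t : 'rV[C]_1 => t 0 0 * mu t).
have hD : holo_at 0 D := holo_pd 0 (holo_mul (holo_coord 0) hmu).
have hKY := holo_map_comp hK hY Y0.
have DY : \forall w \near (0 : 'rV[C]_n),
    jdet (unimod o u sq) w * D (const_mx (coord_prod w)) = eps.
  have H1 := holo_map_continuous hY Y0 (det_radial o hmu mu0).
  have H2 := det_jacobian_near hKY hXt XtE.
  have H3 := det_jacobian_comp hK hY Y0.
  apply: filterS (filterI near_u (filterI H1 (filterI H2 (filterI H3 dXt)))).
  move=> w [uw [e1 [e2 [e3 e4]]]].
  by rewrite -e4 -e2 e3 e1 coord_prod_unimod.
have D0 : D 0 != 0.
  have := nbhs_singleton DY; rewrite z0 => e; apply/eqP => D0.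
  by move: eps0; rewrite -e D0 mulr0 eqxx.
have hf : holo_at 0 (fun t => eps * (D t)^-1 - 1).
  exact: holo_sub (holo_scale _ (holo_inv hD D0)) (holo_const _ _).
have Deps : \forall t \near (0 : 'rV[C]_1), D t = eps.
  (* The density 1 pulls back to the Jacobian of [unimod], which equals [eps / D(P)]. Its difference
     with 1 has no diagonal coefficients and is a function of P. *)
  have f0 : \forall t \near (0 : 'rV[C]_1), eps * (D t)^-1 - 1 = 0.
    apply: (diag0_radial n0 hf); apply: diag0_near (pY _ (holo_const n 1)) _.
    have H := rV1_near hP c0 (holo_ne0 hD D0).
    by apply: filterS (filterI DY H) => w [<- Dw]; rewrite mulfK// mul1r.
  apply: filterS (filterI f0 (holo_ne0 hD D0)) => t [e Dt].
  by apply/esym/(divIf Dt); rewrite divff//; apply/eqP; rewrite -subr_eq0 e.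
have hk : holo_at 0 (fun t : 'rV[C]_1 => t 0 0 * mu t - eps * t 0 0).
  exact: holo_sub (holo_mul (holo_coord _) hmu) (holo_scale _ (holo_coord _)).
have k0 : \forall t \near (0 : 'rV[C]_1), (t : 'rV[C]_1) 0 0 * mu t - eps * t 0 0 = 0.
  apply: (pd_zero hk); first by rewrite !mxE mul0r mulr0 subrr.
  have H1 := holo_diff (holo_mul (holo_coord (0 : 'I_1)) hmu).
  have H2 := holo_diff (holo_scale eps (@holo_coord R 1 0)).
  apply: filterS (filterI Deps (filterI H1 H2)) => t [e [d1 d2]].
  have dc := @differentiable_coord C 1 1 t 0 0.
  have dk : differentiable (fun _ : 'rV[C]_1 => eps) t by exact: differentiable_cst.
  rewrite (pd_sub _ d1 d2) (pd_mul _ dk dc) pd_const pd_coord eqxx mulr1 mulr0 addr0.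
  by apply/eqP; rewrite subr_eq0; apply/eqP; exact: e.
by apply: filterS (filterI k0 Lmu) => t [/eqP + ->]; rewrite subr_eq0 => /eqP.
Qed.

(** The point [- t] is included for the case of the sign -1 in [radial_unique]. *)
Lemma near_rV1 (P : 'rV[C]_1 -> Prop) : (\forall t \near (0 : 'rV[C]_1), P t) ->
  \forall t \near (0 : C), P (const_mx t) /\ P (const_mx (- t)).
Proof.
move=> /near0P[r r0 h]; apply/nbhs_ballP; exists r => // t.
rewrite -ball_normE /= sub0r normrN => /ltW tr.
by split; apply: h => i; rewrite mxE ?normrN.
Qed.

End Uniqueness.

Theorem corollary1 (R : realType) (n : nat) (n_ge2 : (2 <= n)%N)
  (* volume form Omega = a dz_1 /\ ... /\ dz_n *)
  (a : 'rV[R[i]]_n -> R[i]) (a_holo : holo_at 0 a) (a0 : a 0 != 0)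
  (F H : 'rV[R[i]]_n -> R)
  (F_irr : ra_irreducible F)
  (F_codim1 : real_codim1 (real_zero F))
  (F_sing : real_sing F 0)
  (F_levi : levi_flat F)
  (H_ra : ra_at 0 H)
  (H_order : (fun z : 'rV[R[i]]_n => (H z)%:C) =O_ (nbhs (0 : 'rV[R[i]]_n))
             (fun z : 'rV[R[i]]_n => `|z| ^+ n.+1))
  (F_eq : \forall z \near (0 : 'rV[R[i]]_n), F z = complex.Re (coord_prod z) + H z)
  (FC : 'rV[R[i]]_(n + n) -> R[i]) (FC_def : complexification F FC)
  (singMC : \forall x \near (0 : 'rV[R[i]]_(n + n)), cplx_sing FC x <-> V_union x)
  (singMC_LC : \forall x \near (0 : 'rV[R[i]]_(n + n)), cplx_sing FC x -> cplx_levi_sing FC x)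
  (f : 'rV[R[i]]_n -> R[i])
  (f_order : (fun z : 'rV[R[i]]_n => f z - coord_prod z)
             =O_ (nbhs (0 : 'rV[R[i]]_n))
             (fun z : 'rV[R[i]]_n => `|z| ^+ n.+1))
  (om : 'rV[R[i]]_n -> 'rV[R[i]]_n) (om_fol : foliation om)
  (om_tangent : tangent_to om F)
  (f_int : first_integral f om)
  (M_eq : \forall z \near (0 : 'rV[R[i]]_n), real_zero F z <-> complex.Re (f z) = 0)
  (f_prod : right_equivalent f (@coord_prod R n)) :
  exists (Phi Phii : 'rV[R[i]]_n -> 'rV[R[i]]_n) (Psi : R[i] -> R[i]),
    [/\ biholo Phi Phii /\ volume_preserving a Phi,
        automorphism1 Psi,
        germ_image Phi (real_zero F)
          [set z | complex.Re (Psi (coord_prod z)) = 0],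
        \forall z \near (0 : 'rV[R[i]]_n), f (Phii z) = Psi (coord_prod z) &
        forall (Phi' Phii' : 'rV[R[i]]_n -> 'rV[R[i]]_n) (Psi' : R[i] -> R[i]),
          biholo Phi' Phii' -> volume_preserving a Phi' ->
          automorphism1 Psi' ->
          (\forall z \near (0 : 'rV[R[i]]_n), f (Phii' z) = Psi' (coord_prod z)) ->
          (\forall t \near (0 : R[i]), Psi' t = Psi t) \/
          (\forall t \near (0 : R[i]), Psi' t = Psi (- t))].
Proof.
pose o : 'I_n := Ordinal (ltnW n_ge2).
have [phi [phii [bphi fphi]]] := f_prod.
have [hphi hphii [phi0 phii0] phiiK phiK] := bphi.
(* The density of Omega in the coordinates [phi], in which [f] is the product P. *)
pose b w := a (phii w) * jdet phii w.
have hb : holo_at 0 b := holo_mul (holo_comp a_holo hphii phii0) (holo_det_jacobian hphii).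
have b0 : b 0 != 0.
  rewrite /b phii0 mulf_neq0//; have := nbhs_singleton (det_jacobian_inv bphi).
  by rewrite phi0 => e; apply/eqP => d0; move: e; rewrite d0 mulr0 => /esym/eqP; rewrite oner_eq0.
have [X [Xi [L [bX [hL L0 dL] dX PX]]]] := volume_normal_form o hb b0.
have [hX hXi [X0 Xi0] XiK XK] := bX.
pose Lm t : R[i] := L (const_mx t).
have hLm : holo_map_at 0 (rV1_map Lm).
  move=> j; rewrite (_ : (fun t => _) = L)//; apply/funext => t.
  by rewrite mxE /Lm -rV1E.
have Lm0 : rV1_map Lm 0 = 0.
  apply/rowP => i; rewrite !mxE /Lm -L0; congr L.
  by apply/rowP => k; rewrite !mxE.
(* [G] inverts [L]: since [P o X = L(P)], the relation [P o Xi = G(P)] follows, and [G] is the germ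
   [Psi]. *)
have [|G bG] := inverse_function hLm Lm0.
  have dLm := nbhs_singleton (holo_map_diff hLm).
  rewrite jdet.unlock det_mx11 (jacobianE _ _ (differentiable_row dLm)).
  rewrite (_ : (fun t => _) = L)//; apply/funext => t.
  by rewrite mxE /Lm -rV1E.
have [_ hG [_ G0] GK KG] := bG.
pose Psi t := G (const_mx t) 0 0.
have PsiE : rV1_map Psi = G.
  by apply/funext => t; rewrite /rV1_map /Psi -(rV1E (G _)) -rV1E.
pose Phi z := X (phi z); pose Phii z := phii (Xi z).
have bPhi : biholo Phi Phii := biholo_comp bX bphi.
have [hPhi hPhii [Phi0 Phii0] PhiiK PhiK] := bPhi.
have fPhii : \forall z \near (0 : 'rV[R[i]]_n), f (Phii z) = Psi (coord_prod z).
  have H1 := holo_map_continuous hXi Xi0 fphi.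
  have H2 := holo_map_continuous hXi Xi0 PX.
  have H3 := rV1_near (holo_prodP R n) (coord_prod0 R o) GK.
  have H4 := holo_map_continuous hXi Xi0 (rV1_near (holo_prodP R n) (coord_prod0 R o) GK).
  apply: filterS (filterI H1 (filterI H2 (filterI H4 XK))) => z [e1 [e2 [e4 e5]]].
  rewrite /Phii e1 /Psi -{2}e5 e2.
  by move: e4; rewrite /rV1_map /Lm mxE => ->; rewrite mxE.
have vPhi : \forall z \near (0 : 'rV[R[i]]_n), jdet Phi z = a z.
  have H1 := holo_map_continuous hphi phi0 dX.
  apply: filterS (filterI H1 (filterI (det_jacobian_comp hX hphi phi0)
    (filterI (det_jacobian_inv bphi) phiiK))) => z [e1 [e2 [e3 e4]]].
  by rewrite /Phi e2 e1 /b e4 mulrCA e3 mulr1.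
have dPhii : \forall z \near (0 : 'rV[R[i]]_n), a (Phii z) * jdet Phii z = 1.
  have H9 := holo_map_continuous hPhii Phii0 vPhi.
  apply: filterS (filterI H9 (det_jacobian_inv (biholo_sym bPhi))) => z [<- e].
  by rewrite mulrC.
exists Phi, Phii, Psi; split.
- by split=> //; rewrite jdet.unlock in vPhi.
- exists Lm; rewrite PsiE; exact: biholo_sym.
(* On this neighbourhood [M] is given by [Re f = 0] and [Phii] inverts [Phi] pointwise, so points of
   [Phi (M /\ U)] can be traced back to [M]. *)
- exists [set z | (real_zero F z <-> complex.Re (f z) = 0) /\ Phii (Phi z) = z].
  split; first exact: filterI M_eq PhiiK.
  move=> U U0 UU.
  have H1 := holo_map_continuous hPhii Phii0 U0.
  apply: filterS (filterI H1 (filterI PhiK fPhii)) => z [Uz [e1 e2]]; split.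
    move=> [y [My Uy] yz]; have [My' yK] := UU _ Uy.
    by rewrite /= -e2 -yz yK; apply/My'.
  rewrite /= -e2 => Rz; exists (Phii z) => //; split=> //.
  by have [Mz _] := UU _ Uz; apply/Mz.
- exact: fPhii.
move=> Phi' Phii' Psi' bPhi' vPhi' [Psii' bPsi'] fPhii'.
have [hPhi' hPhii' [Phi'0 Phii'0] Phii'K Phi'K] := bPhi'.
have [hPsi' hPsii' [Psi'0 Psii'0] Psii'K Psi'K] := bPsi'.
(* The comparison map of the two solutions: it preserves [dz], and it sends P to [K(P)] with [K] the
   composite of [Psi] and the inverse of [Psi']. *)
pose Y z := Phi' (Phii z).
have bY : biholo Y (fun z => Phi (Phii' z)) := biholo_comp bPhi' (biholo_sym bPhi).
have [hY _ [Y0 _] _ _] := bY.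
have dY : \forall z \near (0 : 'rV[R[i]]_n), jdet Y z = 1.
  have vPhi'' : \forall z \near (0 : 'rV[R[i]]_n), jdet Phi' z = a z by rewrite jdet.unlock.
  have H9 := holo_map_continuous hPhii Phii0 vPhi''.
  apply: filterS (filterI H9 (filterI dPhii (det_jacobian_comp hPhi' hPhii Phii0))) => z [e1 [e2 e3]].
  by rewrite /Y e3 e1 mulrC.
pose K (t : 'rV[R[i]]_1) := rV1_map Psii' (G t) 0 0.
have hK : holo_at 0 K := holo_map_comp hPsii' hG G0 0.
have K0 : K 0 = 0 by rewrite /K G0 Psii'0 mxE.
have hPP : holo_at 0 (@coord_prod R n) := holo_prodP R n.
have c0 := coord_prod0 R o.
have YK : \forall w \near (0 : 'rV[R[i]]_n), coord_prod (Y w) = K (const_mx (coord_prod w)).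
  have H1 := holo_map_continuous hY Y0 fPhii'.
  have H2 := holo_map_continuous hPhii Phii0 Phii'K.
  have H3 := holo_map_continuous hY Y0 (rV1_near hPP c0 Psii'K).
  apply: filterS (filterI H1 (filterI H2 (filterI H3 fPhii))) => w [e1 [e2 [e3 e4]]].
  have e5 : Psi' (coord_prod (Y w)) = Psi (coord_prod w) by rewrite -e1 -e4 /Y e2.
  have /rowP/(_ 0) := e3; rewrite /K -PsiE /rV1_map !mxE e5 => <-.
  by [].
have [s Ks] := radial_unique o bY dY hK K0 YK.
have GK' : \forall t \near (0 : 'rV[R[i]]_1), Psi' (K t) = Psi (t 0 0).
  have H9 := holo_map_continuous hG G0 Psi'K.
  apply: filterS H9 => t /rowP/(_ 0); rewrite /K /rV1_map !mxE => ->.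
  by rewrite /Psi -rV1E.
have KG' : \forall t \near (0 : 'rV[R[i]]_1),
    K t = (-1) ^+ s * t 0 0 /\ Psi' (K t) = Psi (t 0 0) by exact: filterI Ks GK'.
have := near_rV1 KG'.
(* For the sign -1 the relation [Psi' (K t) = Psi t] is read at [- t], where [K (- t) = t]; for the
   sign +1 it is read at [t]. *)
case: s {Ks KG'} => h; [right|left]; apply: filterS h => t [[e1 e2] [e3 e4]].
  by move: e4; rewrite e3 !mxE expr1 mulN1r opprK.
by move: e2; rewrite e1 !mxE expr0 mul1r.
Qed.
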